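(* If $f\in L^1(\mathbb{H})$, then for all $n\in\mathbb{Z}\setminus\{0\}$ and all $\lambda>0$, $$\left(\mathcal{F}_{\mathbb{H}/\Gamma_\lambda}(I_\lambda f)\right)(n)=\frac{2\pi}{\lambda}\,\mathcal{J}_n\circ\left(\mathcal{F}_{\mathbb{H}}f\right)(n\lambda^2)$$ as operators on $\mathcal{H}$.
   Context: The Heisenberg group is $\mathbb{H}=\mathbb{C}\times\mathbb{R}$ with group law $(x+iy,t)(u+iv,s)=\left(x+u+i(y+v),\,t+s+\tfrac12(xv-yu)\right)$ and Haar measure equal to Lebesgue measure. For $\lambda>0$ put $R=1/\lambda$, $\gamma_\lambda(s)=\left(Re^{is/R},\tfrac12 sR\right)$, and $\Gamma_\lambda=\{(0,k\pi R^2):k\in\mathbb{Z}\}$, a central subgroup. $\mathbb{H}/\Gamma_\lambda$ carries the Haar measure $dx\,dy\,dt$ (Lebesgue measure on $\mathbb{C}\times[0,\pi R^2)$). For $f\in C_c(\mathbb{H})$, $I_\lambda f(z,t)=\int_{\mathbb{R}}f\left((z,t)\gamma_\lambda(s)\right)ds$, which is a function on $\mathbb{H}/\Gamma_\lambda$; $I_\lambda:L^1(\mathbb{H})\to L^1(\mathbb{H}/\Gamma_\lambda)$ is the bounded extension. Bargmann-Fock space is $\mathcal{H}=\{F:\mathbb{C}\to\mathbb{C}\text{ holomorphic}:\tfrac1\pi\int_{\mathbb{C}}|F(\zeta)|^2e^{-|\zeta|^2}d\zeta<\infty\}$ with the corresponding inner product. For $h>0$, $\beta_h(z,t)F(\zeta)=e^{2iht-\sqrt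 h\,\zeta\overline z-\frac h2|z|^2}F(\zeta+\sqrt h z)$, and $\beta_h(z,t)=\beta_{|h|}(\overline z,-t)$ for $h<0$; these are strongly continuous unitary representations of $\mathbb{H}$ on $\mathcal{H}$. For $f\in L^1(\mathbb{H})$ and $h\in\mathbb{R}\setminus\{0\}$, $\mathcal{F}_{\mathbb{H}}f(h)=\int_{\mathbb{H}}f(q)\beta_h(q)^*dq$, and for $g\in L^1(\mathbb{H}/\Gamma_\lambda)$ and $n\in\mathbb{Z}\setminus\{0\}$, $\mathcal{F}_{\mathbb{H}/\Gamma_\lambda}(g)(n)=\int_{\mathbb{H}/\Gamma_\lambda}g(q)\beta_{n\lambda^2}(q)^*dq$ (bounded operators on $\mathcal{H}$; Bochner integrals; $\beta_{n\lambda^2}$ is trivial on $\Gamma_\lambda$). For $n>0$, $\mathcal{J}_n:\mathcal{H}\to\mathcal{H}$ is $$\mathcal{J}_nF(\zeta)=\frac{1}{2\pi i}\left(\frac{1}{en}\right)^{n/2}\oint z^{n-1}e^{-n\zeta/z}F(\zeta+z)\,dz,$$ where the contour is a counterclockwise circle around the origin, and $\mathcal{J}_{-n}=\mathcal{J}_n$. *)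

(* Defs.v *)
From HB Require Import structures.
From mathcomp Require Import all_boot all_order all_algebra.
From mathcomp Require Import complex.
From mathcomp Require Import all_classical all_reals all_analysis.

Set Implicit Arguments.
Unset Strict Implicit.
Unset Printing Implicit Defensive.

Import Order.TTheory GRing.Theory Num.Theory.
Import numFieldNormedType.Exports.

Local Open Scope classical_set_scope.
Local Open Scope ring_scope.
Local Open Scope complex_scope.

(* ((x, y), t) stands for (x + iy, t) in C x R. *)
Notation heis R := (R * R * R)%type.

Section Complex.
Context {R : realType}.

Definition cexp (z : R[i]) : R[i] :=
  (expR (complex.Re z))%:C * (cos (complex.Im z) +i* sin (complex.Im z)).

Definition cnorm (z : R[i]) : R := ComplexField.Normc.normc z.

Section Integral.
Context {d : measure_display} {T : measurableType d}.
Variable mu : {measure set T -> \bar R}.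

Definition cintegrable (D : set T) (f : T -> R[i]) : Prop :=
  mu.-integrable D (fun x => (complex.Re (f x))%:E) /\
  mu.-integrable D (fun x => (complex.Im (f x))%:E).

Definition cintegral (D : set T) (f : T -> R[i]) : R[i] :=
  (Rintegral mu D (fun x => complex.Re (f x)))
  +i* (Rintegral mu D (fun x => complex.Im (f x))).

Definition L1norm (D : set T) (f : T -> R[i]) : \bar R :=
  (\int[mu]_(x in D) (cnorm (f x))%:E)%E.

End Integral.

Definition circle_integral (r : R) (g : R[i] -> R[i]) : R[i] :=
  cintegral (@lebesgue_measure R) `[0, 2 * pi]
    (fun theta => let z := r%:C * cexp ('i%C * theta%:C) in g z * ('i%C * z)).

End Complex.

Section Fock.
Context {R : realType}.

(* Lebesgue measure on C, identified with R x R. *)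
Definition plane_measure := ((@lebesgue_measure R) \x (@lebesgue_measure R))%E.

Definition holomorphic (F : R[i] -> R[i]) : Prop :=
  forall z, derivable (F : R[i]^o -> R[i]^o) z 1.

Definition gauss (w : R * R) : R := expR (- (w.1 ^+ 2 + w.2 ^+ 2)).

Definition fock (F : R[i] -> R[i]) : Prop :=
  holomorphic F /\
  ((pi^-1)%:E * \int[plane_measure]_w
     (cnorm (F (w.1 +i* w.2)) ^+ 2 * gauss w)%:E < +oo)%E.

Definition fock_dot (F G : R[i] -> R[i]) : R[i] :=
  (pi^-1)%:C * cintegral plane_measure setT
    (fun w => F (w.1 +i* w.2) * (G (w.1 +i* w.2))^*%C * (gauss w)%:C).

Definition fock_norm (F : R[i] -> R[i]) : R :=
  Num.sqrt (complex.Re (fock_dot F F)).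

(* Operators on Fock space are maps on functions C -> C; only their values on
   elements of [fock] are meaningful. *)
Definition fock_adjoint (T : (R[i] -> R[i]) -> (R[i] -> R[i]))
    (F : R[i] -> R[i]) : R[i] -> R[i] :=
  xget (fun=> 0) [set G | fock G /\
    forall K, fock K -> fock_dot (T K) F = fock_dot K G].

Section Bochner.
Context {d : measure_display} {T : measurableType d}.
Variables (mu : {measure set T -> \bar R}) (D : set T).

(* A list of pairs (A, v) represents the simple function q |-> \sum 1_A(q) v. *)
Definition fock_simple (s : seq (set T * (R[i] -> R[i]))) : Prop :=
  forall a, a \in s ->
    [/\ measurable a.1, (mu (a.1 `&` D) < +oo)%E & fock a.2].

Definition simple_eval (s : seq (set T * (R[i] -> R[i]))) (q : T) :
    R[i] -> R[i] :=
  fun zeta => \sum_(a <- s) (\1_(a.1) q)%:C * a.2 zeta.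

Definition simple_integral (s : seq (set T * (R[i] -> R[i]))) :
    R[i] -> R[i] :=
  fun zeta => \sum_(a <- s) (fine (mu (a.1 `&` D)))%:C * a.2 zeta.

(* V is the Bochner integral over D of the Fock-space-valued map Phi: Phi is
   an almost everywhere and L^1 limit of simple functions whose integrals
   converge to V in norm. *)
Definition is_bochner_integral (Phi : T -> R[i] -> R[i]) (V : R[i] -> R[i]) :
    Prop :=
  [/\ forall q, D q -> fock (Phi q), fock V &
   exists s : nat -> seq (set T * (R[i] -> R[i])),
   [/\ forall k, fock_simple (s k),
       {ae mu, forall q, D q ->
         (fun k => fock_norm (Phi q \- simple_eval (s k) q)) @ \oo --> (0 : R)},
       (fun k => \int[mu]_(q in D)
          (fock_norm (Phi q \- simple_eval (s k) q))%:E)%E @ \oo --> 0%E &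
       (fun k => fock_norm (V \- simple_integral (s k))) @ \oo --> (0 : R)]].

(* Equal to 0 when Phi is not Bochner integrable on D. *)
Definition bochner_integral (Phi : T -> R[i] -> R[i]) : R[i] -> R[i] :=
  xget (fun=> 0) (is_bochner_integral Phi).

End Bochner.
End Fock.

Section Heisenberg.
Context {R : realType}.

Definition hmul (p q : heis R) : heis R :=
  (p.1.1 + q.1.1, p.1.2 + q.1.2,
   p.2 + q.2 + 2^-1 * (p.1.1 * q.1.2 - p.1.2 * q.1.1)).

Definition heis_measure :=
  (((@lebesgue_measure R) \x (@lebesgue_measure R)) \x (@lebesgue_measure R))%E.

Definition Cc (u : heis R -> R[i]) : Prop :=
  continuous (u : heis R -> R[i]^o) /\ compact (closure [set q | u q != 0]).

Definition gamma (lambda s : R) : heis R :=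
  let r := lambda^-1 in (r * cos (s / r), r * sin (s / r), 2^-1 * s * r).

Definition Gamma (lambda : R) : set (heis R) :=
  [set q | exists k : int, q = (0, 0, k%:~R * pi * lambda^-1 ^+ 2)].

(* Functions on the quotient by Gamma are right Gamma-invariant functions on the
   group; they are integrated over this fundamental domain. *)
Definition Gamma_invariant (lambda : R) (g : heis R -> R[i]) : Prop :=
  forall q c, Gamma lambda c -> g (hmul q c) = g q.

Definition fund_domain (lambda : R) : set (heis R) :=
  [set q | 0 <= q.2 < pi * lambda^-1 ^+ 2].

Definition helix_integral (lambda : R) (f : heis R -> R[i]) (q : heis R) :
    R[i] :=
  cintegral (@lebesgue_measure R) setT (fun s => f (hmul q (gamma lambda s))).

(* g represents the value at f of the bounded extension to L^1 of
   [helix_integral] on C_c: it is the L^1 limit of the helix integrals of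
   some C_c sequence converging to f in L^1. *)
Definition is_Xray (lambda : R) (f g : heis R -> R[i]) : Prop :=
  [/\ Gamma_invariant lambda g,
      cintegrable heis_measure (fund_domain lambda) g &
   exists u : nat -> heis R -> R[i],
   [/\ forall k, Cc (u k),
       (fun k => L1norm heis_measure setT (u k \- f)) @ \oo --> 0%E &
       (fun k => L1norm heis_measure (fund_domain lambda)
                   (helix_integral lambda (u k) \- g)) @ \oo --> 0%E]].

(* A representative of the class I_lambda f in L^1 of the quotient. *)
Definition Xray (lambda : R) (f : heis R -> R[i]) : heis R -> R[i] :=
  xget (fun=> 0) (is_Xray lambda f).

Definition beta_pos (h : R) (q : heis R) (F : R[i] -> R[i]) : R[i] -> R[i] :=
  let z := q.1.1 +i* q.1.2 in
  fun zeta =>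
    cexp (2 * 'i%C * h%:C * (q.2)%:C - (Num.sqrt h)%:C * zeta * z^*%C
          - (h / 2 * cnorm z ^+ 2)%:C)
    * F (zeta + (Num.sqrt h)%:C * z).

(* Meaningful for h != 0 only. *)
Definition beta (h : R) (q : heis R) : (R[i] -> R[i]) -> (R[i] -> R[i]) :=
  if 0 < h then beta_pos h q
  else beta_pos `|h| (q.1.1, - q.1.2, - q.2).

Definition fourier_H (f : heis R -> R[i]) (h : R) (F : R[i] -> R[i]) :
    R[i] -> R[i] :=
  bochner_integral heis_measure setT
    (fun q zeta => f q * fock_adjoint (beta h q) F zeta).

Definition fourier_quot (lambda : R) (g : heis R -> R[i]) (n : int)
    (F : R[i] -> R[i]) : R[i] -> R[i] :=
  bochner_integral heis_measure (fund_domain lambda)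
    (fun q zeta => g q * fock_adjoint (beta (n%:~R * lambda ^+ 2) q) F zeta).

(* r is the radius of the contour. *)
Definition J (r : R) (n : int) (F : R[i] -> R[i]) : R[i] -> R[i] :=
  let m := `|n|%N in
  fun zeta =>
    (2 * pi%:C * 'i%C)^-1 * (((expR 1 * m%:R)^-1) `^ (m%:R / 2))%:C
    * circle_integral r
        (fun z => z ^+ m.-1 * cexp (- (m%:R * zeta / z)) * F (zeta + z)).

End Heisenberg.

(* Main.v *)
(** Put h = n lambda^2, m = |n| and V = (F_H f)(h) F. Evaluation at a point is
    bounded on Fock space and the adjoint of beta_h(q) is beta_h(q^-1), so both
    Fourier transforms can be computed pointwise, for instance
    V(zeta) = int_H f(q) (beta_h(q^-1) F)(zeta) dq. The helix satisfies
    gamma(s + 2 pi / lambda) = gamma(s) c, where c generates Gamma_lambda and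
    beta_h(c) = 1. Hence the integral of f(q gamma(s)) (beta_h(q^-1) F)(zeta)
    over R x (H / Gamma_lambda) unfolds to an integral over
    [0, 2 pi / lambda) x H, and the translation q -> q gamma(s)^-1 turns it into
    int_0^(2 pi / lambda) (beta_h(gamma(s)) V)(zeta) ds. On the other side the
    contour integral in J_n does not depend on the radius, and on the circle of
    radius sqrt m its integrand at z = sqrt m e^(i theta) is, up to the constant
    in J_n, (beta_h(gamma(theta / lambda)) V)(zeta) when n > 0; for n < 0
    the helix is run backwards.

    The facts about Fock space (evaluation bound, reproducing kernel) come from
    the mean value property, that is from Goursat's theorem on rectangles in the
    coordinate log z, and from the rotation invariance of the Gaussian. *)

From HB Require Import structures.
From mathcomp Require Import all_boot all_order all_algebra.
From mathcomp Require Import complex ring lra.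
From mathcomp Require Import all_classical all_reals all_analysis.
From mathcomp Require Import measurable_realfun.
Require Import Defs.

Set Implicit Arguments.
Unset Strict Implicit.
Unset Printing Implicit Defensive.

Import Order.TTheory GRing.Theory Num.Theory.
Import numFieldNormedType.Exports.

Local Open Scope classical_set_scope.
Local Open Scope ring_scope.
Local Open Scope complex_scope.

(** * Complex numbers and complex-valued integrals *)

(** Adjoints, Bochner integrals and [Xray] are all selected by [xget]. For each of them an explicit
    candidate has to be shown to meet the specification, and every other solution has to be compared
    with it. In Fock space the comparison rests on |G(z)| <= e^(|z|^2/2) ||G||: a limit in norm is a
    limit at every point. Existence needs honest simple functions, obtained by sampling the strongly
    continuous map q -> beta_h(q^-1) F at finitely many points. [Xray lambda f] is known only up to
    a null set, so it is used only when paired with q -> (beta_h(q^-1) F)(zeta), which is bounded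
    because beta_h is unitary.

    In w = log z circles become vertical segments, and the horizontal sides of a rectangle of height
    2 pi cancel by periodicity; this moves the contour to any radius. The radius sqrt m is forced:
    beta_h(gamma(s)) shifts zeta by sqrt h / lambda = sqrt m times a unit complex number. In the
    constant (1/(e m))^(m/2), the factor e^(-m/2) is e^(-h |z|^2 / 2) on the helix, and m^(-m/2)
    cancels the modulus of z^m. *)

Section ComplexNorm.
Context {R : realType}.
Implicit Types z w : R[i].

Lemma cnormE z : cnorm z = Num.sqrt (complex.Re z ^+ 2 + complex.Im z ^+ 2).
Proof. by case: z. Qed.

Lemma normC_cnorm z : `|z| = (cnorm z)%:C.
Proof. by rewrite normc_def cnormE. Qed.

Lemma cnorm_ge0 z : 0 <= cnorm z.
Proof. by rewrite cnormE sqrtr_ge0. Qed.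

Lemma cnorm_sqr z : cnorm z ^+ 2 = complex.Re z ^+ 2 + complex.Im z ^+ 2.
Proof. by rewrite cnormE sqr_sqrtr // addr_ge0 ?sqr_ge0. Qed.

Lemma cnormM z w : cnorm (z * w) = cnorm z * cnorm w.
Proof. exact: ComplexField.Normc.normcM. Qed.

Lemma cnormV z : cnorm z^-1 = (cnorm z)^-1.
Proof. exact: ComplexField.Normc.normcV. Qed.

Lemma cnormN z : cnorm (- z) = cnorm z.
Proof. exact: normcN. Qed.

Lemma cnormD z w : cnorm (z + w) <= cnorm z + cnorm w.
Proof. exact: le_normcD. Qed.

Lemma cnormB z w : cnorm (z - w) <= cnorm z + cnorm w.
Proof. by rewrite -(cnormN w) cnormD. Qed.

Lemma cnorm0 : cnorm (0 : R[i]) = 0.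
Proof. by rewrite cnormE /= expr0n /= addr0 sqrtr0. Qed.

Lemma cnorm_eq0 z : cnorm z = 0 -> z = 0.
Proof. exact: ComplexField.Normc.eq0_normc. Qed.

Lemma cnormR (r : R) : cnorm r%:C = `|r|.
Proof. by rewrite cnormE /= expr0n /= addr0 sqrtr_sqr. Qed.

Lemma cnormI : cnorm ('i%C : R[i]) = 1.
Proof. by rewrite cnormE /= expr0n /= add0r expr1n sqrtr1. Qed.

Lemma cnormJ z : cnorm z^*%C = cnorm z.
Proof. by case: z => a b; rewrite !cnormE /= sqrrN. Qed.

Lemma ReM z w : complex.Re (z * w) =
  complex.Re z * complex.Re w - complex.Im z * complex.Im w.
Proof. by case: z => a b; case: w. Qed.

Lemma ImM z w : complex.Im (z * w) =
  complex.Re z * complex.Im w + complex.Im z * complex.Re w.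
Proof. by case: z => a b; case: w. Qed.

Lemma ReD z w : complex.Re (z + w) = complex.Re z + complex.Re w.
Proof. by case: z => a b; case: w. Qed.

Lemma ImD z w : complex.Im (z + w) = complex.Im z + complex.Im w.
Proof. by case: z => a b; case: w. Qed.

Lemma ReN z : complex.Re (- z) = - complex.Re z.
Proof. by case: z. Qed.

Lemma ImN z : complex.Im (- z) = - complex.Im z.
Proof. by case: z. Qed.

Lemma ReJ z : complex.Re z^*%C = complex.Re z.
Proof. by case: z. Qed.

Lemma ImJ z : complex.Im z^*%C = - complex.Im z.
Proof. by case: z. Qed.

Lemma complex_ext z w : complex.Re z = complex.Re w ->
  complex.Im z = complex.Im w -> z = w.
Proof. by case: z => a b; case: w => c d /= -> ->. Qed.

Lemma normRe_le z : `|complex.Re z| <= cnorm z.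
Proof.
rewrite -(@ler_pXn2r _ 2) ?nnegrE ?cnorm_ge0 //.
by rewrite cnorm_sqr real_normK ?num_real // lerDl sqr_ge0.
Qed.

Lemma normIm_le z : `|complex.Im z| <= cnorm z.
Proof.
rewrite -(@ler_pXn2r _ 2) ?nnegrE ?cnorm_ge0 //.
by rewrite cnorm_sqr real_normK ?num_real // lerDr sqr_ge0.
Qed.

Lemma cnorm_le z : cnorm z <= `|complex.Re z| + `|complex.Im z|.
Proof.
rewrite -(@ler_pXn2r _ 2) ?nnegrE ?cnorm_ge0 ?addr_ge0 // cnorm_sqr.
rewrite sqrrD !real_normK ?num_real //.
by have := mulr_ge0 (normr_ge0 (complex.Re z)) (normr_ge0 (complex.Im z)); lra.
Qed.

Lemma cnorm_sqrD z w : cnorm (z + w) ^+ 2 <= 2 * cnorm z ^+ 2 + 2 * cnorm w ^+ 2.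
Proof.
rewrite !cnorm_sqr ReD ImD.
have := sqr_ge0 (complex.Re z - complex.Re w).
have := sqr_ge0 (complex.Im z - complex.Im w).
by nra.
Qed.

Lemma mulJE z : z * z^*%C = (cnorm z ^+ 2)%:C.
Proof.
rewrite cnorm_sqr; apply: complex_ext; rewrite ?ReM ?ImM; case: z => a b /=; ring.
Qed.

Lemma RCD (a b : R) : (a + b)%:C = a%:C + b%:C.
Proof. by apply: complex_ext => /=; rewrite ?addr0. Qed.
Lemma RCM (a b : R) : (a * b)%:C = a%:C * b%:C.
Proof. by apply: complex_ext; rewrite ?ReM ?ImM /=; ring. Qed.
Lemma RCN (a : R) : (- a)%:C = - a%:C.
Proof. by apply: complex_ext => /=; rewrite ?oppr0. Qed.

Lemma cexpD z w : cexp (z + w) = cexp z * cexp w.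
Proof.
rewrite /cexp; case: z => a b; case: w => c d /=.
rewrite expRD cosD sinD.
by apply: complex_ext; rewrite !(ReM, ImM) /=; ring.
Qed.

Lemma cexp0 : cexp (0 : R[i]) = 1.
Proof. by rewrite /cexp /= expR0 cos0 sin0 mul1r. Qed.

Lemma cexpN z : cexp (- z) = (cexp z)^-1.
Proof.
have /eqP : cexp z * cexp (- z) = 1 by rewrite -cexpD subrr cexp0.
move=> /eqP h; have nz : cexp z != 0.
  by apply/eqP => e; move: h; rewrite e mul0r => /eqP; rewrite eq_sym oner_eq0.
by apply: (mulfI nz); rewrite h divff.
Qed.

Lemma cnorm_cexp z : cnorm (cexp z) = expR (complex.Re z).
Proof.
rewrite /cexp cnormM cnormR cnormE /= cos2Dsin2 sqrtr1 mulr1.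
by rewrite ger0_norm // expR_ge0.
Qed.

Lemma cexp_real (r : R) : cexp r%:C = (expR r)%:C.
Proof. by rewrite /cexp /= cos0 sin0 mulr1. Qed.

End ComplexNorm.

Section ComplexMeasurable.
Context {R : realType} {d : measure_display} {T : measurableType d}.
Implicit Types f g : T -> R[i].

(** Stated by coordinates to match [cintegrable] and [cintegral], which are also defined by
    coordinates. *)
Definition cmeas (f : T -> R[i]) : Prop :=
  measurable_fun setT (fun x => complex.Re (f x)) /\
  measurable_fun setT (fun x => complex.Im (f x)).

Lemma cmeas_cst z : cmeas (fun=> z).
Proof. by split; exact: measurable_cst. Qed.

Lemma cmeasD f g : cmeas f -> cmeas g -> cmeas (fun x => f x + g x).
Proof.
move=> [f1 f2] [g1 g2]; split.
- under eq_fun do rewrite ReD; exact: measurable_funD.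
- under eq_fun do rewrite ImD; exact: measurable_funD.
Qed.

Lemma cmeasN f : cmeas f -> cmeas (fun x => - f x).
Proof.
move=> [f1 f2]; split.
- under eq_fun do rewrite ReN; exact: measurable_funN.
- under eq_fun do rewrite ImN; exact: measurable_funN.
Qed.

Lemma cmeasB f g : cmeas f -> cmeas g -> cmeas (fun x => f x - g x).
Proof. by move=> mf mg; apply: cmeasD => //; exact: cmeasN. Qed.

Lemma cmeasM f g : cmeas f -> cmeas g -> cmeas (fun x => f x * g x).
Proof.
move=> [f1 f2] [g1 g2]; split.
- under eq_fun do rewrite ReM.
  by apply: measurable_funB; exact: measurable_funM.
- under eq_fun do rewrite ImM.
  by apply: measurable_funD; exact: measurable_funM.
Qed.

Lemma cmeasJ f : cmeas f -> cmeas (fun x => (f x)^*%C).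
Proof.
move=> [f1 f2]; split.
- by under eq_fun do rewrite ReJ.
- by under eq_fun do rewrite ImJ; exact: measurable_funN.
Qed.

Lemma cmeas_real (u : T -> R) : measurable_fun setT u -> cmeas (fun x => (u x)%:C).
Proof. by move=> mu; split => //=; exact: measurable_cst. Qed.

Lemma cmeas_pair (u v : T -> R) : measurable_fun setT u ->
  measurable_fun setT v -> cmeas (fun x => u x +i* v x).
Proof. by []. Qed.

Lemma cmeas_cexp f : cmeas f -> cmeas (fun x => cexp (f x)).
Proof.
move=> [f1 f2]; rewrite /cexp; apply: cmeasM.
  by apply: cmeas_real; apply: measurableT_comp => //; exact: measurable_expR.
split => /=; apply: measurableT_comp f2.
- exact: continuous_measurable_fun (@continuous_cos R).
- exact: continuous_measurable_fun (@continuous_sin R).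
Qed.

Lemma measurable_cnorm f : cmeas f -> measurable_fun setT (fun x => cnorm (f x)).
Proof.
move=> [f1 f2]; under eq_fun do rewrite cnormE.
apply: measurableT_comp; first exact: continuous_measurable_fun (@sqrt_continuous R).
by apply: measurable_funD; exact: measurable_funX.
Qed.

Lemma measurable_cnormE f : cmeas f ->
  measurable_fun setT (fun x => (cnorm (f x))%:E).
Proof. by move=> mf; apply/measurable_EFinP; exact: measurable_cnorm. Qed.

End ComplexMeasurable.

Lemma cmeas_comp {R : realType} d1 d2 (T1 : measurableType d1)
    (T2 : measurableType d2) (f : T2 -> R[i]) (phi : T1 -> T2) :
  cmeas f -> measurable_fun setT phi -> cmeas (fun x => f (phi x)).
Proof. by move=> [f1 f2] mp; split; [exact: (measurableT_comp f1 mp)|exact: (measurableT_comp f2 mp)]. Qed.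

Section ComplexIntegral.
Context {R : realType} {d : measure_display} {T : measurableType d}.
Variable mu : {measure set T -> \bar R}.
Implicit Types (f g : T -> R[i]) (D : set T).

(** The integral of a nonnegative function is a supremum over the simple functions below it, so
    monotonicity needs no measurability. This serves for integrands such as the Fock norms of
    approximation errors. *)
Lemma ge0_le_integral_nonmeas D (u v : T -> \bar R) :
  (forall x, D x -> (0 <= u x)%E) -> (forall x, D x -> (u x <= v x)%E) ->
  (\int[mu]_(x in D) u x <= \int[mu]_(x in D) v x)%E.
Proof.
move=> u0 uv; have v0 x : D x -> (0 <= v x)%E.
  by move=> Dx; exact: le_trans (u0 _ Dx) (uv _ Dx).
rewrite !ge0_integralE //; apply: ge_ereal_sup => _ [h /= hu <-].
apply: ereal_sup_ubound; exists h => //= x; apply: (le_trans (hu x)).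
rewrite !patchE; case: ifPn => // /set_mem; exact: uv.
Qed.

(** An integrable [u] is finite almost everywhere, so [fine] changes it on a null set only. This
    brings the inner integrals of Fubini's theorem back to real values. *)
Lemma cintegrable_ae_fine D (u : T -> \bar R) : measurable D ->
  mu.-integrable D u -> mu.-integrable D (EFin \o (fine \o u)) /\
  (\int[mu]_(x in D) u x = \int[mu]_(x in D) (fine (u x))%:E)%E.
Proof.
move=> mD iu; have mu' := measurable_int mu iu.
have mf : measurable_fun D (EFin \o (fine \o u)).
  by apply/measurable_EFinP; apply: measurableT_comp.
split.
  apply: (le_integrable mD mf _ iu) => x Dx /=.
  by case: (u x) => [r||] //=; rewrite ?lexx ?leey.
apply: ae_eq_integral => //.
have [N [mN N0 sN]] := integrable_ae mD iu.
exists N; split => //; apply: (subset_trans _ sN) => x /= h h2.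
by apply: h => Dx /=; rewrite fineK // h2.
Qed.

Lemma cintegrable_norm D f : measurable D -> cintegrable mu D f ->
  mu.-integrable D (fun x => (cnorm (f x))%:E).
Proof.
move=> mD [f1 f2].
have /integrable_abse i1 := f1; have /integrable_abse i2 := f2.
apply: (le_integrable mD _ _ (integrableD mD i1 i2)).
  apply/measurable_EFinP; under eq_fun do rewrite cnormE.
  apply: measurableT_comp; first exact: continuous_measurable_fun (@sqrt_continuous R).
  by apply: measurable_funD; apply: measurable_funX; apply/measurable_EFinP;
    [exact: measurable_int f1|exact: measurable_int f2].
move=> x Dx /=; rewrite lee_fin ger0_norm ?cnorm_ge0 // ger0_norm ?addr_ge0 //.
exact: cnorm_le.
Qed.

Lemma cintegrable_cmeas f : cintegrable mu setT f -> cmeas f.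
Proof.
by move=> [/integrableP[/measurable_EFinP ? _] /integrableP[/measurable_EFinP ? _]].
Qed.

Lemma cintegrableP f : cintegrable mu setT f <->
  cmeas f /\ (\int[mu]_x (cnorm (f x))%:E < +oo)%E.
Proof.
split=> [fi|[mf foo]].
  split; first exact: cintegrable_cmeas fi.
  have /integrableP[_] := cintegrable_norm measurableT fi.
  by under eq_integral do rewrite gee0_abs ?lee_fin ?cnorm_ge0 //.
have ic : mu.-integrable setT (fun x => (cnorm (f x))%:E).
  apply/integrableP; split; first exact: measurable_cnormE.
  by under eq_integral do rewrite gee0_abs ?lee_fin ?cnorm_ge0 //.
split; apply: le_integrable ic => //.
- by apply/measurable_EFinP; case: mf.
- by move=> x _; rewrite /= lee_fin [leRHS]ger0_norm ?cnorm_ge0 // normRe_le.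
- by apply/measurable_EFinP; case: mf.
- by move=> x _; rewrite /= lee_fin [leRHS]ger0_norm ?cnorm_ge0 // normIm_le.
Qed.

Lemma le_cintegrable f (g : T -> R) : cmeas f ->
  (forall x, cnorm (f x) <= g x) -> mu.-integrable setT (EFin \o g) ->
  cintegrable mu setT f.
Proof.
move=> mf fg /integrableP[mg ig]; apply/cintegrableP; split => //.
apply: le_lt_trans ig; apply: ge0_le_integral_nonmeas => x _.
  by rewrite lee_fin cnorm_ge0.
by rewrite /= lee_fin (le_trans (fg x)) // ler_norm.
Qed.

Lemma cintegrableD D f g : measurable D -> cintegrable mu D f ->
  cintegrable mu D g -> cintegrable mu D (fun x => f x + g x).
Proof.
move=> mD [f1 f2] [g1 g2]; split.
- by under eq_fun do rewrite ReD EFinD; exact: integrableD.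
- by under eq_fun do rewrite ImD EFinD; exact: integrableD.
Qed.

Lemma cintegralD D f g : measurable D -> cintegrable mu D f ->
  cintegrable mu D g ->
  cintegral mu D (fun x => f x + g x) = cintegral mu D f + cintegral mu D g.
Proof.
move=> mD [f1 f2] [g1 g2]; rewrite /cintegral.
under eq_fun do rewrite ReD; under [X in _ +i* Rintegral _ _ X]eq_fun do rewrite ImD.
by rewrite !RintegralD.
Qed.

Lemma cintegrableZ D (c : R[i]) f : measurable D -> cintegrable mu D f ->
  cintegrable mu D (fun x => c * f x).
Proof.
move=> mD [f1 f2]; split.
- under eq_fun do rewrite ReM EFinB.
  by apply: integrableB => //; under eq_fun do rewrite EFinM; exact: integrableZl.
- under eq_fun do rewrite ImM EFinD.
  by apply: integrableD => //; under eq_fun do rewrite EFinM; exact: integrableZl.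
Qed.

Lemma cintegralZ D (c : R[i]) f : measurable D -> cintegrable mu D f ->
  cintegral mu D (fun x => c * f x) = c * cintegral mu D f.
Proof.
move=> mD [f1 f2]; rewrite /cintegral.
have Z (a : R) (u : T -> R) : mu.-integrable D (EFin \o u) ->
    mu.-integrable D (EFin \o (fun x => a * u x)).
  by move=> iu; rewrite /comp; under eq_fun do rewrite EFinM; exact: integrableZl.
under eq_fun do rewrite ReM; under [X in _ +i* Rintegral _ _ X]eq_fun do rewrite ImM.
rewrite RintegralB ?RintegralD ?RintegralZl //; try exact: Z.
by apply: complex_ext; rewrite ?ReM ?ImM.
Qed.

Lemma cintegrableB D f g : measurable D -> cintegrable mu D f ->
  cintegrable mu D g -> cintegrable mu D (fun x => f x - g x).
Proof.
move=> mD fi gi; apply: cintegrableD => //.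
by under eq_fun do rewrite -mulN1r; exact: cintegrableZ.
Qed.

Lemma cintegralB D f g : measurable D -> cintegrable mu D f ->
  cintegrable mu D g ->
  cintegral mu D (fun x => f x - g x) = cintegral mu D f - cintegral mu D g.
Proof.
move=> mD fi gi; have Ng : cintegrable mu D (fun x => -1 * g x).
  exact: cintegrableZ.
under eq_fun do rewrite -[- g _]mulN1r.
by rewrite cintegralD // cintegralZ // mulN1r.
Qed.

Lemma eq_cintegral D f g : (forall x, D x -> f x = g x) ->
  cintegral mu D f = cintegral mu D g.
Proof.
by move=> fg; rewrite /cintegral; congr (_ +i* _); apply: eq_Rintegral => x;
  rewrite inE => /fg ->.
Qed.

Lemma cintegral0 D : cintegral mu D (fun=> 0) = 0.
Proof. by rewrite /cintegral /Rintegral !integral0. Qed.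

Lemma eq_cintegrable D f g : measurable D -> (forall x, D x -> f x = g x) ->
  cintegrable mu D f -> cintegrable mu D g.
Proof.
by move=> mD fg [f1 f2]; split; [move: f1|move: f2]; apply: (eq_integrable mD) => x;
  rewrite inE => /fg ->.
Qed.

Lemma le_cnorm_cintegral D f : measurable D -> cintegrable mu D f ->
  cnorm (cintegral mu D f) <= \int[mu]_(x in D) cnorm (f x).
Proof.
move=> mD fi; have [I eI] : exists I, I = cintegral mu D f by eexists.
rewrite -eI.
have ge0 : 0 <= \int[mu]_(x in D) cnorm (f x).
  by apply: Rintegral_ge0 => x _; exact: cnorm_ge0.
have [I0|I0] := eqVneq (cnorm I) 0; first by rewrite I0.
have Ip : 0 < cnorm I by rewrite lt_neqAle eq_sym I0 cnorm_ge0.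
(* Rotating by the conjugate of the integral makes it real: |I|^2 is the integral of Re(conj(I) f),
   which is at most |I| times the integral of |f|. *)
have E : \int[mu]_(x in D) complex.Re (I^*%C * f x) = cnorm I ^+ 2.
  transitivity (complex.Re (cintegral mu D (fun x => I^*%C * f x))) => //.
  by rewrite cintegralZ // -eI mulrC mulJE.
have ic := cintegrable_norm mD fi.
rewrite -(ler_pM2l Ip) -expr2 -E -RintegralZl //.
apply: le_Rintegral => //.
- by have [] := cintegrableZ I^*%C mD fi.
- by rewrite /comp; under eq_fun do rewrite EFinM; exact: integrableZl.
- move=> x _; apply: (le_trans (ler_norm _)).
  by apply: (le_trans (normRe_le _)); rewrite cnormM cnormJ.
Qed.

Lemma le_cnorm_cintegralE D f : measurable D -> cintegrable mu D f ->
  ((cnorm (cintegral mu D f))%:E <= \int[mu]_(x in D) (cnorm (f x))%:E)%E.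
Proof.
move=> mD fi; have ic := cintegrable_norm mD fi.
rewrite -[leRHS]fineK ?lee_fin; first exact: le_cnorm_cintegral.
exact: integrable_fin_num.
Qed.

Definition cind D (x : T) : R[i] := (\1_D x)%:C.

Lemma cindE D x : D x -> cind D x = 1.
Proof. by move=> Dx; rewrite /cind indicE mem_set. Qed.

Lemma cindN D x : ~ D x -> cind D x = 0.
Proof. by move=> Dx; rewrite /cind indicE memNset. Qed.

Lemma cmeas_cind D : measurable D -> cmeas (cind D).
Proof. by move=> mD; apply: cmeas_real; exact: measurable_indic. Qed.

Lemma cnorm_cind_le1 D x : cnorm (cind D x) <= 1.
Proof. by rewrite /cind cnormR indicE; case: (_ \in _); rewrite ?normr1 ?normr0. Qed.

Lemma cintegral_cind D f :
  cintegral mu D f = cintegral mu setT (fun x => cind D x * f x).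
Proof.
rewrite /cintegral !(Rintegral_mkcond _ D) /cind.
by congr (_ +i* _); apply: eq_Rintegral => x _; rewrite patchE indicE;
  rewrite ?ReM ?ImM; case: (_ \in _); rewrite /= ?mul1r ?mul0r ?subr0 ?addr0.
Qed.

Lemma cintegrable_cind D f : measurable D ->
  cintegrable mu D f <-> cintegrable mu setT (fun x => cind D x * f x).
Proof.
move=> mD; rewrite /cintegrable (propext (integrable_mkcond _ mD)) (propext (integrable_mkcond (fun x => (complex.Im _)%:E) mD)).
set A := (X in mu.-integrable _ X /\ _); set B := (X in _ /\ mu.-integrable _ X).
set C := (X in _ <-> mu.-integrable _ X /\ _); set E := (X in _ <-> _ /\ mu.-integrable _ X).
suff : A = C /\ B = E by move=> [-> ->].
split; apply/funext => x; rewrite /A /B /C /E /cind patchE indicE;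
  rewrite ?ReM ?ImM; case: (_ \in _); rewrite /= ?mul1r ?mul0r ?subr0 ?addr0 //.
Qed.

End ComplexIntegral.

(* The positive and negative parts of the real and imaginary parts suffice. *)
Lemma cintegral_transfer {R : realType} d1 d2 (T1 : measurableType d1)
    (T2 : measurableType d2) (m1 : {measure set T1 -> \bar R})
    (m2 : {measure set T2 -> \bar R}) (f1 : T1 -> R[i]) (f2 : T2 -> R[i]) :
  (forall u : R[i] -> R, (forall z, 0 <= u z) -> u 0 = 0 ->
    (forall d (T : measurableType d) (f : T -> R[i]), cmeas f ->
       measurable_fun setT (fun x => u (f x))) ->
    (\int[m1]_x (u (f1 x))%:E = \int[m2]_x (u (f2 x))%:E)%E) ->
  cintegral m1 setT f1 = cintegral m2 setT f2.
Proof.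
move=> H; rewrite /cintegral /Rintegral.
have pe (r : R) : (maxe r%:E 0 = (Num.max r 0)%:E)%E by rewrite EFin_max.
have E (p : R[i] -> R) (p0 : p 0 = 0) (mp : forall d (T : measurableType d) (f : T -> R[i]), cmeas f ->
       measurable_fun setT (fun x => p (f x))) :
    (\int[m1]_x (p (f1 x))%:E = \int[m2]_x (p (f2 x))%:E)%E.
  rewrite integralE [RHS]integralE; congr (_ - _)%E.
    under eq_integral do rewrite funeposE pe.
    under [RHS]eq_integral do rewrite funeposE pe.
    apply: (H (fun z => Num.max (p z) 0)).
    - by move=> z; rewrite le_max lexx orbT.
    - by rewrite p0 maxxx.
    - by move=> d T f mf; apply: measurable_maxr; [exact: mp|exact: measurable_cst].
  under eq_integral do rewrite funenegE -EFinN pe.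
  under [RHS]eq_integral do rewrite funenegE -EFinN pe.
  apply: (H (fun z => Num.max (- p z) 0)).
  - by move=> z; rewrite le_max lexx orbT.
  - by rewrite p0 oppr0 maxxx.
  - by move=> d T f mf; apply: measurable_maxr; [apply: measurable_funN; exact: mp|exact: measurable_cst].
by rewrite (E (@complex.Re R)) ?(E (@complex.Im R)) //; move=> d T f [].
Qed.

(** * Fubini's theorem for complex-valued functions, and measure-preserving maps *)

Section Fubini.
Context {R : realType} {d1 d2 : measure_display}.
Context {T1 : measurableType d1} {T2 : measurableType d2}.
Variable m1 : {sigma_finite_measure set T1 -> \bar R}.
Variable m2 : {sigma_finite_measure set T2 -> \bar R}.

Let RFub1 (f : T1 * T2 -> R) : (m1 \x m2)%E.-integrable setT (EFin \o f) ->
  m1.-integrable setT (EFin \o (fun x => Rintegral m2 setT (fun y => f (x, y)))) /\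
  Rintegral m1 setT (fun x => Rintegral m2 setT (fun y => f (x, y)))
  = Rintegral (m1 \x m2)%E setT f.
Proof.
move=> fi; have iF := integrable_fubini_F fi.
have [i1 e1] := cintegrable_ae_fine measurableT iF.
by split => //; rewrite {1}/Rintegral -e1 (integral12_prod_meas1 fi).
Qed.

Let RFub2 (f : T1 * T2 -> R) : (m1 \x m2)%E.-integrable setT (EFin \o f) ->
  m2.-integrable setT (EFin \o (fun y => Rintegral m1 setT (fun x => f (x, y)))) /\
  Rintegral m2 setT (fun y => Rintegral m1 setT (fun x => f (x, y)))
  = Rintegral (m1 \x m2)%E setT f.
Proof.
move=> fi; have mf := measurable_int _ fi.
(* [fubini_G] of [f] is [fubini_F] of [f] with its arguments swapped; the swapped function is
   integrable because its iterated integral in the other order is finite. *)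
have iF : m2.-integrable setT (fubini_G m1 (EFin \o f)).
  have ms : measurable_fun setT (fun z : T2 * T1 => (f (z.2, z.1))%:E).
    apply: (measurableT_comp mf).
    by apply: measurable_fun_pair; [exact: measurable_snd|exact: measurable_fst].
  apply: (@integrable_fubini_F _ _ _ _ R m2 m1 (fun z => (f (z.2, z.1))%:E)).
  apply/(integrable12ltyP _ _ ms) => /=.
  exact/(integrable21ltyP _ _ mf).
have [i1 e1] := cintegrable_ae_fine measurableT iF.
by split => //; rewrite {1}/Rintegral -e1 (integral21_prod_meas1 fi).
Qed.

Lemma cintegrable_fubini2 f : cintegrable (m1 \x m2)%E setT f ->
  cintegrable m2 setT (fun y => cintegral m1 setT (fun x => f (x, y))).
Proof.
by move=> [f1 f2]; split; [exact: (RFub2 f1).1|exact: (RFub2 f2).1].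
Qed.

Lemma cintegral_fubini1 f : cintegrable (m1 \x m2)%E setT f ->
  cintegral m1 setT (fun x => cintegral m2 setT (fun y => f (x, y)))
  = cintegral (m1 \x m2)%E setT f.
Proof.
by move=> [f1 f2]; rewrite /cintegral /= (RFub1 f1).2 (RFub1 f2).2.
Qed.

Lemma cintegral_fubini2 f : cintegrable (m1 \x m2)%E setT f ->
  cintegral m2 setT (fun y => cintegral m1 setT (fun x => f (x, y)))
  = cintegral (m1 \x m2)%E setT f.
Proof.
by move=> [f1 f2]; rewrite /cintegral /= (RFub2 f1).2 (RFub2 f2).2.
Qed.

Lemma cintegral_fubini f : cintegrable (m1 \x m2)%E setT f ->
  cintegral m1 setT (fun x => cintegral m2 setT (fun y => f (x, y)))
  = cintegral m2 setT (fun y => cintegral m1 setT (fun x => f (x, y))).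
Proof. by move=> fi; rewrite cintegral_fubini1 // cintegral_fubini2. Qed.

Lemma cintegrable_prodP f : cintegrable (m1 \x m2)%E setT f <->
  cmeas f /\ (\int[m1]_x \int[m2]_y (cnorm (f (x, y)))%:E < +oo)%E.
Proof.
rewrite (propext (cintegrableP _ _)); split => -[mf fo]; split => //.
  rewrite -(fubini_tonelli1 (fun z => (cnorm (f z))%:E)) //.
    exact: measurable_cnormE.
  by move=> x; rewrite lee_fin cnorm_ge0.
rewrite fubini_tonelli1 //; first exact: measurable_cnormE.
by move=> x; rewrite lee_fin cnorm_ge0.
Qed.

End Fubini.

(** Invariance is asked of nonnegative integrals, the form in which Tonelli's theorem proves it
    fibre by fibre; complex integrals follow by [cintegral_transfer]. *)
Definition mpres {R : realType} {d} {T : measurableType d}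
    (mu : {measure set T -> \bar R}) (phi : T -> T) : Prop :=
  measurable_fun setT phi /\ forall g : T -> \bar R, measurable_fun setT g ->
    (forall x, 0 <= g x)%E -> (\int[mu]_x g (phi x) = \int[mu]_x g x)%E.

Section ProductSigmaFinite.
Context {R : realType} {d1 d2 : measure_display}.
Context {T1 : measurableType d1} {T2 : measurableType d2}.
Variable m1 : {sigma_finite_measure set T1 -> \bar R}.
Variable m2 : {sigma_finite_measure set T2 -> \bar R}.

Lemma prod_sigma_finite : sigma_finite setT (m1 \x m2)%E.
Proof.
have /sigma_finiteP[F [TF ndF Foo]] := sigma_finiteT m1.
have /sigma_finiteP[G [TG ndG Goo]] := sigma_finiteT m2.
exists (fun n => F n `*` G n).
  rewrite -setXTT TF TG; apply/seteqP; split => -[x y].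
    (* Both exhausting sequences increase, so the two coordinates can share the larger index. *)
    move=> [/= [n _ Fnx] [k _ Gky]]; exists (maxn n k) => //; split => /=.
    - by move: x Fnx; exact/subsetPset/ndF/leq_maxl.
    - by move: y Gky; exact/subsetPset/ndG/leq_maxr.
  by move=> [n _ []/= Fx Gy]; split; exists n.
move=> k; have [mF Fk] := Foo k; have [mG Gk] := Goo k.
split; first exact: measurableX.
by rewrite product_measure1E // lte_mul_pinfty // ge0_fin_numE.
Qed.

(* The library's canonical sigma-finite structure on a product measure is
   shadowed by the one for probability measures. *)
Definition sfprod : {sigma_finite_measure set (T1 * T2)%type -> \bar R} :=
  HB.pack (m1 \x m2)%E
    (Measure_isSigmaFinite.Build _ _ _ (m1 \x m2)%E prod_sigma_finite).

End ProductSigmaFinite.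

Section MeasurePreserving.
Context {R : realType} {d : measure_display} {T : measurableType d}.
Variable mu : {measure set T -> \bar R}.
Implicit Types phi psi : T -> T.

Lemma mpres_comp phi psi : mpres mu phi -> mpres mu psi -> mpres mu (phi \o psi).
Proof.
move=> [m1 h1] [m2 h2]; split; first exact: measurableT_comp.
move=> g mg g0 /=; rewrite -[RHS]h1 //.
by apply: (h2 (g \o phi))  => [|x]; [exact: (measurableT_comp mg m1)|exact: g0].
Qed.

Lemma mpres_cintegral phi f : mpres mu phi -> cmeas f ->
  cintegral mu setT (fun x => f (phi x)) = cintegral mu setT f.
Proof.
move=> [mp hp] mf; apply: cintegral_transfer => u u0 _ mu'.
apply: (hp (fun x => (u (f x))%:E)); last by move=> x; rewrite lee_fin.
by apply/measurable_EFinP; exact: mu'.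
Qed.

Lemma mpres_cintegrable phi f : mpres mu phi -> cintegrable mu setT f ->
  cintegrable mu setT (fun x => f (phi x)).
Proof.
move=> [mp hp] /cintegrableP[mf fo]; apply/cintegrableP.
split; first exact: cmeas_comp.
rewrite (hp (fun x => (cnorm (f x))%:E)) //; first exact: measurable_cnormE.
by move=> x; rewrite lee_fin cnorm_ge0.
Qed.

End MeasurePreserving.

(** * Translations, shears, rotations and right translations of the Heisenberg group *)

Section Translation.
Context {R : realType}.
Notation leb := (@lebesgue_measure R).

Lemma measurable_addr (a : R) :
  measurable_fun setT (fun x : measurableTypeR R => (x + a : measurableTypeR R)).
Proof. by apply: measurable_funD => //; exact: measurable_cst. Qed.

(** The pushforward of Lebesgue measure by a translation agrees with it on bounded intervals, which
    determines a measure. *)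
Lemma mpres_addr (a : R) : mpres leb (fun x => x + a).
Proof.
split; first exact: measurable_addr.
move=> g mg g0.
pose sh (x : measurableTypeR R) : measurableTypeR R := x + a.
transitivity (\int[pushforward leb sh]_x g x)%E.
  by rewrite ge0_integral_pushforward //=; exact: measurable_addr.
have msh : measurable_fun setT sh by exact: measurable_addr.
apply: eq_measure_integral => //= A mA _; apply/esym.
apply: lebesgue_measure_unique => //= _ [[u v]] _ <-.
rewrite /pushforward (_ : _ @^-1` _ = `]u - a, v - a]%classic); last first.
  by apply/seteqP; split => x /=; rewrite !in_itv /= ltrBlDr lerBrDr.
rewrite !lebesgue_measure_itv /= !lte_fin ltrD2r -!EFinB.
by case: ifP => // _; congr EFin; ring.
Qed.

Lemma mpres_opp : mpres leb (fun x => - x).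
Proof.
have m : measurable_fun setT (-%R : R -> measurableTypeR R) by exact: oppr_measurable.
split => // g mg g0.
transitivity (\int[pushforward leb (-%R : R -> measurableTypeR R)]_x g x)%E.
  by rewrite ge0_integral_pushforward.
by apply: eq_measure_integral => //= A mA _; exact: lebesgue_measureN.
Qed.

Context {d : measure_display} {T : measurableType d}.
Variable mu : {sigma_finite_measure set T -> \bar R}.

(** On the fibre over a fixed first coordinate a shear is a translation, and Tonelli's theorem
    integrates the fibres. *)
Lemma mpres_shear2 (phi : T -> R) : measurable_fun setT phi ->
  mpres (mu \x leb)%E (fun w => (w.1, w.2 + phi w.1)).
Proof.
move=> mp; have m : measurable_fun setT (fun w : T * measurableTypeR R => (w.1, (w.2 + phi w.1 : measurableTypeR R))).
  apply: measurable_fun_pair; first exact: measurable_fst.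
  apply: measurable_funD; first exact: measurable_snd.
  by apply: measurableT_comp => //; exact: measurable_fst.
split => // g mg g0; rewrite fubini_tonelli1 //; last exact: measurableT_comp.
rewrite fubini_tonelli1 //; apply: eq_integral => x _; rewrite /fubini_F /=.
have [_ h] := mpres_addr (phi x); apply: (h (fun y => g (x, y))) => //.
by apply: measurableT_comp => //; exact: measurable_fun_pair.
Qed.

Lemma mpres_shear1 (phi : T -> R) : measurable_fun setT phi ->
  mpres (leb \x mu)%E (fun w => (w.1 + phi w.2, w.2)).
Proof.
move=> mp; have m : measurable_fun setT (fun w : measurableTypeR R * T => ((w.1 + phi w.2 : measurableTypeR R), w.2)).
  apply: measurable_fun_pair; last exact: measurable_snd.
  apply: measurable_funD; first exact: measurable_fst.
  by apply: measurableT_comp => //; exact: measurable_snd.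
split => // g mg g0; rewrite fubini_tonelli2 //; last exact: measurableT_comp.
rewrite fubini_tonelli2 //; apply: eq_integral => x _; rewrite /fubini_G /=.
have [_ h] := mpres_addr (phi x); apply: (h (fun y => g (y, x))) => //.
by apply: measurableT_comp => //; exact: measurable_fun_pair.
Qed.

Lemma mpres_left d' (T' : measurableType d')
    (mu' : {sigma_finite_measure set T' -> \bar R}) (phi : T -> T) :
  mpres mu phi -> mpres (mu \x mu')%E (fun w => (phi w.1, w.2)).
Proof.
move=> [mp hp]; have m : measurable_fun setT (fun w : T * T' => (phi w.1, w.2)).
  apply: measurable_fun_pair; last exact: measurable_snd.
  by apply: measurableT_comp => //; exact: measurable_fst.
split => // g mg g0; rewrite fubini_tonelli2 //; last exact: measurableT_comp.
rewrite fubini_tonelli2 //; apply: eq_integral => y _; rewrite /fubini_G /=.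
apply: (hp (fun x => g (x, y))) => //.
by apply: measurableT_comp => //; exact: measurable_fun_pair.
Qed.

End Translation.

Section Plane.
Context {R : realType}.
Notation leb := (@lebesgue_measure R).
Notation plane := (@plane_measure R).

Lemma mpres_plane_add (a b : R) : mpres plane (fun w => (w.1 + a, w.2 + b)).
Proof.
have h1 := @mpres_shear1 R _ _ leb (fun=> a) (measurable_cst a).
have h2 := @mpres_shear2 R _ _ leb (fun=> b) (measurable_cst b).
exact: (mpres_comp h1 h2).
Qed.

Definition rot (c s : R) (w : R * R) : R * R :=
  (c * w.1 - s * w.2, s * w.1 + c * w.2).

Let rot_shears (c s : R) : c ^+ 2 + s ^+ 2 = 1 -> 1 + c != 0 ->
  mpres plane (rot c s).
Proof.
(* With c = cos t and s = sin t this is -tan(t/2). The rotation is the horizontal shear by a, the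
   vertical shear by s, and the horizontal shear by a again. *)
move=> cs c1; pose a := - s / (1 + c).
have ma (k : R) : measurable_fun setT (fun x : measurableTypeR R => k * x) by exact: mulrl_measurable.
have h1 := @mpres_shear1 R _ _ leb (fun y => a * y) (ma a).
have h2 := @mpres_shear2 R _ _ leb (fun x => s * x) (ma s).
have := mpres_comp h1 (mpres_comp h2 h1).
congr mpres; apply/funext => -[x y]; rewrite /rot /=.
have e2 : a * (1 + c) = - s by rewrite /a mulrVK // unitfE.
have e1 : 1 + a * s = c.
  apply: (mulIf c1); transitivity (1 + c + (a * (1 + c)) * s); first by ring.
  by rewrite e2; nra.
congr (_, _).
  transitivity ((1 + a * s) * x + (a * (1 + (1 + a * s))) * y); first by ring.
  by rewrite e1 e2 mulNr.
transitivity (s * x + (1 + a * s) * y); first by ring.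
by rewrite e1.
Qed.

(* A rotation other than the half-turn is a product of three shears. *)
Lemma mpres_rot (c s : R) : c ^+ 2 + s ^+ 2 = 1 -> mpres plane (rot c s).
Proof.
move=> cs; have [c1|c1] := eqVneq (1 + c) 0; last exact: rot_shears.
have ec : c = -1 by apply/eqP; rewrite -addr_eq0 addrC c1.
have es : s = 0 by apply/eqP; rewrite -sqrf_eq0; apply/eqP; move: cs; rewrite ec; lra.
(* The half-turn, the only case with 1 + c = 0, is the square of the quarter-turn. *)
have h : mpres plane (rot 0 1) by apply: rot_shears; rewrite ?addr0 ?oner_eq0 //; ring.
have := mpres_comp h h; congr mpres; apply/funext => -[x y]; rewrite /rot /= ec es.
by congr (_, _); ring.
Qed.

End Plane.

Section HeisTranslation.
Context {R : realType}.
Notation leb := (@lebesgue_measure R).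

(** Right translation shears t by an affine function of the plane coordinates and then translates
    the plane; hence Lebesgue measure is right-invariant. *)
Lemma mpres_hmulr (p : heis R) : mpres heis_measure (fun q => hmul q p).
Proof.
have h1 := @mpres_left R _ _ (sfprod leb leb) _ _ leb _ (mpres_plane_add p.1.1 p.1.2).
have mf : measurable_fun setT (fun w : measurableTypeR R * measurableTypeR R =>
    p.2 + 2^-1 * (w.1 * p.1.2 - w.2 * p.1.1)).
  apply: measurable_funD; first exact: measurable_cst.
  apply: measurable_funM; first exact: measurable_cst.
  by apply: measurable_funB; apply: measurable_funM => //; exact: measurable_cst.
have h2 := @mpres_shear2 R _ _ (sfprod leb leb) _ mf.
have := mpres_comp h1 h2; congr mpres; apply/funext => -[[x y] t].
by rewrite /hmul /=; congr (_, _); ring.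
Qed.

End HeisTranslation.

(** * Entire functions and contour integrals *)

Section ExpBounds.
Context {R : realType}.
Implicit Types a b M : R.

(** A mean value inequality for both signs of b. Applied repeatedly it turns bounds on derivatives
    into crude Taylor remainders, with no attempt at sharp constants. *)
Lemma mvt_bound (f df : R -> R) M b :
  (forall x : R, is_derive x 1 f (df x)) ->
  (forall x, `|x| <= `|b| -> `|df x| <= M) -> `|f b - f 0| <= M * `|b|.
Proof.
move=> fd dM.
have cf (u v : R) : {within `[u, v], continuous f}.
  by apply: derivable_within_continuous => x _; apply: ex_derive.
have [b0|b0] := leP 0 b.
  have [c] := @MVT_segment R f df 0 b b0 (fun x _ => fd x) (cf _ _).
  rewrite in_itv /= => /andP[c0 cb] ->; rewrite subr0 normrM ler_wpM2r //.
  by apply: dM; rewrite !ger0_norm.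
have [c] := @MVT_segment R f df b 0 (ltW b0) (fun x _ => fd x) (cf _ _).
rewrite in_itv /= => /andP[c0 cb] E; rewrite distrC E sub0r normrM normrN.
rewrite ler_wpM2r //; apply: dM; rewrite !ler0_norm ?lerN2 //; exact: ltW.
Qed.

Lemma norm_expR_sub1 a : `|expR a - 1| <= `|a| * expR `|a|.
Proof.
rewrite -[X in _ - X]expR0 mulrC; apply: (mvt_bound (df := expR)) => x xa.
by rewrite ger0_norm ?expR_ge0 // ler_expR (le_trans (ler_norm x)).
Qed.

Lemma norm_expR_taylor1 a : `|expR a - 1 - a| <= `|a| ^+ 2 * expR `|a|.
Proof.
have -> : expR a - 1 - a = (expR a - a) - (expR 0 - 0) by rewrite expR0; ring.
rewrite expr2 -mulrA mulrC.
apply: (mvt_bound (f := fun x => expR x - x) (df := fun x => expR x - 1)) => x xa.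
apply: (le_trans (norm_expR_sub1 x)).
by apply: ler_pM; rewrite ?expR_ge0 ?ler_expR.
Qed.

Lemma norm_sin_le b : `|sin b| <= `|b|.
Proof.
rewrite -[sin b]subr0 -sin0 -[leRHS]mul1r.
by apply: (mvt_bound (df := cos)) => x _; rewrite ler_norml cos_geN1 cos_le1.
Qed.

Lemma norm_cos_sub1 b : `|cos b - 1| <= `|b|.
Proof.
rewrite -cos0 -[leRHS]mul1r.
apply: (mvt_bound (df := fun x => - sin x)) => x _.
by rewrite normrN ler_norml sin_geN1 sin_le1.
Qed.

Lemma norm_cos_sub1_sqr b : `|cos b - 1| <= `|b| ^+ 2.
Proof.
rewrite -cos0 expr2; apply: (mvt_bound (df := fun x => - sin x)) => x xb.
by rewrite normrN (le_trans (norm_sin_le x)).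
Qed.

Lemma norm_sin_taylor1 b : `|sin b - b| <= `|b| ^+ 2.
Proof.
have -> : sin b - b = (sin b - b) - (sin 0 - 0) by rewrite sin0; ring.
rewrite expr2.
apply: (mvt_bound (f := fun x => sin x - x) (df := fun x => cos x - 1)) => x xb.
by rewrite (le_trans (norm_cos_sub1 x)).
Qed.

(** With u = a + ib and r = |u|, the real part of the remainder is (e^a - 1 - a) + e^a (cos b - 1)
    and the imaginary part is e^a (sin b - b) + (e^a - 1) b. Each of the four terms is at most r^2
    e^r, whence the factor 4. *)
Lemma cnorm_cexp_taylor1 (u : R[i]) :
  cnorm (cexp u - 1 - u) <= 4 * (cnorm u ^+ 2 * expR (cnorm u)).
Proof.
apply: (le_trans (cnorm_le _)); set r := cnorm u.
have r0 : 0 <= r := cnorm_ge0 u.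
have ha : `|complex.Re u| <= r := normRe_le u.
have hb : `|complex.Im u| <= r := normIm_le u.
case: u @r r0 ha hb => a b r r0 /= ha hb.
have er0 := expR_ge0 r.
have ea : expR a <= expR r by rewrite ler_expR (le_trans (ler_norm a)).
have eaa : expR `|a| <= expR r by rewrite ler_expR.
have a2 : `|a| ^+ 2 <= r ^+ 2 by rewrite lerXn2r ?nnegrE.
have b2 : `|b| ^+ 2 <= r ^+ 2 by rewrite lerXn2r ?nnegrE.
have h1 : `|expR a - 1 - a| <= r ^+ 2 * expR r.
  by apply: (le_trans (norm_expR_taylor1 a)); apply: ler_pM; rewrite ?expR_ge0 ?sqr_ge0.
have h2 : `|expR a * (cos b - 1)| <= r ^+ 2 * expR r.
  rewrite normrM (ger0_norm (expR_ge0 _)) mulrC.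
  by apply: ler_pM; rewrite ?expR_ge0 // (le_trans (norm_cos_sub1_sqr b)).
have h3 : `|expR a * (sin b - b)| <= r ^+ 2 * expR r.
  rewrite normrM (ger0_norm (expR_ge0 _)) mulrC.
  by apply: ler_pM; rewrite ?expR_ge0 // (le_trans (norm_sin_taylor1 b)).
have h4 : `|(expR a - 1) * b| <= r ^+ 2 * expR r.
  rewrite normrM mulrC expr2 -mulrA; apply: ler_pM => //.
  by apply: (le_trans (norm_expR_sub1 a)); apply: ler_pM; rewrite ?expR_ge0.
rewrite ?mul0r ?subr0 ?addr0 ?oppr0 ?addr0.
have -> : expR a * cos b - 1 - a = (expR a - 1 - a) + expR a * (cos b - 1) by ring.
have -> : expR a * sin b - b = expR a * (sin b - b) + (expR a - 1) * b by ring.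
have := ler_normD (expR a - 1 - a) (expR a * (cos b - 1)).
have := ler_normD (expR a * (sin b - b)) ((expR a - 1) * b).
lra.
Qed.

End ExpBounds.

Section ComplexDerivative.
Context {R : realType}.
Implicit Types (F G : R[i] -> R[i]) (z L h : R[i]).

(** The division-free form of differentiability: h = 0 needs no exclusion, and all bounds are real
    inequalities on [cnorm]. *)
Definition cderiv F z L : Prop := forall e : R, 0 < e -> exists2 d : R, 0 < d &
  forall h, cnorm h < d -> cnorm (F (z + h) - F z - L * h) <= e * cnorm h.

Definition cdiff F z : Prop := exists L, cderiv F z L.

Lemma holomorphicP F : holomorphic F <-> forall z, cdiff F z.
Proof.
split=> [hF z|hF z].
  have /cvg_ex[/= L /cvgrPdist_le hL] := hF z.
  exists L => e e0; have /hL : 0 < e%:C :> R[i] by rewrite ltcR.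
  rewrite /dnbhs /within /= => /nbhs_ballP[/= d d0 hd].
  (* In the order of R[i] a positive element is real, so the complex radius produced by the topology
     is a real one. *)
  have dE : d = (complex.Re d)%:C.
    by move: d0; case: (d) => a b; rewrite ltcE /= => /andP[/eqP-> _].
  exists (complex.Re d) => [|h hlt]; first by move: d0; rewrite {1}dE ltcR.
  have [->|h0] := eqVneq h 0; first by rewrite mulr0 addr0 !subrr cnorm0 mulr0.
  have hb : ball (0 : R[i]^o) d h.
    by rewrite /ball /= sub0r normrN normC_cnorm dE ltcR.
  have := hd _ hb h0; rewrite /shift /= normC_cnorm lecR.
  have -> : L - h^-1 *: (F (h *: (1 : R[i]^o) + z) - F z)
      = - h^-1 * (F (z + h) - F z - L * h).
    by rewrite /GRing.scale /= mulr1 [h + z]addrC; field.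
  rewrite cnormM cnormN cnormV ler_pdivrMl; first by rewrite [cnorm h * e]mulrC.
  by rewrite lt_neqAle cnorm_ge0 eq_sym andbT; apply: contra h0 => /eqP/cnorm_eq0 ->.
have [L hL] := hF z; apply/cvg_ex; exists L; apply/cvgrPdist_le => /= e e0.
have eE : e = (complex.Re e)%:C.
  by move: e0; case: (e) => a b; rewrite ltcE /= => /andP[/eqP-> _].
have er : 0 < complex.Re e by move: e0; rewrite {1}eE ltcR.
have [d d0 hd] := hL _ er.
rewrite /dnbhs /within /=; apply/nbhs_ballP; exists d%:C => /=; first by rewrite ltcR.
move=> h; rewrite /ball /= sub0r normrN normC_cnorm ltcR => hlt h0.
rewrite /shift /=; have -> : L - h^-1 *: (F (h *: (1 : R[i]^o) + z) - F z)
    = - h^-1 * (F (z + h) - F z - L * h).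
  by rewrite /GRing.scale /= mulr1 [h + z]addrC; field.
rewrite normC_cnorm eE lecR cnormM cnormN cnormV ler_pdivrMl.
  by rewrite [leRHS]mulrC; exact: hd.
by rewrite lt_neqAle cnorm_ge0 eq_sym andbT; apply: contra h0 => /eqP/cnorm_eq0 ->.
Qed.

Lemma cdiff_cst c z : cdiff (fun=> c) z.
Proof.
exists 0 => e e0; exists 1 => // h _.
by rewrite mul0r subr0 subrr cnorm0 mulr_ge0 ?cnorm_ge0 // ltW.
Qed.

Lemma cdiff_id z : cdiff (fun x => x) z.
Proof.
exists 1 => e e0; exists 1 => // h _.
rewrite mul1r (_ : z + h - z - h = 0) ?cnorm0 ?mulr_ge0 ?cnorm_ge0 ?(ltW e0) //.
by ring.
Qed.

Lemma cdiffD F G z : cdiff F z -> cdiff G z -> cdiff (fun x => F x + G x) z.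
Proof.
move=> [L hL] [M hM]; exists (L + M) => e e0.
have e2 : 0 < e / 2 by rewrite divr_gt0.
have [d1 d10 h1] := hL _ e2; have [d2 d20 h2] := hM _ e2.
exists (Num.min d1 d2) => [|h]; first by rewrite lt_min d10.
rewrite lt_min => /andP[/h1 {}h1 /h2 {}h2].
have -> : F (z + h) + G (z + h) - (F z + G z) - (L + M) * h =
  (F (z + h) - F z - L * h) + (G (z + h) - G z - M * h) by ring.
by apply: (le_trans (cnormD _ _)); lra.
Qed.

Lemma cdiff_comp F G z : cdiff G z -> cdiff F (G z) ->
  cdiff (fun x => F (G x)) z.
Proof.
move=> [M hM] [L hL]; exists (L * M) => e e0.
pose A := cnorm M + 1; have A0 : 0 < A by rewrite /A ltr_wpDl ?cnorm_ge0.
pose B := cnorm L + 1; have B0 : 0 < B by rewrite /B ltr_wpDl ?cnorm_ge0.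
have e1 : 0 < e / (2 * A) by rewrite divr_gt0 // mulr_gt0.
(* The bound 1 gives |k| <= (|M| + 1) |h| = A |h|, and e / (2 B) controls the term L (k - M h). *)
have e2 : 0 < Num.min 1 (e / (2 * B)) by rewrite lt_min ltr01 divr_gt0 // mulr_gt0.
have [d1 d10 h1] := hL _ e1; have [d2 d20 h2] := hM _ e2.
exists (Num.min (d1 / A) d2) => [|h]; first by rewrite lt_min d20 divr_gt0.
rewrite lt_min ltr_pdivlMr // => /andP[hd1 /h2 {}h2].
set k := G (z + h) - G z.
have n0 := cnorm_ge0 h.
have hk1 : cnorm (k - M * h) <= cnorm h.
  apply: (le_trans h2); rewrite -[leRHS]mul1r ler_wpM2r //.
  by rewrite ge_min lexx.
have hk2 : cnorm (k - M * h) <= e / (2 * B) * cnorm h.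
  apply: (le_trans h2); rewrite ler_wpM2r //.
  by rewrite ge_min lexx orbT.
have kA : cnorm k <= A * cnorm h.
  have -> : k = (k - M * h) + M * h by ring.
  by apply: (le_trans (cnormD _ _)); rewrite cnormM /A; lra.
have {}h1 : cnorm (F (G z + k) - F (G z) - L * k) <= e / (2 * A) * cnorm k.
  by apply: h1; apply: (le_lt_trans kA); rewrite mulrC.
have -> : F (G (z + h)) - F (G z) - L * M * h =
    (F (G z + k) - F (G z) - L * k) + L * (k - M * h).
  have Ek : G (z + h) = G z + k by rewrite /k; ring.
  by rewrite Ek; ring.
apply: (le_trans (cnormD _ _)); rewrite cnormM.
have t1 : e / (2 * A) * cnorm k <= e / 2 * cnorm h.
  apply: (le_trans (ler_wpM2l (ltW e1) kA)).
  by rewrite mulrA invfM mulrA mulfVK // gt_eqF.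
have t2 : cnorm L * cnorm (k - M * h) <= e / 2 * cnorm h.
  apply: (@le_trans _ _ (B * (e / (2 * B) * cnorm h))).
    apply: ler_pM; rewrite ?cnorm_ge0 //.
    by rewrite /B lerDl.
  rewrite le_eqVlt; apply/orP; left; apply/eqP.
  by field; rewrite gt_eqF.
by lra.
Qed.

Lemma cdiffZ c F z : cdiff F z -> cdiff (fun x => c * F x) z.
Proof.
move=> hF; apply: (cdiff_comp (F := fun x => c * x)) hF _.
exists c => e e0; exists 1 => // h _.
rewrite (_ : _ - _ - _ = 0) ?cnorm0 ?mulr_ge0 ?cnorm_ge0 ?(ltW e0) //.
by ring.
Qed.

(** Polarization, FG = ((F + G)^2 - (F - G)^2) / 4, reduces the product rule to the chain rule and
    the derivative of the square. *)
Lemma cdiffM F G z : cdiff F z -> cdiff G z -> cdiff (fun x => F x * G x) z.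
Proof.
move=> hF hG; have sq w : cdiff (fun x => x ^+ 2) w.
  exists (2 * w) => e e0; exists e => // h he.
  have -> : (w + h) ^+ 2 - w ^+ 2 - 2 * w * h = h * h by ring.
  by rewrite cnormM ler_wpM2r ?cnorm_ge0 // ltW.
have -> : (fun x => F x * G x) = (fun x => 4^-1 * (F x + G x) ^+ 2
    + (- 4^-1) * (F x + (-1) * G x) ^+ 2).
  by apply/funext => x; field.
apply: cdiffD; apply: cdiffZ.
  by apply: (cdiff_comp (F := fun x => x ^+ 2)) (sq _); exact: cdiffD.
by apply: (cdiff_comp (F := fun x => x ^+ 2)) (sq _); apply: cdiffD => //; exact: cdiffZ.
Qed.

Lemma cdiff_cexp z : cdiff cexp z.
Proof.
exists (cexp z) => e e0; pose A := cnorm (cexp z) * 4 * expR 1.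
have A0 : 0 < A.
  rewrite /A !mulr_gt0 ?expR_gt0 // cnorm_cexp; exact: expR_gt0.
exists (Num.min 1 (e / A)) => [|h]; first by rewrite lt_min ltr01 divr_gt0.
rewrite lt_min => /andP[h1 hA].
have -> : cexp (z + h) - cexp z - cexp z * h = cexp z * (cexp h - 1 - h).
  by rewrite cexpD; ring.
rewrite cnormM.
have n0 := cnorm_ge0 h.
apply: (@le_trans _ _ (cnorm (cexp z) * (4 * (cnorm h ^+ 2 * expR 1)))).
  apply: ler_wpM2l; first exact: cnorm_ge0.
  apply: (le_trans (cnorm_cexp_taylor1 h)); rewrite ler_pM2l //.
  by rewrite ler_wpM2l ?sqr_ge0 // ler_expR ltW.
rewrite (_ : _ * (4 * _) = A * cnorm h * cnorm h); last by rewrite /A; ring.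
by apply: ler_wpM2r => //; rewrite mulrC -ler_pdivlMr // ltW.
Qed.

Lemma cdiff_cont F z (e : R) : cdiff F z -> 0 < e ->
  exists2 d : R, 0 < d & forall h, cnorm h < d -> cnorm (F (z + h) - F z) < e.
Proof.
move=> [L hL] e0; have [d d0 hd] := hL 1 ltr01.
pose A := cnorm L + 1; have A0 : 0 < A by rewrite /A ltr_wpDl ?cnorm_ge0.
exists (Num.min d (e / A)) => [|h]; first by rewrite lt_min d0 divr_gt0.
rewrite lt_min ltr_pdivlMr // => /andP[/hd {}hd hA].
have -> : F (z + h) - F z = (F (z + h) - F z - L * h) + L * h by ring.
apply: (le_lt_trans (cnormD _ _)); apply: le_lt_trans hA.
by rewrite cnormM /A; lra.
Qed.

End ComplexDerivative.

(** * From continuity to measurability on products of lines *)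

Section TopologyMeasurable.

(* A countable family refining every neighbourhood. *)
Definition nbhs_base (T : topologicalType) (I : countType) (B : I -> set T) :=
  forall (x : T) (U : set T), nbhs x U -> exists2 i, B i x & B i `<=` U.

Lemma nbhs_base_real (R : realType) :
  nbhs_base (fun q : rat * rat => ball (ratr q.1 : R) (ratr q.2)).
Proof.
move=> x U /nbhs_ballP[e e0 xU].
have [q2] : exists q2 : rat, 0 < (ratr q2 : R) < e / 2.
  have /rat_in_itvoo[q] : 0 < e / 2 by rewrite divr_gt0.
  by rewrite in_itv /= => h; exists q.
move=> /andP[q20 q2e].
have [q1] : exists q1 : rat, x - ratr q2 < (ratr q1 : R) < x + ratr q2.
  have /rat_in_itvoo[q] : x - ratr q2 < x + ratr q2 :> R by lra.
  by rewrite in_itv /= => h; exists q.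
move=> /andP[h1 h2]; exists (q1, q2) => /=.
  by rewrite /ball /= ltr_norml; apply/andP; split; lra.
move=> y; rewrite /ball /= ltr_norml => /andP[k1 k2]; apply: xU.
by rewrite /ball /= ltr_norml; apply/andP; split; lra.
Qed.

Lemma nbhs_base_prod (T1 T2 : topologicalType) (I1 I2 : countType)
    (B1 : I1 -> set T1) (B2 : I2 -> set T2) :
  nbhs_base B1 -> nbhs_base B2 ->
  nbhs_base (fun i : I1 * I2 => B1 i.1 `*` B2 i.2).
Proof.
move=> h1 h2 [x y] U [[U1 U2] /= [/h1[i i1 i2] /h2[j j1 j2]] UU].
exists (i, j) => // -[a b] [/= /i2 ? /j2 ?]; exact: UU.
Qed.

(** The set where u > a is the union of the members of the countable base that it contains. This
    links the product topology to the product sigma-algebra. *)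
Lemma nbhs_base_measurable d (S : measurableType d) (T : topologicalType)
    (R : realType) (I : countType) (B : I -> set T) (phi : S -> T) (u : T -> R) :
  nbhs_base B -> (forall i, measurable (phi @^-1` B i)) ->
  (forall x e, 0 < e -> nbhs x [set y | `|u y - u x| < e]) ->
  measurable_fun setT (fun s => u (phi s)).
Proof.
move=> hB mB cu.
apply: (measurability _ (RGenOInfty.measurableE R)) => //= _ [_ [a ->] <-].
rewrite setTI; pose D := [set i | B i `<=` [set y | a < u y]].
rewrite (_ : _ @^-1` _ = \bigcup_n
  (if unpickle n is Some i then if i \in D then phi @^-1` B i else set0 else set0)).
  apply: bigcup_measurable => n _; case: (unpickle n) => [i|] //.
  by case: ifP.
apply/seteqP; split => x /=; rewrite ?in_itv /= ?andbT.
  move=> ax; have [i Bi iD] : exists2 i, B i (phi x) & B i `<=` [set y | a < u y].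
    apply: hB; have /(cu (phi x)) : 0 < u (phi x) - a by rewrite subr_gt0.
    by apply: filterS => y /=; rewrite ltr_norml => /andP[h _]; lra.
  exists (pickle i) => //; rewrite pickleK.
  by rewrite ifT //; apply/mem_set.
move=> [n _]; case: (unpickle n) => [i|] //.
by case: ifP => // /set_mem iD Bx; exact: iD.
Qed.

End TopologyMeasurable.

Section ComplexContinuity.
Context {R : realType}.

Definition ccont (F : R[i] -> R[i]) : Prop := forall z (e : R), 0 < e ->
  exists2 d : R, 0 < d & forall h, cnorm h < d -> cnorm (F (z + h) - F z) < e.

Lemma holomorphic_ccont F : holomorphic F -> ccont F.
Proof. by move=> /holomorphicP hF z e e0; exact: cdiff_cont. Qed.

Lemma ccont_cmeas F : ccont F -> cmeas (fun w : measurableTypeR R * measurableTypeR R => F (w.1 +i* w.2)).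
Proof.
move=> cF.
have key (p : R[i] -> R) : (forall z w, `|p z - p w| <= cnorm (z - w)) ->
    measurable_fun setT (fun w : measurableTypeR R * measurableTypeR R => p (F (w.1 +i* w.2))).
  move=> hp; apply: (@nbhs_base_measurable _ (measurableTypeR R * measurableTypeR R)%type
    (R * R)%type R _ _ id (fun w : R * R => p (F (w.1 +i* w.2)))
    (nbhs_base_prod (@nbhs_base_real R) (@nbhs_base_real R))).
    by move=> i; apply: measurableX; exact: measurable_ball.
  move=> [x y] e e0; have [d d0 hd] := cF (x +i* y) e e0.
  apply/nbhs_ballP; exists (d / 2) => /=; first by rewrite divr_gt0.
  move=> [x' y'] [/=]; rewrite /ball /= => h1 h2.
  apply: (le_lt_trans (hp _ _)).
  have -> : x' +i* y' = x +i* y + ((x' - x) +i* (y' - y)).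
    by apply: complex_ext => /=; ring.
  apply: hd; apply: (le_lt_trans (cnorm_le _)) => /=.
  by rewrite distrC [`|y' - y|]distrC; lra.
split.
- by apply: key => z w; rewrite -ReN -ReD normRe_le.
- by apply: key => z w; rewrite -ImN -ImD normIm_le.
Qed.

Lemma heis_cont_cmeas (u : heis R -> R[i]) :
  continuous (u : heis R -> R[i]^o) ->
  cmeas (u : measurableTypeR R * measurableTypeR R * measurableTypeR R -> R[i]).
Proof.
move=> cu.
have key (p : R[i] -> R) : (forall z w, `|p z - p w| <= cnorm (z - w)) ->
    measurable_fun setT (fun w : measurableTypeR R * measurableTypeR R * measurableTypeR R => p (u w)).
  move=> hp; apply: (@nbhs_base_measurable _ (measurableTypeR R * measurableTypeR R * measurableTypeR R)%type
    (heis R) R _ _ id (fun w : heis R => p (u w))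
    (nbhs_base_prod (nbhs_base_prod (@nbhs_base_real R) (@nbhs_base_real R)) (@nbhs_base_real R))).
    by move=> i; apply: measurableX; [apply: measurableX|]; exact: measurable_ball.
  move=> x e e0; have /cvgrPdist_lt/(_ e%:C) := cu x.
  rewrite ltcR e0 => /(_ isT); apply: filterS => y /=.
  rewrite normC_cnorm ltcR => h; apply: le_lt_trans (hp _ _) _.
  by rewrite -cnormN opprB.
split.
- by apply: key => z w; rewrite -ReN -ReD normRe_le.
- by apply: key => z w; rewrite -ImN -ImD normIm_le.
Qed.

End ComplexContinuity.

(** * Goursat's theorem on rectangles by bisection *)

Section Bisection.
Context {R : realType}.
Variable N : R -> R -> R -> R -> R.
Hypothesis Nsub : forall x y p q, 0 < p -> 0 < q ->
  N x y p q <= N x y (p / 2) (q / 2) + N (x + p / 2) y (p / 2) (q / 2)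
    + N x (y + q / 2) (p / 2) (q / 2) + N (x + p / 2) (y + q / 2) (p / 2) (q / 2).
Hypothesis Nloc : forall x y e, 0 < e -> exists2 d, 0 < d &
  forall x' y' p q, 0 < p < d -> 0 < q < d -> x' <= x <= x' + p ->
    y' <= y <= y' + q -> N x' y' p q <= e * (p + q) ^+ 2.

(** Pigeonhole: at least one of the four quarters carries at least a quarter of N. *)
Let step (x y p q : R) : 0 < p -> 0 < q -> exists z : R * R,
  [/\ x <= z.1 <= x + p / 2, y <= z.2 <= y + q / 2 &
     N x y p q <= 4 * N z.1 z.2 (p / 2) (q / 2)].
Proof.
move=> p0 q0; have := Nsub x y p0 q0.
set A := N x y (p / 2) _; set B := N (x + _) y _ _; set C := N x (y + _) _ _.
set D := N (x + _) (y + _) _ _ => h.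
have [h1|h1] := leP (N x y p q) (4 * A).
  by exists (x, y); split; [apply/andP; split => /=; lra|apply/andP; split => /=; lra|exact: h1].
have [h2|h2] := leP (N x y p q) (4 * B).
  by exists (x + p / 2, y); split; [apply/andP; split => /=; lra|apply/andP; split => /=; lra|exact: h2].
have [h3|h3] := leP (N x y p q) (4 * C).
  by exists (x, y + q / 2); split; [apply/andP; split => /=; lra|apply/andP; split => /=; lra|exact: h3].
exists (x + p / 2, y + q / 2); split => /=; [apply/andP; split; lra|apply/andP; split; lra|].
by rewrite -/D; lra.
Qed.

(** The left ends z_k increase and the right ends z_k + p / 2^k decrease, so the limit of the left
    ends lies in every interval. *)
Lemma nested_limit (z : nat -> R) (p : R) :
  (forall k, z k <= z k.+1 <= z k + p / 2 ^+ k.+1) ->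
  exists l, forall k, z k <= l <= z k + p / 2 ^+ k.
Proof.
move=> hz.
have nd : nondecreasing_seq z by apply/nondecreasing_seqP => k; case/andP: (hz k).
have ni : nonincreasing_seq (fun k => z k + p / 2 ^+ k).
  apply/nonincreasing_seqP => k; case/andP: (hz k) => _ h.
  have E : p / 2 ^+ k = p / 2 ^+ k.+1 + p / 2 ^+ k.+1.
    rewrite exprS invfM; set a := (2 ^+ k)^-1; lra.
  by rewrite E; lra.
have p0 : 0 <= p.
  case/andP: (hz 0%N) => h1 h2; have := le_trans h1 h2; rewrite expr1.
  by lra.
have pk k : 0 <= p / 2 ^+ k by rewrite divr_ge0 // exprn_ge0.
have ub k j : z j <= z k + p / 2 ^+ k.
  have [kj|/ltnW jk] := leqP k j.
    by apply: le_trans (ni _ _ kj); rewrite lerDl.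
  by apply: (le_trans (nd _ _ jk)); rewrite lerDl.
have cz : cvgn z.
  by apply: nondecreasing_is_cvgn => //; exists (z 0%N + p / 2 ^+ 0) => _ [j _ <-].
exists (limn z) => k; apply/andP; split; first exact: nondecreasing_cvgn_le.
by apply: limr_le => //; apply: nearW => j; exact: ub.
Qed.

(** Goursat's bisection for an abstract N. Repeated quartering gives N <= 4^k N_k on rectangles
    shrinking to a point, while the local bound makes N_k an arbitrarily small multiple of 4^-k. *)
Lemma bisection_le0 x y p q : 0 < p -> 0 < q -> N x y p q <= 0.
Proof.
move=> p0 q0.
have p2 k : 0 < p / 2 ^+ k by rewrite divr_gt0 // exprn_gt0.
have q2 k : 0 < q / 2 ^+ k by rewrite divr_gt0 // exprn_gt0.
pose f := fun k (z : R * R) => projT1 (cid (step z.1 z.2 (p2 k) (q2 k))).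
pose z := fix z k := if k is j.+1 then f j (z j) else (x, y).
have half (a : R) k : a / 2 ^+ k / 2 = a / 2 ^+ k.+1 by rewrite exprSr invfM mulrA.
have hz k : [/\ (z k).1 <= (z k.+1).1 <= (z k).1 + p / 2 ^+ k.+1,
    (z k).2 <= (z k.+1).2 <= (z k).2 + q / 2 ^+ k.+1 &
    N (z k).1 (z k).2 (p / 2 ^+ k) (q / 2 ^+ k) <=
    4 * N (z k.+1).1 (z k.+1).2 (p / 2 ^+ k.+1) (q / 2 ^+ k.+1)].
  by rewrite /= /f; case: cid => w /=; rewrite !half.
have [l1 hl1] := @nested_limit (fun k => (z k).1) p (fun k => let: And3 a _ _ := hz k in a).
have [l2 hl2] := @nested_limit (fun k => (z k).2) q (fun k => let: And3 _ a _ := hz k in a).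
have grow k : N x y p q <= 4 ^+ k * N (z k).1 (z k).2 (p / 2 ^+ k) (q / 2 ^+ k).
  elim: k => [|k IH]; first by rewrite !expr0 mul1r !divr1.
  apply: (le_trans IH); rewrite exprSr -mulrA ler_pM2l ?exprn_gt0 //.
  by case: (hz k).
apply/ler_addgt0Pr => e e0; rewrite add0r.
have pq0 : 0 < (p + q) ^+ 2 by rewrite exprn_gt0 // addr_gt0.
(* Dividing e by (p + q)^2 makes the final bound exactly e: the factor 4^k cancels the square of
   2^-k in the k-th side lengths. *)
have [d d0 hd] := Nloc l1 l2 (divr_gt0 e0 pq0).
have [k [kp kq]] : exists k, p / 2 ^+ k < d /\ q / 2 ^+ k < d.
  have c (a : R) : \forall k \near \oo, a / 2 ^+ k < d.
    have : (fun k => a / 2 ^+ k) @ \oo --> (0 : R).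
      rewrite -(mulr0 a); apply: cvgM; first exact: cvg_cst.
      under eq_fun do rewrite -exprVn; apply: cvg_expr.
      by rewrite ger0_norm ?invr_ge0 // invf_lt1 // ltr1n.
    by move/cvgrPdist_lt/(_ _ d0); apply: filterS => k; rewrite sub0r normrN; apply: le_lt_trans; exact: ler_norm.
  have [k _ hk] : \forall k \near \oo, p / 2 ^+ k < d /\ q / 2 ^+ k < d.
    by apply: filterS2 (c p) (c q).
  by exists k; exact: hk (leqnn k).
apply: (le_trans (grow k)); rewrite -ler_pdivlMl ?exprn_gt0 //.
apply: (le_trans (hd _ _ _ _ _ _ (hl1 k) (hl2 k))); rewrite ?p2 ?q2 //.
have -> : 4 ^+ k = (2 ^+ k) ^+ 2 :> R.
  by rewrite -exprM mulnC exprM; congr (_ ^+ k); ring.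
have a0 : 2 ^+ k != 0 :> R by rewrite gt_eqF // exprn_gt0.
rewrite le_eqVlt; apply/orP; left; apply/eqP; field.
by rewrite a0 gt_eqF // addr_gt0.
Qed.

End Bisection.

Section Goursat.
Context {R : realType}.
Notation leb := (@lebesgue_measure R).
Implicit Types g : R -> R[i].

Definition lcont g := continuous (fun x => complex.Re (g x)) /\
  continuous (fun x => complex.Im (g x)).

Lemma lcont_cintegrable g a b : lcont g -> cintegrable leb `[a, b] g.
Proof.
move=> [g1 g2]; split; apply: continuous_compact_integrable;
  by [exact: segment_compact|exact: continuous_subspaceT].
Qed.

Lemma lcontP g : (forall x e, 0 < e -> exists2 d : R, 0 < d & forall h,
  `|h| < d -> cnorm (g (x + h) - g x) < e) -> lcont g.
Proof.
move=> hg.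
have key (p : R[i] -> R) : (forall z w, `|p z - p w| <= cnorm (z - w)) ->
    continuous (fun x => p (g x)).
  move=> hp x; apply/cvgrPdist_lt => e e0; have [d d0 hd] := hg x e e0.
  apply/nbhs_ballP; exists d => //= y; rewrite /ball /= => xy.
  rewrite distrC; apply: (le_lt_trans (hp _ _)).
  by have := hd (y - x); rewrite [x + _]addrC subrK [`|y - x|]distrC; apply.
split.
- by apply: key => z w; rewrite -ReN -ReD normRe_le.
- by apply: key => z w; rewrite -ImN -ImD normIm_le.
Qed.

Lemma cintegral_split g a b c : lcont g -> a <= b -> b <= c ->
  cintegral leb `[a, c] g = cintegral leb `[a, b] g + cintegral leb `[b, c] g.
Proof.
move=> gc ab bc.
have key (u : R -> R) : leb.-integrable `[a, c] (EFin \o u) ->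
    Rintegral leb `[a, c] u = Rintegral leb `[a, b] u + Rintegral leb `[b, c] u.
  move=> iu; have := @Rintegral_itvB R u (BLeft a) (BRight c) b iu.
  rewrite !bnd_simp => /(_ ab bc) h.
  have ib : leb.-integrable `]b, c] (EFin \o u).
    apply: integrableS iu => //; apply: subset_itvr; by rewrite bnd_simp.
  by rewrite -(Rintegral_itv_obnd_cbnd ib) -h; ring.
have [g1 g2] := lcont_cintegrable a c gc.
by rewrite /cintegral (key _ g1) (key _ g2).
Qed.

Lemma cintegral_segment_cst (c : R[i]) a b : a <= b ->
  cintegral leb `[a, b] (fun=> c) = c * (b - a)%:C.
Proof.
move=> ab; rewrite /cintegral !Rintegral_cst //= lebesgue_measure_itv /= lte_fin.
have -> : fine (if a < b then (b%:E - a%:E)%E else 0%E) = b - a.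
  case: ltP => //= ba; have -> : a = b by apply/le_anti; rewrite ab ba.
  by rewrite subrr.
by apply: complex_ext; rewrite ?ReM ?ImM /=; ring.
Qed.

Lemma cnorm_cintegral_segment_le g a b C : lcont g -> a <= b ->
  (forall x, a <= x <= b -> cnorm (g x) <= C) ->
  cnorm (cintegral leb `[a, b] g) <= C * (b - a).
Proof.
move=> gc ab gC; have gi := lcont_cintegrable a b gc.
apply: (le_trans (le_cnorm_cintegral _ gi)) => //.
have -> : C * (b - a) = \int[leb]_(x in `[a, b]) C.
  rewrite Rintegral_cst //= lebesgue_measure_itv /= lte_fin.
  case: ltP => //= ba; have -> : a = b by apply/le_anti; rewrite ab ba.
  by rewrite subrr.
apply: le_Rintegral => //; first exact: cintegrable_norm.
  by apply: continuous_compact_integrable;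
    [exact: segment_compact|apply: continuous_subspaceT => ?; exact: cvg_cst].
Qed.

Variable P : R[i] -> R[i].
Hypothesis hP : forall z, cdiff P z.

Let horiz y a p := cintegral leb `[a, a + p] (fun s => P (s +i* y)).
Let vert x c q := cintegral leb `[c, c + q] (fun t => P (x +i* t)).
(** The counterclockwise contour integral of P dz; the factor i on the vertical sides comes from dz
    = i dt. *)
Let bdry x y p q := horiz y x p - horiz (y + q) x p
  + 'i%C * (vert (x + p) y q - vert x y q).

Let contP z e : 0 < e -> exists2 d : R, 0 < d &
  forall h, cnorm h < d -> cnorm (P (z + h) - P z) < e.
Proof. exact: cdiff_cont. Qed.

Let lch y : lcont (fun s => P (s +i* y)).
Proof.
apply: lcontP => x e e0; have [d d0 hd] := contP (x +i* y) e0.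
exists d => // h hh; have -> : (x + h) +i* y = x +i* y + h%:C.
  by apply: complex_ext => /=; ring.
by apply: hd; rewrite cnormR.
Qed.

Let lcv x : lcont (fun t => P (x +i* t)).
Proof.
apply: lcontP => y e e0; have [d d0 hd] := contP (x +i* y) e0.
exists d => // h hh; have -> : x +i* (y + h) = x +i* y + 'i%C * h%:C.
  by apply: complex_ext; rewrite ?ReD ?ImD ?ReM ?ImM /=; ring.
by apply: hd; rewrite cnormM cnormI mul1r cnormR.
Qed.

Let bdry_split x y p q : 0 < p -> 0 < q ->
  bdry x y p q = bdry x y (p / 2) (q / 2) + bdry (x + p / 2) y (p / 2) (q / 2)
    + bdry x (y + q / 2) (p / 2) (q / 2)
    + bdry (x + p / 2) (y + q / 2) (p / 2) (q / 2).
Proof.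
move=> p0 q0.
have hs y' : horiz y' x p = horiz y' x (p / 2) + horiz y' (x + p / 2) (p / 2).
  rewrite /horiz (@cintegral_split _ x (x + p / 2)) //; [|by lra|by lra].
  by rewrite -addrA -splitr.
have vs x' : vert x' y q = vert x' y (q / 2) + vert x' (y + q / 2) (q / 2).
  rewrite /vert (@cintegral_split _ y (y + q / 2)) //; [|by lra|by lra].
  by rewrite -addrA -splitr.
have ep : x + p / 2 + p / 2 = x + p by rewrite -addrA -splitr.
have eq' : y + q / 2 + q / 2 = y + q by rewrite -addrA -splitr.
by rewrite /bdry !hs !vs ep eq'; ring.
Qed.

Let lcontB g1 g2 : lcont g1 -> lcont g2 -> lcont (fun x => g1 x - g2 x).
Proof.
move=> [a1 b1] [a2 b2]; split => x.
- under eq_fun do rewrite ReD ReN; apply: cvgB; [exact: a1|exact: a2].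
- under eq_fun do rewrite ImD ImN; apply: cvgB; [exact: b1|exact: b2].
Qed.

Let lcont_cst c : lcont (fun=> c).
Proof. by split => x; exact: cvg_cst. Qed.

(** Opposite sides are subtracted before estimating. The affine part of P contributes -i q L p from
    the horizontal pair and i p L q from the vertical pair, and these cancel. The remainder is at
    most (e/2)(p + q) at each point, so the two pairs contribute at most e (p + q) p and e (p + q)
    q. *)
Let bdry_loc x y e : 0 < e -> exists2 d, 0 < d &
  forall x' y' p q, 0 < p < d -> 0 < q < d -> x' <= x <= x' + p ->
    y' <= y <= y' + q -> cnorm (bdry x' y' p q) <= e * (p + q) ^+ 2.
Proof.
move=> e0; have [L hL] := hP (x +i* y).
have [d d0 hd] := hL (e / 2) (divr_gt0 e0 (ltr0Sn _ 1)).
exists (d / 2); first by rewrite divr_gt0.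
move=> x' y' p q /andP[p0 pd] /andP[q0 qd] /andP[x1 x2] /andP[y1 y2].
pose rem w := P w - P (x +i* y) - L * (w - (x +i* y)).
have hrem s t : x' <= s <= x' + p -> y' <= t <= y' + q ->
    cnorm (rem (s +i* t)) <= e / 2 * (p + q).
  move=> /andP[s1 s2] /andP[t1 t2].
  have lh : cnorm (s +i* t - (x +i* y)) <= p + q.
    by apply: (le_trans (cnorm_le _)); apply: lerD => /=; rewrite ler_norml; apply/andP; split; lra.
  have := hd (s +i* t - (x +i* y)); rewrite [x +i* y + _]addrC subrK => /(_ _)h.
  apply: (le_trans (h _)); first by apply: (le_lt_trans lh); lra.
  by apply: ler_wpM2l lh; lra.
have Erem w : P w = P (x +i* y) + L * (w - (x +i* y)) + rem w by rewrite /rem; ring.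
have sub g a b : lcont g -> forall c, a <= b ->
    cintegral leb `[a, b] (fun t => g t - c) = cintegral leb `[a, b] g - c * (b - a)%:C.
  move=> gc c ab; rewrite cintegralB ?cintegral_segment_cst //; exact: lcont_cintegrable.
have H : cnorm (horiz y' x' p - horiz (y' + q) x' p - (- 'i%C * q%:C * L) * p%:C)
    <= e * (p + q) * p.
  rewrite /horiz -cintegralB //; try exact: lcont_cintegrable.
  have := sub _ x' (x' + p) (lcontB (lch y') (lch (y' + q))) (- 'i%C * q%:C * L).
  rewrite [x' + p - x']addrAC subrr add0r => <-; last by lra.
  have -> : e * (p + q) * p = e * (p + q) * (x' + p - x') by ring.
  apply: cnorm_cintegral_segment_le; [|by lra|].
    by apply: lcontB (lcont_cst _); exact: lcontB.
  move=> s hs; rewrite (Erem (s +i* y')) (Erem (s +i* (y' + q))).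
  set r1 := rem _; set r2 := rem _.
  have -> : P (x +i* y) + L * (s +i* y' - (x +i* y)) + r1 - (P (x +i* y)
      + L * (s +i* (y' + q) - (x +i* y)) + r2) - - 'i%C * q%:C * L = r1 - r2.
    have -> : s +i* (y' + q) = s +i* y' + 'i%C * q%:C.
      by apply: complex_ext; rewrite ?ReD ?ImD ?ReM ?ImM /=; ring.
    by ring.
  apply: (le_trans (cnormB _ _)).
  have g1 : cnorm r1 <= e / 2 * (p + q) by apply: hrem => //; apply/andP; split; lra.
  have g2 : cnorm r2 <= e / 2 * (p + q) by apply: hrem => //; apply/andP; split; lra.
  by lra.
have V : cnorm (vert (x' + p) y' q - vert x' y' q - (p%:C * L) * q%:C)
    <= e * (p + q) * q.
  rewrite /vert -cintegralB //; try exact: lcont_cintegrable.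
  have := sub _ y' (y' + q) (lcontB (lcv (x' + p)) (lcv x')) (p%:C * L).
  rewrite [y' + q - y']addrAC subrr add0r => <-; last by lra.
  have -> : e * (p + q) * q = e * (p + q) * (y' + q - y') by ring.
  apply: cnorm_cintegral_segment_le; [|by lra|].
    by apply: lcontB (lcont_cst _); exact: lcontB.
  move=> s hs; rewrite (Erem ((x' + p) +i* s)) (Erem (x' +i* s)).
  set r1 := rem _; set r2 := rem _.
  have -> : P (x +i* y) + L * ((x' + p) +i* s - (x +i* y)) + r1 - (P (x +i* y)
      + L * (x' +i* s - (x +i* y)) + r2) - p%:C * L = r1 - r2.
    have -> : (x' + p) +i* s = x' +i* s + p%:C by apply: complex_ext => /=; ring.
    by ring.
  apply: (le_trans (cnormB _ _)).
  have g1 : cnorm r1 <= e / 2 * (p + q) by apply: hrem => //; apply/andP; split; lra.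
  have g2 : cnorm r2 <= e / 2 * (p + q) by apply: hrem => //; apply/andP; split; lra.
  by lra.
rewrite /bdry; set h := horiz _ _ _ - _ in H *; set v := vert _ _ _ - _ in V *.
have -> : h + 'i%C * v = (h - - 'i%C * q%:C * L * p%:C) + 'i%C * (v - p%:C * L * q%:C).
  by ring.
apply: (le_trans (cnormD _ _)); rewrite cnormM cnormI mul1r.
rewrite (_ : e * _ = e * (p + q) * p + e * (p + q) * q); last by ring.
exact: lerD.
Qed.

Lemma goursat_rectangle x y p q : 0 < p -> 0 < q ->
  cintegral leb `[x, x + p] (fun s => P (s +i* y))
    - cintegral leb `[x, x + p] (fun s => P (s +i* (y + q)))
    + 'i%C * (cintegral leb `[y, y + q] (fun t => P ((x + p) +i* t))
    - cintegral leb `[y, y + q] (fun t => P (x +i* t))) = 0.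
Proof.
move=> p0 q0; apply: cnorm_eq0; apply/le_anti; rewrite cnorm_ge0 andbT.
apply: (@bisection_le0 _ (fun x y p q => cnorm (bdry x y p q))) => //.
  move=> x1 y1 p1 q1 p10 q10; rewrite bdry_split //.
  by do 3!(apply: (le_trans (cnormD _ _)); rewrite lerD2r).
Qed.

(** Periodicity by iq cancels the two horizontal sides of the rectangle between the lines, leaving
    equality of the vertical ones. For functions of e^w and q = 2 pi it says that circle integrals
    do not depend on the radius. *)
Lemma vertical_invariance (q a b : R) : 0 < q ->
  (forall z, P (z + 'i%C * q%:C) = P z) ->
  cintegral leb `[0, q] (fun t => P (a +i* t))
  = cintegral leb `[0, q] (fun t => P (b +i* t)).
Proof.
move=> q0 per; wlog ab : a b / a < b.
  move=> h; have [ab|ba|->] := ltgtP a b; [exact: h| |by []].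
  by apply/esym; exact: h.
have p0 : 0 < b - a by rewrite subr_gt0.
have := goursat_rectangle a 0 p0 q0; rewrite add0r [a + (b - a)]addrC subrK.
have -> : (fun s => P (s +i* q)) = (fun s => P (s +i* 0)).
  apply/funext => s; rewrite -[RHS]per; congr P.
  by apply: complex_ext; rewrite ?ReD ?ImD ?ReM ?ImM /=; ring.
rewrite subrr add0r => /eqP; rewrite mulf_eq0 => /orP[/eqP h|].
  by have := @cnormI R; rewrite h cnorm0 => /eqP; rewrite eq_sym oner_eq0.
by rewrite subr_eq0 => /eqP ->.
Qed.

End Goursat.

Section CircleMean.
Context {R : realType}.
Notation leb := (@lebesgue_measure R).
Implicit Types (F G : R[i] -> R[i]).

Lemma cexp_polar (a t : R) : cexp (a +i* t) = (expR a)%:C * cexp ('i%C * t%:C).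
Proof.
rewrite -cexp_real -cexpD; congr cexp.
by apply: complex_ext; rewrite ?ReD ?ImD ?ReM ?ImM /=; ring.
Qed.

Lemma cexp_iE (t : R) : cexp ('i%C * t%:C) = cos t +i* sin t.
Proof.
rewrite /cexp; have -> : 'i%C * t%:C = 0 +i* t.
  by apply: complex_ext; rewrite ?ReM ?ImM /=; ring.
by rewrite /= expR0 mul1r.
Qed.

Lemma cexp_2pi (z : R[i]) : cexp (z + 'i%C * (2 * pi)%:C) = cexp z.
Proof.
rewrite cexpD cexp_iE mulrC [2 * pi]mulr_natl.
have -> : cos (pi *+ 2) = 1 :> R by rewrite -[pi *+ 2]add0r cosD2pi cos0.
have -> : sin (pi *+ 2) = 0 :> R by rewrite -[pi *+ 2]add0r sinD2pi sin0.
by rewrite mul1r.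
Qed.

(** In w = log z the unit circle is the line Re w = 0. It is moved to Re w = ln (d / 2), that is to
    a circle of radius d / 2, on which G differs from G(0) by less than e / (2 pi). *)
Lemma circle_mean G : holomorphic G ->
  cintegral leb `[0, 2 * pi] (fun t => G (cexp ('i%C * t%:C))) = (2 * pi)%:C * G 0.
Proof.
move=> /holomorphicP hG; have pi2 : 0 < 2 * pi :> R by rewrite mulr_gt0 // pi_gt0.
pose P z := G (cexp z).
have hP z : cdiff P z by apply: (cdiff_comp (F := G)) (hG _); exact: cdiff_cexp.
have inv a b := vertical_invariance hP a b pi2 (fun z => congr1 G (cexp_2pi z)).
have -> : (fun t => G (cexp ('i%C * t%:C))) = (fun t => P (0 +i* t)).
  by apply/funext => t; rewrite /P (cexp_polar 0 t) expR0 mul1r.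
apply/eqP; rewrite -subr_eq0; apply/eqP/cnorm_eq0/le_anti; rewrite cnorm_ge0 andbT.
apply/ler_addgt0Pr => e e0; rewrite add0r.
have [d d0 hd] := cdiff_cont (hG 0) (divr_gt0 e0 pi2).
have lP a : lcont (fun t => P (a +i* t)).
  apply: lcontP => x e' e'0; have [d' d'0 hd'] := cdiff_cont (hP (a +i* x)) e'0.
  exists d' => // h hh; have -> : a +i* (x + h) = a +i* x + 'i%C * h%:C.
    by apply: complex_ext; rewrite ?ReD ?ImD ?ReM ?ImM /=; ring.
  by apply: hd'; rewrite cnormM cnormI mul1r cnormR.
pose a := ln (d / 2); rewrite (inv 0 a).
have lc c : lcont (fun=> c : R[i]) by split => x; exact: cvg_cst.
have -> : (2 * pi)%:C * G 0 = cintegral leb `[0, 2 * pi] (fun=> G 0).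
  by rewrite cintegral_segment_cst ?(ltW pi2) // subr0 mulrC.
rewrite -cintegralB //; try exact: lcont_cintegrable.
have -> : e = e / (2 * pi) * (2 * pi - 0).
  by rewrite subr0 mulfVK // gt_eqF.
apply: cnorm_cintegral_segment_le; rewrite ?(ltW pi2) //.
  have [a1 a2] := lP a; split => x.
  - by under eq_fun do rewrite ReD; apply: cvgD; [exact: a1|exact: cvg_cst].
  - by under eq_fun do rewrite ImD; apply: cvgD; [exact: a2|exact: cvg_cst].
move=> x _; apply: ltW; have := hd (cexp (a +i* x)); rewrite add0r; apply.
by rewrite cnorm_cexp /= /a lnK ?posrE ?divr_gt0 //; lra.
Qed.

End CircleMean.

(** * Cauchy-Schwarz inequality and Gaussian integrals *)

Section Jensen.
Context {R : realType} {d : measure_display} {T : measurableType d}.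
Variable mu : {measure set T -> \bar R}.

(** The Cauchy-Schwarz inequality for the measure a dmu. Integrability of a M comes from a M <= a +
    a M^2, and the inequality from the sign of a quadratic polynomial. *)
Lemma weighted_jensen (a M : T -> R) :
  measurable_fun setT a -> measurable_fun setT M ->
  (forall x, 0 <= a x) -> (forall x, 0 <= M x) ->
  (\int[mu]_x (a x)%:E < +oo)%E -> (\int[mu]_x (a x * M x ^+ 2)%:E < +oo)%E ->
  mu.-integrable setT (EFin \o (fun x => a x * M x)) /\
  (\int[mu]_x (a x * M x)) ^+ 2 <=
    (\int[mu]_x a x) * (\int[mu]_x (a x * M x ^+ 2)).
Proof.
move=> ma mM a0 M0 fa fb.
have ige (u : T -> R) : measurable_fun setT u -> (forall x, 0 <= u x) ->
    (\int[mu]_x (u x)%:E < +oo)%E -> mu.-integrable setT (EFin \o u).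
  move=> mu' u0 fu; apply/integrableP; split; first exact/measurable_EFinP.
  by under eq_integral do rewrite /= ger0_norm //.
have ia : mu.-integrable setT (EFin \o a) by exact: ige.
have ib : mu.-integrable setT (EFin \o (fun x => a x * M x ^+ 2)).
  apply: ige => //; first by apply: measurable_funM => //; exact: measurable_funX.
  by move=> x; rewrite mulr_ge0 ?sqr_ge0.
have ic : mu.-integrable setT (EFin \o (fun x => a x * M x)).
  apply: (le_integrable measurableT _ _ (integrableD measurableT ia ib)).
    by apply/measurable_EFinP; exact: measurable_funM.
  move=> x _; rewrite /= lee_fin !ger0_norm ?addr_ge0 ?mulr_ge0 ?sqr_ge0 //.
  by have := a0 x; have := sqr_ge0 (M x - 1); have := M0 x; nra.
split => //; set A := Rintegral _ _ _ ; set B := Rintegral _ _ _; set C := Rintegral _ _ _.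
(* The integral of a (M - m)^2, expanded in m. Its value at the minimum m = A / B gives the
   inequality when B is nonzero. *)
have var (m : R) : 0 <= C - 2 * m * A + m ^+ 2 * B.
  have <- : \int[mu]_x (a x * (M x - m) ^+ 2) = C - 2 * m * A + m ^+ 2 * B.
    have Z (k : R) (u : T -> R) : mu.-integrable setT (EFin \o u) ->
        mu.-integrable setT (EFin \o (fun x => k * u x)).
      by move=> iu; rewrite /comp; under eq_fun do rewrite EFinM; exact: integrableZl.
    under eq_Rintegral => x _.
      rewrite (_ : _ * _ = (a x * M x ^+ 2 - 2 * m * (a x * M x)) + m ^+ 2 * a x); last by ring.
      over.
    rewrite RintegralD ?RintegralB ?RintegralZl //; try exact: Z.
    have := integrableB measurableT ib (Z (2 * m) _ ic).
    by apply: eq_integrable => // x _ /=; rewrite EFinB.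
  by apply: Rintegral_ge0 => x _; rewrite mulr_ge0 ?sqr_ge0.
have B0 : 0 <= B by apply: Rintegral_ge0.
have C0 : 0 <= C by apply: Rintegral_ge0 => x _; rewrite mulr_ge0 ?sqr_ge0.
have A0 : 0 <= A by apply: Rintegral_ge0 => x _; rewrite mulr_ge0.
have [Bz|Bz] := eqVneq B 0; last first.
  have Bp : 0 < B by rewrite lt_neqAle eq_sym Bz.
  have := var (A / B); have -> : C - 2 * (A / B) * A + (A / B) ^+ 2 * B = C - A ^+ 2 / B.
    by field.
  by rewrite subr_ge0 ler_pdivrMr // mulrC.
rewrite Bz mul0r; have [->|Az] := eqVneq A 0; first by rewrite expr0n.
have Ap : 0 < A by rewrite lt_neqAle eq_sym Az.
(* For B = 0 the polynomial is affine and nonnegative everywhere, which is impossible when A > 0: at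
   this m it equals -1. *)
have := var ((C + 1) / (2 * A)).
have -> : C - 2 * ((C + 1) / (2 * A)) * A + ((C + 1) / (2 * A)) ^+ 2 * B = - 1.
  by rewrite Bz; field.
by lra.
Qed.

Lemma cintegral_jensen (a : T -> R) (W : T -> R[i]) :
  measurable_fun setT a -> cmeas W -> (forall x, 0 <= a x) ->
  (\int[mu]_x (a x)%:E < +oo)%E ->
  (\int[mu]_x (a x * cnorm (W x) ^+ 2)%:E < +oo)%E ->
  cintegrable mu setT (fun x => (a x)%:C * W x) /\
  cnorm (cintegral mu setT (fun x => (a x)%:C * W x)) ^+ 2 <=
    (\int[mu]_x a x) * (\int[mu]_x (a x * cnorm (W x) ^+ 2)).
Proof.
move=> ma mW a0 fa fb.
have [i1 j1] := weighted_jensen ma (measurable_cnorm mW) a0 (fun x => cnorm_ge0 (W x)) fa fb.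
have ci : cintegrable mu setT (fun x => (a x)%:C * W x).
  apply: le_cintegrable i1; first by apply: cmeasM => //; exact: cmeas_real.
  by move=> x; rewrite cnormM cnormR ger0_norm.
split => //; apply: le_trans j1.
have E : \int[mu]_x cnorm ((a x)%:C * W x) = \int[mu]_x (a x * cnorm (W x)).
  by apply: eq_Rintegral => x _; rewrite cnormM cnormR ger0_norm.
have := le_cnorm_cintegral measurableT ci; rewrite E => h.
rewrite lerXn2r ?nnegrE ?cnorm_ge0 //.
exact: le_trans (cnorm_ge0 _) h.
Qed.

End Jensen.

Section Gauss.
Context {R : realType}.
Notation leb := (@lebesgue_measure R).
Notation plane := (@plane_measure R).

Lemma gauss_ge0 (w : R * R) : 0 <= gauss w.
Proof. exact: expR_ge0. Qed.

Lemma measurable_gauss : measurable_fun setT (gauss : measurableTypeR R * measurableTypeR R -> R).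
Proof.
apply: measurableT_comp; first exact: measurable_expR.
apply: measurable_funN; apply: measurable_funD; apply: measurable_funX;
  [exact: measurable_fst|exact: measurable_snd].
Qed.

Lemma integral_gauss : (\int[plane]_w (gauss w)%:E = (pi : R)%:E)%E.
Proof.
rewrite /plane_measure fubini_tonelli1; last 2 first.
- by apply/measurable_EFinP; exact: measurable_gauss.
- by move=> x; rewrite lee_fin gauss_ge0.
rewrite /fubini_F.
under eq_integral => x _.
  under eq_integral => y _.
    rewrite /gauss /= opprD expRD EFinM -/(gauss_fun x) -/(gauss_fun y); over.
  rewrite ge0_integralZl //=; last 3 first.
  - by apply/measurable_EFinP; exact: measurable_gauss_fun.
  - by move=> y _; rewrite lee_fin gauss_fun_ge0.
  - by rewrite lee_fin gauss_fun_ge0.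
  rewrite integralT_gauss; over.
rewrite ge0_integralZr //=; last 2 first.
- by apply/measurable_EFinP; exact: measurable_gauss_fun.
- by move=> y _; rewrite lee_fin gauss_fun_ge0.
by rewrite integralT_gauss -EFinM -expr2 sqr_sqrtr // pi_ge0.
Qed.

Lemma Rintegral_gauss : \int[plane]_w gauss w = pi :> R.
Proof. by rewrite /Rintegral integral_gauss. Qed.

(** In each variable e^(-x^2/2) is a multiple of the standard normal density. Half of the Gaussian
    weight is what remains once the other half has absorbed exponential factors. *)
Lemma integral_half_gauss :
  (\int[plane]_w (expR (- ((w.1 ^+ 2 + w.2 ^+ 2) / 2)))%:E < +oo)%E.
Proof.
have s10 : (1 : R) != 0 by exact: oner_neq0.
pose g (x : R) := expR (- (x ^+ 2 / 2)).
have mg : measurable_fun setT g.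
  apply: measurableT_comp; first exact: measurable_expR.
  apply: measurable_funN; apply: measurable_funM; last exact: measurable_cst.
  exact: measurable_funX.
have g0 x : 0 <= g x := expR_ge0 _.
have gfin : (\int[leb]_x (g x)%:E < +oo)%E.
  have pk : 0 < @normal_peak R 1 by exact: normal_peak_gt0.
  have E x : g x = (normal_peak 1)^-1 * normal_pdf 0 1 x.
    rewrite /normal_pdf (negbTE s10) mulKf ?gt_eqF // /normal_fun /g subr0.
    by rewrite expr1n mulNr mulr2n.
  under eq_integral do rewrite E EFinM.
  rewrite ge0_integralZl //=; first last.
  - by rewrite lee_fin invr_ge0 ltW.
  - by move=> x _; rewrite lee_fin normal_pdf_ge0.
  - by apply/measurable_EFinP; exact: measurable_normal_pdf.
  by rewrite integral_normal_pdf // mule1 ltry.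
have gfn : (\int[leb]_x (g x)%:E)%E \is a fin_num.
  by rewrite ge0_fin_numE // integral_ge0 // => x _; rewrite lee_fin.
rewrite /plane_measure fubini_tonelli1; last 2 first.
- apply/measurable_EFinP; apply: measurableT_comp; first exact: measurable_expR.
  apply: measurable_funN; apply: measurable_funM; last exact: measurable_cst.
  by apply: measurable_funD; apply: measurable_funX; [exact: measurable_fst|exact: measurable_snd].
- by move=> x; rewrite lee_fin expR_ge0.
rewrite /fubini_F.
under eq_integral => x _.
  under eq_integral => y _.
    rewrite /= mulrDl opprD expRD EFinM -/(g x) -/(g y); over.
  rewrite ge0_integralZl //=; last 3 first.
  - by apply/measurable_EFinP.
  - by move=> y _; rewrite lee_fin.
  - by rewrite lee_fin.
  over.
rewrite ge0_integralZr //=; last 3 first.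
- by apply/measurable_EFinP.
- by move=> y _; rewrite lee_fin.
- by apply: integral_ge0 => x _; rewrite lee_fin.
by rewrite lte_mul_pinfty // integral_ge0 // => x _; rewrite lee_fin.
Qed.

End Gauss.

(** * Fock space and the representations beta *)

Section FockBasics.
Context {R : realType}.
Notation leb := (@lebesgue_measure R).
Notation plane := (@plane_measure R).
Notation RR := (measurableTypeR R * measurableTypeR R)%type.
Implicit Types (F G K : R[i] -> R[i]).

Definition toC (w : R * R) : R[i] := w.1 +i* w.2.

(* pi times the squared Fock norm. *)
Definition N2 F : \bar R :=
  (\int[plane]_w (cnorm (F (toC w)) ^+ 2 * gauss w)%:E)%E.

(** Fock space without holomorphy, for functions given by integrals whose holomorphy is still to be
    proved. *)
Definition L2 F : Prop := cmeas (fun w : RR => F (toC w)) /\ (N2 F < +oo)%E.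

Lemma N2_ge0 F : (0 <= N2 F)%E.
Proof. by apply: integral_ge0 => w _; rewrite lee_fin mulr_ge0 ?sqr_ge0 ?gauss_ge0. Qed.

Lemma N2_fin F : (N2 F < +oo)%E -> N2 F = (fine (N2 F))%:E.
Proof. by move=> h; rewrite fineK // ge0_fin_numE // N2_ge0. Qed.

Lemma fockP F : fock F <-> holomorphic F /\ (N2 F < +oo)%E.
Proof.
have pi0 : 0 < pi^-1 :> R by rewrite invr_gt0 pi_gt0.
split=> -[hF fF]; split => //; move: fF; rewrite -/(N2 F); last first.
  by move=> h; rewrite lte_mul_pinfty // lee_fin ltW.
have := N2_ge0 F; case: (N2 F) => [r _ _|_|//]; first exact: ltry.
by rewrite gt0_muley // lte_fin.
Qed.

Lemma fock_L2 F : fock F -> L2 F.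
Proof.
by move=> /fockP[hF fF]; split => //; apply: ccont_cmeas; exact: holomorphic_ccont.
Qed.

Lemma fock_normE F : fock_norm F = Num.sqrt (pi^-1 * fine (N2 F)).
Proof.
congr Num.sqrt; rewrite /fock_dot ReM /= mul0r subr0; congr (_ * _).
rewrite /Rintegral /N2; congr fine; apply: eq_integral => w _; congr EFin.
by rewrite -/(toC w) mulJE -RCM.
Qed.

Lemma measurable_N2_integrand F : cmeas (fun w : RR => F (toC w)) ->
  measurable_fun setT (fun w : RR => (cnorm (F (toC w)) ^+ 2 * gauss w)%:E).
Proof.
move=> mF; apply/measurable_EFinP; apply: measurable_funM.
  by apply: measurable_funX; exact: measurable_cnorm.
exact: measurable_gauss.
Qed.

Lemma N2Z (c : R[i]) F : cmeas (fun w : RR => F (toC w)) ->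
  N2 (fun z => c * F z) = ((cnorm c ^+ 2)%:E * N2 F)%E.
Proof.
move=> mF; rewrite /N2; under eq_integral do rewrite cnormM exprMn -mulrA EFinM.
rewrite ge0_integralZl //.
- exact: measurable_N2_integrand.
- by move=> w _; rewrite lee_fin mulr_ge0 ?sqr_ge0 ?gauss_ge0.
- by rewrite lee_fin sqr_ge0.
Qed.

(** The inequality |a + b|^2 <= 2 |a|^2 + 2 |b|^2 stands in for the triangle inequality; the lost
    factor is harmless for finiteness and for limits equal to zero. *)
Lemma N2D F G : cmeas (fun w : RR => F (toC w)) ->
  cmeas (fun w : RR => G (toC w)) ->
  (N2 (fun z => F z + G z)%R <= 2%:E * N2 F + 2%:E * N2 G)%E.
Proof.
move=> mF mG; rewrite /N2 -!ge0_integralZl //; try exact: measurable_N2_integrand;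
  try by move=> w _; rewrite lee_fin mulr_ge0 ?sqr_ge0 ?gauss_ge0.
rewrite -ge0_integralD //; last 4 first.
- by move=> w _; rewrite mule_ge0 // lee_fin mulr_ge0 ?sqr_ge0 ?gauss_ge0.
- by apply: measurable_funeM; exact: measurable_N2_integrand.
- by move=> w _; rewrite mule_ge0 // lee_fin mulr_ge0 ?sqr_ge0 ?gauss_ge0.
- by apply: measurable_funeM; exact: measurable_N2_integrand.
apply: ge0_le_integral_nonmeas => w _.
  by rewrite lee_fin mulr_ge0 ?sqr_ge0 ?gauss_ge0.
rewrite -!EFinM -EFinD lee_fin.
have -> (a b g : R) : 2 * (a * g) + 2 * (b * g) = (2 * a + 2 * b) * g by ring.
rewrite ler_wpM2r ?gauss_ge0 //.
exact: cnorm_sqrD.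
Qed.

Lemma L2Z c F : L2 F -> L2 (fun z => c * F z).
Proof.
move=> [mF fF]; split; first by apply: cmeasM => //; exact: cmeas_cst.
by rewrite N2Z // lte_mul_pinfty // lee_fin sqr_ge0.
Qed.

Lemma L2D F G : L2 F -> L2 G -> L2 (fun z => F z + G z).
Proof.
move=> [mF fF] [mG fG]; split; first exact: cmeasD.
apply: le_lt_trans (N2D mF mG) _.
by rewrite lte_add_pinfty // lte_mul_pinfty.
Qed.

Lemma L2B F G : L2 F -> L2 G -> L2 (fun z => F z - G z).
Proof.
move=> hF hG; under eq_fun do rewrite -[- G _]mulN1r.
by apply: L2D => //; exact: L2Z.
Qed.

Lemma fockZ c F : fock F -> fock (fun z => c * F z).
Proof.
move=> hF; have [_ f2] := L2Z c (fock_L2 hF).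
move/fockP : hF => [/holomorphicP hF _]; apply/fockP; split => //.
by apply/holomorphicP => z; exact: cdiffZ.
Qed.

Lemma fockD F G : fock F -> fock G -> fock (fun z => F z + G z).
Proof.
move=> hF hG; have [_ f2] := L2D (fock_L2 hF) (fock_L2 hG).
move/fockP : hF => [/holomorphicP hF _]; move/fockP : hG => [/holomorphicP hG _].
by apply/fockP; split => //; apply/holomorphicP => z; exact: cdiffD.
Qed.

Lemma fock0 : fock (fun=> 0 : R[i]).
Proof.
apply/fockP; split; first by apply/holomorphicP => z; exact: cdiff_cst.
rewrite /N2 integral0_eq // => w _; by rewrite cnorm0 expr0n mul0r.
Qed.

Lemma fockB F G : fock F -> fock G -> fock (fun z => F z - G z).
Proof.
move=> hF hG; under eq_fun do rewrite -[- G _]mulN1r.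
by apply: fockD => //; exact: fockZ.
Qed.

Lemma L2_cintegrable_gauss G : L2 G ->
  cintegrable plane setT (fun w => (gauss w)%:C * G (toC w)) /\
  cnorm (cintegral plane setT (fun w => (gauss w)%:C * G (toC w))) ^+ 2
    <= pi * fine (N2 G).
Proof.
move=> [mG fG].
have [i1 j1] := @cintegral_jensen R _ _ plane gauss _ measurable_gauss mG (@gauss_ge0 R)
  (eq_ind_r (fun x => x < +oo)%E (ltry _) integral_gauss)
  (eq_ind _ (fun x => x < +oo)%E fG _ (eq_integral _ _ (fun w _ => congr1 EFin (mulrC _ _)))).
split => //; apply: (le_trans j1); rewrite Rintegral_gauss.
rewrite ler_pM2l ?pi_gt0 // le_eqVlt; apply/orP; left; apply/eqP.
by rewrite /Rintegral /N2; congr fine; apply: eq_integral => w _; rewrite mulrC.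
Qed.

Lemma toC_rot (c s : R) w : toC (rot c s w) = (c +i* s) * toC w.
Proof. by apply: complex_ext; rewrite ?ReM ?ImM /=; ring. Qed.

Lemma gauss_rot (c s : R) w : c ^+ 2 + s ^+ 2 = 1 -> gauss (rot c s w) = gauss w.
Proof.
move=> cs; rewrite /gauss /=; congr (expR (- _)).
transitivity ((c ^+ 2 + s ^+ 2) * (w.1 ^+ 2 + w.2 ^+ 2)); first by ring.
by rewrite cs mul1r.
Qed.

Lemma holomorphic_circle_lcont G : holomorphic G ->
  lcont (fun t => G (cexp ('i%C * t%:C))).
Proof.
move=> /holomorphicP hG; have hP z : cdiff (fun x => G (cexp ('i%C * x))) z.
  apply: (cdiff_comp (F := G)) (hG _); apply: (cdiff_comp (F := cexp)) (cdiff_cexp _).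
  by apply: cdiffZ; exact: cdiff_id.
apply: lcontP => x e e0; have [d d0 hd] := cdiff_cont (hP x%:C) e0.
by exists d => // h hh; rewrite RCD; apply: hd; rewrite cnormR.
Qed.

(** Polar coordinates are avoided by integrating e^(-|w|^2) G(e^(it) w) over t in [0, 2 pi] and w in
    C in both orders. With w first, invariance under rotations gives 2 pi I. With t first, the mean
    value property of z -> G(z w) at 0 gives 2 pi G(0) times the Gaussian. *)
Lemma gauss_mean G : fock G ->
  cintegral plane setT (fun w => (gauss w)%:C * G (toC w)) = pi%:C * G 0.
Proof.
move=> gG; have [mG fG] := fock_L2 gG; have [hG _] := (fockP G).1 gG.
have [gi _] := L2_cintegrable_gauss (fock_L2 gG).
set I := cintegral _ _ _.
have pi2 : 0 < 2 * pi :> R by rewrite mulr_gt0 // pi_gt0.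
have pi2C : (2 * pi)%:C != 0 :> R[i].
  by apply/eqP => /(congr1 (@complex.Re R)) /= h; move: pi2; rewrite h ltxx.
pose D : set R := `[0, 2 * pi]%classic.
have mD : measurable D by exact: measurable_itv.
have muD : leb D = (2 * pi)%:E.
  by rewrite lebesgue_measure_itv /= lte_fin pi2 sube0.
pose f (p : measurableTypeR R * RR) : R[i] :=
  cind D p.1 * ((gauss p.2)%:C * G (cexp ('i%C * p.1%:C) * toC p.2)).
have rotE t w : cexp ('i%C * t%:C) * toC w = toC (rot (cos t) (sin t) w).
  by rewrite toC_rot cexp_iE.
have mf : cmeas f.
  apply: cmeasM; first exact: (cmeas_comp (cmeas_cind mD) (@measurable_fst _ _ _ _)).
  apply: cmeasM.
    apply: (@cmeas_comp _ _ _ _ _ (fun w : RR => (gauss w)%:C) snd) => //.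
    by apply: cmeas_real; exact: measurable_gauss.
  rewrite (_ : (fun p => _) = (fun p : measurableTypeR R * RR =>
      G (toC (rot (cos p.1) (sin p.1) p.2)))); last first.
    by apply/funext => p; rewrite rotE.
  apply: (@cmeas_comp _ _ _ _ _ (fun w : RR => G (toC w))
    (fun p : measurableTypeR R * RR => rot (cos p.1) (sin p.1) p.2 : RR)) => //.
  have mc : measurable_fun setT (fun p : measurableTypeR R * RR => cos p.1).
    apply: measurableT_comp; last exact: measurable_fst.
    exact: continuous_measurable_fun (@continuous_cos R).
  have ms : measurable_fun setT (fun p : measurableTypeR R * RR => sin p.1).
    apply: measurableT_comp; last exact: measurable_fst.
    exact: continuous_measurable_fun (@continuous_sin R).
  have m1 : measurable_fun setT (fun p : measurableTypeR R * RR => p.2.1).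
    by apply: measurableT_comp; [exact: measurable_fst|exact: measurable_snd].
  have m2 : measurable_fun setT (fun p : measurableTypeR R * RR => p.2.2).
    by apply: measurableT_comp; [exact: measurable_snd|exact: measurable_snd].
  apply: measurable_fun_pair.
    by apply: measurable_funB; exact: measurable_funM.
  by apply: measurable_funD; exact: measurable_funM.
have Kfin := (cintegrableP _ _).1 gi; case: Kfin => _.
set K := (\int[plane]_w (cnorm ((gauss w)%:C * G (toC w)))%:E)%E => Kfin.
have K0 : (0 <= K)%E by apply: integral_ge0 => w _; rewrite lee_fin cnorm_ge0.
have cs1 t : cos t ^+ 2 + sin t ^+ 2 = 1 :> R by exact: cos2Dsin2.
have shift t (w : RR) : (gauss w)%:C * G (cexp ('i%C * t%:C) * toC w) =
    (fun w => (gauss w)%:C * G (toC w)) (rot (cos t) (sin t) w).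
  by rewrite /= rotE gauss_rot.
have fi : cintegrable (leb \x sfprod leb leb)%E setT f.
  apply/cintegrable_prodP; split => //.
  have E t : (\int[plane]_w (cnorm (f (t, w)))%:E = (\1_D t)%:E * K)%E.
    rewrite /f /=; under eq_integral do rewrite shift cnormM EFinM.
    have [mr hr] := mpres_rot (cs1 t).
    have mg := measurable_cnormE (cmeas_comp (cintegrable_cmeas gi) mr).
    rewrite (ge0_integralZl plane measurableT mg); last 2 first.
    - by move=> w _; rewrite lee_fin cnorm_ge0.
    - by rewrite lee_fin cnorm_ge0.
    rewrite (hr (fun w => (cnorm ((gauss w)%:C * G (toC w)))%:E)); last 2 first.
    - by apply: measurable_cnormE; have /cintegrable_cmeas := gi.
    - by move=> w; rewrite lee_fin cnorm_ge0.
    by rewrite /cind cnormR ger0_norm // indicE ler0n.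
  under eq_integral do rewrite E.
  rewrite ge0_integralZr //; [|by apply/measurable_EFinP; exact: measurable_indic..].
  have -> : (\int[leb]_x (\1_D x)%:E)%E = (2 * pi)%:E.
    by rewrite integral_indic // setIT; exact: muD.
  by rewrite lte_mul_pinfty // lee_fin ltW.
have := cintegral_fubini fi.
have -> : cintegral leb setT (fun t => cintegral (sfprod leb leb) setT (fun w => f (t, w)))
    = (2 * pi)%:C * I.
  have -> : (fun t => cintegral (sfprod leb leb) setT (fun w => f (t, w)))
      = (fun t => cind D t * I).
    apply/funext => t; rewrite /f /= cintegralZ //; last first.
      rewrite (_ : (fun w => _) = (fun w : RR => (fun w => (gauss w)%:C * G (toC w)) (rot (cos t) (sin t) w))); last first.
        by apply/funext => w; exact: shift.
      exact: mpres_cintegrable (mpres_rot (cs1 t)) gi.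
    congr (_ * _); under eq_cintegral do rewrite shift.
    by apply: mpres_cintegral (mpres_rot (cs1 t)) _; exact: cintegrable_cmeas gi.
  rewrite -cintegral_cind /D cintegral_segment_cst ?ltW // subr0 mulrC //.
have -> : cintegral (sfprod leb leb) setT (fun w => cintegral leb setT (fun t => f (t, w)))
    = (2 * pi)%:C * (pi%:C * G 0).
  have -> : (fun w => cintegral leb setT (fun t => f (t, w)))
      = (fun w => (2 * pi)%:C * G 0 * (gauss w)%:C).
    apply/funext => w; rewrite /f /= -cintegral_cind.
    have hw : holomorphic (fun z => G (z * toC w)).
      apply/holomorphicP => z; apply: (cdiff_comp (F := G)) ((holomorphicP _).1 hG _).
      under [X in cdiff X _]eq_fun do rewrite mulrC.
      by apply: cdiffZ; exact: cdiff_id.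
    rewrite cintegralZ //; last exact: lcont_cintegrable (holomorphic_circle_lcont hw).
    by rewrite (circle_mean hw) mul0r mulrC.
  have gg : cintegrable plane setT (fun w => (gauss w)%:C : R[i]).
    apply/cintegrableP; split; first by apply: cmeas_real; exact: measurable_gauss.
    under eq_integral do rewrite cnormR ger0_norm ?gauss_ge0 //.
    by rewrite integral_gauss ltry.
  rewrite cintegralZ // -mulrA; congr (_ * _); rewrite mulrC; congr (_ * _).
  apply: complex_ext => /=; first exact: Rintegral_gauss.
  by rewrite /Rintegral integral0.
by move/(mulfI pi2C).
Qed.

(** G(0) is the Gaussian mean of G, so Cauchy-Schwarz against the weight of total mass pi bounds
    it. *)
Lemma eval0_le G : fock G -> cnorm (G 0) ^+ 2 <= pi^-1 * fine (N2 G).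
Proof.
move=> gG; have [_] := L2_cintegrable_gauss (fock_L2 gG); rewrite gauss_mean //.
have p0 : 0 < pi :> R := pi_gt0 R.
rewrite cnormM cnormR (ger0_norm (ltW p0)) exprMn => h.
rewrite ler_pdivlMl // -(ler_pM2l p0); apply: le_trans h.
by rewrite le_eqVlt; apply/orP; left; apply/eqP; ring.
Qed.

End FockBasics.

(** * Unitarity, adjoints and the reproducing kernel *)

Section Representation.
Context {R : realType}.
Notation plane := (@plane_measure R).
Notation RR := (measurableTypeR R * measurableTypeR R)%type.
Implicit Types (F G K : R[i] -> R[i]) (h : R) (p q : heis R) (w : R * R).

Definition hinv q : heis R := (- q.1.1, - q.1.2, - q.2).

(** The exponent in [beta_pos], in real coordinates, so that identities between the operators become
    polynomial identities in the coordinates and sqrt h. *)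
Definition bexp h q w : R[i] :=
  (- Num.sqrt h * (w.1 * q.1.1 + w.2 * q.1.2) - h / 2 * (q.1.1 ^+ 2 + q.1.2 ^+ 2))
  +i* (2 * h * q.2 - Num.sqrt h * (w.2 * q.1.1 - w.1 * q.1.2)).

Definition bshift h q w : R * R :=
  (w.1 + Num.sqrt h * q.1.1, w.2 + Num.sqrt h * q.1.2).

Lemma toC_ReIm (z : R[i]) : toC (complex.Re z, complex.Im z) = z.
Proof. by case: z. Qed.

Lemma beta_posE h q F w :
  beta_pos h q F (toC w) = cexp (bexp h q w) * F (toC (bshift h q w)).
Proof.
rewrite /beta_pos; congr (cexp _ * F _); last first.
  by apply: complex_ext; rewrite ?ReD ?ImD ?ReM ?ImM /=; ring.
rewrite cnorm_sqr /=.
by apply: complex_ext; rewrite !(ReD, ImD, ReN, ImN, ReM, ImM) /=; field.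
Qed.

Lemma funC_ext F G : (forall w, F (toC w) = G (toC w)) -> F = G.
Proof. by move=> FG; apply/funext => z; rewrite -(toC_ReIm z). Qed.

Lemma beta_pos_holomorphic h q F : holomorphic F -> holomorphic (beta_pos h q F).
Proof.
move=> /holomorphicP hF; apply/holomorphicP => z; rewrite /beta_pos; apply: cdiffM.
  apply: (cdiff_comp (F := cexp)) (cdiff_cexp _).
  apply: cdiffD; last exact: cdiff_cst.
  apply: cdiffD; first exact: cdiff_cst.
  rewrite (_ : (fun x => _) = (fun x => - ((Num.sqrt h)%:C * (q.1.1 +i* q.1.2)^*%C) * x)).
    by apply: cdiffZ; exact: cdiff_id.
  by apply/funext => x; ring.
apply: (cdiff_comp (F := F)) (hF _).
by apply: cdiffD; [exact: cdiff_id|exact: cdiff_cst].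
Qed.

Lemma mpres_bshift h q : mpres plane (bshift h q).
Proof. exact: mpres_plane_add. Qed.

Lemma cexp_conj (z : R[i]) : (cexp z)^*%C = cexp z^*%C.
Proof.
by case: z => a b; apply: complex_ext;
  rewrite ?ReJ ?ImJ /cexp ?ReM ?ImM /= ?cosN ?sinN; ring.
Qed.

Lemma gaussC w : (gauss w)%:C = cexp (- (w.1 ^+ 2 + w.2 ^+ 2))%:C.
Proof. by rewrite cexp_real. Qed.

Lemma conjM (x y : R[i]) : (x * y)^*%C = x^*%C * y^*%C.
Proof. exact: rmorphM. Qed.

(** The adjoint relation at the level of integrands: the translation w -> w + sqrt h z carries one
    to the other, and the exponents, Gaussian included, agree. *)
Lemma beta_pos_dot_pointwise h q K F w : 0 <= h ->
  beta_pos h q K (toC w) * (F (toC w))^*%C * (gauss w)%:C =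
  K (toC (bshift h q w)) * (beta_pos h (hinv q) F (toC (bshift h q w)))^*%C
    * (gauss (bshift h q w))%:C.
Proof.
move=> h0; have s2 := sqr_sqrtr h0.
rewrite !beta_posE; have -> : bshift h (hinv q) (bshift h q w) = w.
  by case: w => a b; rewrite /bshift /=; congr (_, _); ring.
rewrite conjM cexp_conj !gaussC.
set e1 := cexp (bexp h q w); set e2 := cexp (- (w.1 ^+ 2 + _))%:C.
set e3 := cexp _^*%C; set e4 := cexp _%:C.
have -> (a b : R[i]) : e1 * a * b * e2 = a * b * (e1 * e2) by ring.
have -> (a b : R[i]) : a * (e3 * b) * e4 = a * b * (e3 * e4) by ring.
congr (_ * _); rewrite /e1 /e2 /e3 /e4 -!cexpD; congr cexp.
(* With h replaced by s * s for s = sqrt h, the claim is an identity of rational functions. *)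
have hE : h = Num.sqrt h * Num.sqrt h by rewrite -expr2 s2.
move: (Num.sqrt h) hE => s ->.
by apply: complex_ext; rewrite !(ReD, ImD, ReJ, ImJ) /=; field.
Qed.

Lemma beta_pos_norm_pointwise h q K w : 0 <= h ->
  cnorm (beta_pos h q K (toC w)) ^+ 2 * gauss w =
  cnorm (K (toC (bshift h q w))) ^+ 2 * gauss (bshift h q w).
Proof.
move=> h0; have s2 := sqr_sqrtr h0.
rewrite beta_posE cnormM cnorm_cexp exprMn /gauss -expRM_natl.
rewrite [_ * cnorm _ ^+ 2]mulrC -mulrA -expRD; congr (_ * expR _) => /=.
have hE : h = Num.sqrt h * Num.sqrt h by rewrite -expr2 s2.
move: (Num.sqrt h) hE => s ->.
by field.
Qed.

Lemma N2_beta_pos h q F : 0 <= h -> cmeas (fun w : RR => F (toC w)) ->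
  N2 (beta_pos h q F) = N2 F.
Proof.
move=> h0 mF; rewrite /N2; under eq_integral do rewrite beta_pos_norm_pointwise //.
have [_ hh] := mpres_bshift h q.
apply: (hh (fun w => (cnorm (F (toC w)) ^+ 2 * gauss w)%:E)).
  exact: measurable_N2_integrand.
by move=> w; rewrite lee_fin mulr_ge0 ?sqr_ge0 ?gauss_ge0.
Qed.

Lemma fock_beta_pos h q F : 0 <= h -> fock F -> fock (beta_pos h q F).
Proof.
move=> h0 fF; have [mF _] := fock_L2 fF; move/fockP: fF => [hF NF].
by apply/fockP; split; [exact: beta_pos_holomorphic|rewrite N2_beta_pos].
Qed.

Lemma L2_dot_cintegrable F G : L2 F -> L2 G ->
  cintegrable plane setT (fun w => F (toC w) * (G (toC w))^*%C * (gauss w)%:C).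
Proof.
move=> [mF fF] [mG fG]; apply/cintegrableP; split.
  apply: cmeasM; last by apply: cmeas_real; exact: measurable_gauss.
  by apply: cmeasM => //; exact: cmeasJ.
apply: (@le_lt_trans _ _ (N2 F + N2 G)%E); last exact: lte_add_pinfty.
rewrite /N2 -ge0_integralD //; last 4 first.
- by move=> w _; rewrite lee_fin mulr_ge0 ?sqr_ge0 ?gauss_ge0.
- exact: measurable_N2_integrand.
- by move=> w _; rewrite lee_fin mulr_ge0 ?sqr_ge0 ?gauss_ge0.
- exact: measurable_N2_integrand.
apply: ge0_le_integral_nonmeas => w _; first by rewrite lee_fin cnorm_ge0.
rewrite -EFinD lee_fin !cnormM cnormJ cnormR (ger0_norm (gauss_ge0 _)) -mulrDl.
rewrite ler_wpM2r ?gauss_ge0 //.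
set a := cnorm _; set b := cnorm _.
have := sqr_ge0 (a - b); have := sqr_ge0 a; have := sqr_ge0 b; nra.
Qed.

Lemma fock_dotBl F G K : L2 F -> L2 G -> L2 K ->
  fock_dot F (fun z => G z - K z) = fock_dot F G - fock_dot F K.
Proof.
move=> hF hG hK; rewrite /fock_dot -mulrBr -cintegralB //; try exact: L2_dot_cintegrable.
congr (_ * _); apply: eq_cintegral => w _; rewrite -!/(toC w).
by rewrite rmorphB /=; ring.
Qed.

Lemma beta_pos_adjoint h q K F : 0 <= h -> L2 K -> L2 F ->
  fock_dot (beta_pos h q K) F = fock_dot K (beta_pos h (hinv q) F).
Proof.
move=> h0 hK hF; rewrite /fock_dot; congr (_ * _).
under eq_fun => w do rewrite -/(toC w) beta_pos_dot_pointwise //.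
have [mF fF] := hF; have [mK fK] := hK.
apply: (@mpres_cintegral _ _ _ plane _ (fun w => K (toC w) * (beta_pos h (hinv q) F (toC w))^*%C * (gauss w)%:C)).
  exact: mpres_bshift.
apply: cmeasM; last by apply: cmeas_real; exact: measurable_gauss.
apply: cmeasM => //; apply: cmeasJ.
under eq_fun do rewrite beta_posE.
have [ms _] := mpres_bshift h (hinv q).
apply: cmeasM; last exact: (cmeas_comp mF ms).
apply: cmeas_cexp; split => /=.
  apply: measurable_funB; last exact: measurable_cst.
  apply: measurable_funM; first exact: measurable_cst.
  by apply: measurable_funD; apply: measurable_funM;
    [exact: measurable_fst|exact: measurable_cst|exact: measurable_snd|exact: measurable_cst].
apply: measurable_funB; first exact: measurable_cst.
apply: measurable_funM; first exact: measurable_cst.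
by apply: measurable_funB; apply: measurable_funM;
    [exact: measurable_snd|exact: measurable_cst|exact: measurable_fst|exact: measurable_cst].
Qed.

(** The operator beta_1(z, 0) moves z to the origin: it preserves the norm, and its value on G at 0
    is e^(-|z|^2/2) G(z). The bound at 0 then applies. *)
Lemma fock_eval_le G (z : R[i]) : fock G ->
  cnorm (G z) ^+ 2 <= pi^-1 * expR (cnorm z ^+ 2) * fine (N2 G).
Proof.
move=> fG; have [mG _] := fock_L2 fG.
have := eval0_le (fock_beta_pos (complex.Re z, complex.Im z, 0) ler01 fG).
rewrite N2_beta_pos // -[X in beta_pos _ _ _ X](toC_ReIm 0) beta_posE.
rewrite /bexp /bshift /= sqrtr1 !mul1r !add0r !mul0r addr0 !mulr0 -/(toC _) toC_ReIm.
rewrite cnormM cnorm_cexp /= sub0r -cnorm_sqr => h.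
have e0 := expR_gt0 (cnorm z ^+ 2).
have E : expR (- (2^-1 * cnorm z ^+ 2)) ^+ 2 = (expR (cnorm z ^+ 2))^-1.
  by rewrite -expRM_natl -expRN; congr expR; field.
by move: h; rewrite exprMn E mulrC ler_pdivrMr // mulrAC.
Qed.

Lemma N2_eq0 G : fock G -> N2 G = 0%E -> G = (fun=> 0).
Proof.
move=> fG G0; apply/funext => z; apply: cnorm_eq0.
have := fock_eval_le z fG; rewrite G0 mulr0 => h.
by apply/eqP; rewrite -sqrf_eq0 -[_ == _]/(_ == _) eq_le h sqr_ge0.
Qed.

(** Testing on G - K itself gives norm zero, which by the evaluation bound means vanishing at every
    point. It makes the adjoint unique as a function. *)
Lemma fock_dot_inj G K : fock G -> fock K ->
  (forall F, fock F -> fock_dot F G = fock_dot F K) -> G = K.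
Proof.
move=> fG fK GK; have fE := fockB fG fK.
have hE := fock_L2 fE.
have : fock_dot (fun z => G z - K z) (fun z => G z - K z) = 0.
  by rewrite fock_dotBl ?GK ?subrr //; exact: fock_L2.
rewrite /fock_dot => /eqP; rewrite mulf_eq0 => /orP[/eqP/(congr1 (@complex.Re R))/= h|/eqP h].
  by have := pi_gt0 R; rewrite -invr_gt0 h ltxx.
have N0 : N2 (fun z => G z - K z) = 0%E.
  rewrite (N2_fin hE.2); congr EFin.
  move/(congr1 (@complex.Re R)) : h => /= <-.
  rewrite /Rintegral /N2; congr fine; apply: eq_integral => w _; congr EFin.
  by rewrite -/(toC w) mulJE -RCM.
apply/funext => z; apply/eqP; rewrite -subr_eq0; apply/eqP.
by have := N2_eq0 fE N0 => /(congr1 (@^~ z)).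
Qed.

(** The Gaussian mean formula for beta_1(z, 0) G, translated by z. The factor e^(-|z|^2/2) appears
    on both sides and is cancelled by multiplying with [cexp e]. *)
Lemma fock_reproducing G (z : R[i]) : fock G ->
  cintegral plane setT (fun w => G (toC w) * cexp (z * (toC w)^*%C) * (gauss w)%:C)
  = pi%:C * G z.
Proof.
move=> fG; have [mG _] := fock_L2 fG.
case: z => u v; pose q : heis R := (u, v, 0).
pose e := (2^-1 * (u ^+ 2 + v ^+ 2))%:C : R[i].
pose g w : R[i] := G (toC w) * cexp ((u +i* v) * (toC w)^*%C) * (gauss w)%:C.
have E w : (gauss w)%:C * beta_pos 1 q G (toC w) = cexp (- e) * g (bshift 1 q w).
  rewrite beta_posE /g !gaussC; move: (G _) => a.
  set e1 := cexp _; set e2 := cexp (bexp _ _ _); set e3 := cexp (- e).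
  set e4 := cexp (_ * _); set e5 := cexp _.
  have -> : e1 * (e2 * a) = a * (e1 * e2) by ring.
  have -> : e3 * (a * e4 * e5) = a * (e3 * (e4 * e5)) by ring.
  congr (_ * _); rewrite /e1 /e2 /e3 /e4 /e5 -!cexpD; congr cexp.
  rewrite /e; apply: complex_ext;
    rewrite !(ReD, ImD, ReN, ImN, ReM, ImM, ReJ, ImJ) /= sqrtr1.
    by field. by field.
have mg : cmeas (g : RR -> R[i]).
  apply: cmeasM; last by apply: cmeas_real; exact: measurable_gauss.
  apply: cmeasM => //; apply: cmeas_cexp; apply: cmeasM; first exact: cmeas_cst.
  by apply: cmeasJ; apply: cmeas_pair; [exact: measurable_fst|exact: measurable_snd].
have ec : cexp e * cexp (- e) = 1 by rewrite -cexpD subrr cexp0.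
have gi : cintegrable plane setT (fun w => g (bshift 1 q w)).
  have [ci _] := L2_cintegrable_gauss (fock_L2 (fock_beta_pos q ler01 fG)).
  have := cintegrableZ (cexp e) measurableT ci.
  by apply: (eq_cintegrable measurableT) => x _; rewrite E mulrA ec mul1r.
have h : cexp (- e) * cintegral plane setT g = pi%:C * beta_pos 1 q G 0.
  rewrite -(gauss_mean (fock_beta_pos q ler01 fG)).
  rewrite -(mpres_cintegral (mpres_bshift 1 q) mg) -cintegralZ //.
  by apply: eq_cintegral => x _; rewrite E.
have : cexp e * (cexp (- e) * cintegral plane setT g) = cexp e * (pi%:C * beta_pos 1 q G 0) by rewrite h.
rewrite mulrA ec mul1r => ->.
rewrite -[X in beta_pos _ _ _ X](toC_ReIm 0) beta_posE.
have -> : toC (bshift 1 q (complex.Re (0 : R[i]), complex.Im (0 : R[i]))) = u +i* v.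
  by apply: complex_ext; rewrite /= sqrtr1; ring.
rewrite mulrCA; congr (_ * _); rewrite mulrA -cexpD.
set b := e + _; have -> : b = 0; last by rewrite cexp0 mul1r.
rewrite /b /e; apply: complex_ext; rewrite !(ReD, ImD) /= ?sqrtr1; first by field.
by ring.
Qed.

End Representation.

Section KernelHolomorphic.
Context {R : realType}.
Notation plane := (@plane_measure R).
Notation RR := (measurableTypeR R * measurableTypeR R)%type.

Lemma expR_le_quarter (t : R) : 0 <= t -> t ^+ 4 <= 24 * expR t.
Proof.
move=> t0; have := @expR_ge1Dxn R t 3 t0.
rewrite (_ : 4`!%:R = 24) //; have := expR_ge0 t; lra.
Qed.

(** The dominating integral for differentiating under the kernel integral. The product |U| X is
    bounded by |U|^2 + X^2, and X^2 times the Gaussian by a multiple of e^(-|w|^2/2). *)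
Lemma fock_kernel_moment (U : R[i] -> R[i]) (c : R) : L2 U -> 0 <= c ->
  (\int[plane]_w (cnorm (U (toC w)) * (cnorm (toC w) ^+ 2 *
     expR (c * cnorm (toC w))) * gauss w)%:E < +oo)%E.
Proof.
move=> [mU fU] c0.
(* From t^4 <= 24 e^t, and from (2 c + 1) t - t^2 / 2 <= (2 c + 1)^2 / 2 by completing the
   square. *)
pose C : R := 24 * expR ((2 * c + 1) ^+ 2 / 2).
have C0 : 0 <= C by rewrite /C mulr_ge0 ?expR_ge0.
pose h (w : R * R) := expR (- ((w.1 ^+ 2 + w.2 ^+ 2) / 2)).
have mh : measurable_fun setT (h : RR -> R).
  apply: measurableT_comp; first exact: measurable_expR.
  apply: measurable_funN; apply: measurable_funM; last exact: measurable_cst.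
  by apply: measurable_funD; apply: measurable_funX; [exact: measurable_fst|exact: measurable_snd].
apply: (@le_lt_trans _ _ (N2 U + C%:E * \int[plane]_w (h w)%:E)%E); last first.
  apply: lte_add_pinfty => //; apply: lte_mul_pinfty => //.
  exact: integral_half_gauss.
rewrite /N2 -ge0_integralZl //; last 2 first.
- exact/measurable_EFinP.
- by move=> w _; rewrite lee_fin expR_ge0.
rewrite -ge0_integralD //; last 4 first.
- by move=> w _; rewrite lee_fin mulr_ge0 ?sqr_ge0 ?gauss_ge0.
- exact: measurable_N2_integrand.
- by move=> w _; rewrite mule_ge0 // lee_fin expR_ge0.
- by apply: measurable_funeM; exact/measurable_EFinP.
apply: ge0_le_integral_nonmeas => w _.
  by rewrite lee_fin !mulr_ge0 ?cnorm_ge0 ?sqr_ge0 ?expR_ge0 ?gauss_ge0.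
rewrite -EFinM -EFinD lee_fin.
set a := cnorm (U _); set t := cnorm (toC w).
have t0 : 0 <= t := cnorm_ge0 _.
have gE : gauss w = h w * h w.
  by rewrite /gauss /h -expRD; congr expR; field.
have tE : t ^+ 2 = w.1 ^+ 2 + w.2 ^+ 2 by rewrite /t cnorm_sqr.
have hE : h w = expR (- (t ^+ 2 / 2)) by rewrite tE.
set X := t ^+ 2 * expR (c * t).
have key : X ^+ 2 * gauss w <= C * h w.
  rewrite gE mulrA ler_wpM2r ?expR_ge0 // /X exprMn -exprM -expRM_natl.
  apply: (@le_trans _ _ (24 * expR t * expR (2%:R * (c * t)) * h w)).
    apply: ler_wpM2r; first exact: expR_ge0.
    by apply: ler_wpM2r; [exact: expR_ge0|exact: expR_le_quarter].
  rewrite /C hE -!mulrA ler_pM2l // -!expRD ler_expR.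
  by have := sqr_ge0 (t - (2 * c + 1)); rewrite !expr2; lra.
apply: le_trans (lerD (lexx _) key); rewrite -mulrDl ler_wpM2r ?gauss_ge0 //.
by have := sqr_ge0 (a - X); have := sqr_ge0 a; have := sqr_ge0 X; rewrite /X; nra.
Qed.

(** Up to the factor e^(|z|^2/2), the exponential is the constant 1 moved by beta_1 at minus the
    conjugate of z, hence of finite norm by unitarity. *)
Lemma L2_exp_kernel (z : R[i]) : L2 (fun y => cexp (z * y)).
Proof.
split.
  apply: cmeas_cexp; apply: cmeasM; first exact: cmeas_cst.
  by apply: cmeas_pair; [exact: measurable_fst|exact: measurable_snd].
pose q : heis R := (- complex.Re z, complex.Im z, 0).
have f1 : fock (fun=> 1 : R[i]).
  apply/fockP; split; first by apply/holomorphicP => y; exact: cdiff_cst.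
  rewrite /N2; under eq_integral do rewrite -[1]/(1%:C) cnormR normr1 expr1n mul1r.
  by rewrite integral_gauss ltry.
have := (fock_L2 (fockZ (cexp (2^-1 * cnorm z ^+ 2)%:C) (fock_beta_pos q ler01 f1))).2.
congr (_ < _)%E; congr N2; apply: funC_ext => w.
rewrite beta_posE mulr1 -cexpD; congr cexp.
rewrite cnorm_sqr; apply: complex_ext; rewrite !(ReD, ImD, ReM, ImM) /= sqrtr1; first by field.
by ring.
Qed.

(** The kernel e^(z conj(w)) is holomorphic in z, and its second-order remainder in h is at most 4
    |h|^2 times an integrable majorant. Thus an L2 function that reproduces itself is holomorphic,
    which is how integrals of Fock elements are shown to lie in Fock space. *)
Lemma kernel_holomorphic (U V : R[i] -> R[i]) : L2 U ->
  (forall z, pi%:C * V z = cintegral plane setT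
     (fun w => U (toC w) * cexp (z * (toC w)^*%C) * (gauss w)%:C)) ->
  holomorphic V.
Proof.
move=> hU hV; apply/holomorphicP => z; have [mU fU] := hU.
pose k z w := U (toC w) * cexp (z * (toC w)^*%C) * (gauss w)%:C.
pose k' w := (toC w)^*%C * k z w.
have mtoC : cmeas (toC : RR -> R[i]).
  by apply: cmeas_pair; [exact: measurable_fst|exact: measurable_snd].
have mg : cmeas (fun w : RR => (gauss w)%:C : R[i]).
  by apply: cmeas_real; exact: measurable_gauss.
have mk z' : cmeas (k z' : RR -> R[i]).
  apply: cmeasM => //; apply: cmeasM => //; apply: cmeas_cexp.
  by apply: cmeasM; [exact: cmeas_cst|exact: cmeasJ].
have mk' : cmeas (k' : RR -> R[i]) by apply: cmeasM => //; exact: cmeasJ.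
have nexp (z' w : R[i]) : cnorm (cexp (z' * w^*%C)) <= expR (cnorm z' * cnorm w).
  rewrite cnorm_cexp ler_expR (le_trans (ler_norm _)) // (le_trans (normRe_le _)) //.
  by rewrite cnormM cnormJ.
have kint z' : cintegrable plane setT (k z').
  have hK := L2_exp_kernel z'^*%C.
  have := L2_dot_cintegrable hU hK; apply: (eq_cintegrable measurableT) => w _.
  rewrite /k cexp_conj; congr (_ * cexp _ * _).
  by rewrite conjM; congr (_ * _); exact: conjcK.
(* One majorant for all |h| < 1: the exponent |z| + 1 covers the kernel at z together with the
   factor e^(|h| |w|) of the Taylor remainder. *)
pose Q w := cnorm (U (toC w)) * (cnorm (toC w) ^+ 2 *
     expR ((cnorm z + 1) * cnorm (toC w))) * gauss w.
have mQ : measurable_fun setT (Q : RR -> R).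
  apply: measurable_funM; last exact: measurable_gauss.
  apply: measurable_funM; first exact: measurable_cnorm.
  apply: measurable_funM; first by apply: measurable_funX; exact: measurable_cnorm.
  apply: measurableT_comp; first exact: measurable_expR.
  by apply: measurable_funM; [exact: measurable_cst|exact: measurable_cnorm].
have Q0 w : 0 <= Q w.
  by rewrite /Q !mulr_ge0 ?cnorm_ge0 ?sqr_ge0 ?expR_ge0 ?gauss_ge0.
have Qint : plane.-integrable setT (EFin \o Q).
  apply/integrableP; split; first exact/measurable_EFinP.
  under eq_integral do rewrite /= ger0_norm //.
  by apply: fock_kernel_moment => //; rewrite addr_ge0 ?cnorm_ge0.
have kn w : cnorm (k z w) = cnorm (U (toC w)) * cnorm (cexp (z * (toC w)^*%C)) * gauss w.
  by rewrite cnormM cnormR (ger0_norm (gauss_ge0 _)) cnormM.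
have kQ w (x : R) : 0 <= x <= cnorm (toC w) ->
    cnorm (toC w) ^+ 2 * expR x * cnorm (k z w) <= Q w.
  move=> /andP[x0 xt]; rewrite kn /Q.
  set a := cnorm (U _); set b := cnorm (cexp _); set t := cnorm (toC w).
  have -> : t ^+ 2 * expR x * (a * b * gauss w) = a * (t ^+ 2 * (b * expR x)) * gauss w by ring.
  rewrite ler_wpM2r ?gauss_ge0 // ler_wpM2l ?cnorm_ge0 // ler_wpM2l ?sqr_ge0 //.
  rewrite mulrDl mul1r expRD; apply: ler_pM; rewrite ?cnorm_ge0 ?expR_ge0 //.
    exact: nexp.
  by rewrite ler_expR.
have k'int : cintegrable plane setT k'.
  have Qk : plane.-integrable setT (EFin \o (fun w => Q w + cnorm (k z w))).
    have := integrableD measurableT Qint (cintegrable_norm measurableT (kint z)).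
    by apply: eq_integrable => // w _; rewrite /= EFinD.
  apply: le_cintegrable Qk => // w; rewrite /k' cnormM cnormJ.
  have := kQ w 0; rewrite lexx cnorm_ge0 expR0 mulr1 => /(_ isT).
  have := cnorm_ge0 (k z w); set n := cnorm (k z w); set t := cnorm _ => n0.
  have := mulr_ge0 (sqr_ge0 (t - 1)) n0; have := mulr_ge0 (sqr_ge0 t) n0.
  have -> : (t - 1) ^+ 2 * n = t ^+ 2 * n - 2 * (t * n) + n by ring.
  by lra.
have pi0 : 0 < pi :> R := pi_gt0 R.
have piC : pi%:C != 0 :> R[i].
  by apply/eqP => /(congr1 (@complex.Re R)) /= h; move: pi0; rewrite h ltxx.
exists (pi%:C^-1 * cintegral plane setT k') => e e0.
set I := \int[plane]_w Q w.
have I0 : 0 <= I by apply: Rintegral_ge0.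
(* The remainder is at most (4 I / pi) |h|^2; adding 1 keeps the divisor positive even if I = 0. *)
pose B := pi^-1 * 4 * I + 1.
have B0 : 0 < B by rewrite /B ltr_wpDl // !mulr_ge0 // invr_ge0 ltW.
exists (Num.min 1 (e / B)) => [|h]; first by rewrite lt_min ltr01 divr_gt0.
rewrite lt_min ltr_pdivlMr // => /andP[h1 hB].
have n0 := cnorm_ge0 h.
have hkint : cintegrable plane setT (fun w => h * k' w) by exact: cintegrableZ.
have dint := cintegrableB measurableT (cintegrableB measurableT (kint (z + h)) (kint z)) hkint.
have -> : V (z + h) - V z - pi%:C^-1 * cintegral plane setT k' * h =
    pi%:C^-1 * cintegral plane setT (fun w => k (z + h) w - k z w - h * k' w).
  rewrite (cintegralB measurableT (cintegrableB measurableT (kint (z + h)) (kint z)) hkint).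
  rewrite (cintegralB measurableT (kint (z + h)) (kint z)) cintegralZ // -!hV.
  by rewrite !mulrBr !mulKf // [h * _]mulrC mulrA.
rewrite cnormM cnormV cnormR ger0_norm ?(ltW pi0) //.
have bnd : cnorm (cintegral plane setT (fun w => k (z + h) w - k z w - h * k' w))
    <= 4 * cnorm h ^+ 2 * I.
  apply: (le_trans (le_cnorm_cintegral measurableT dint)).
  rewrite /I -RintegralZl //; apply: le_Rintegral => //.
  - exact: cintegrable_norm.
  - by rewrite /comp; under eq_fun do rewrite EFinM; exact: integrableZl.
  - move=> w _; have -> : k (z + h) w - k z w - h * k' w =
        (cexp (h * (toC w)^*%C) - 1 - h * (toC w)^*%C) * k z w.
      by rewrite /k' /k mulrDl cexpD; ring.
    rewrite cnormM; have := cnorm_cexp_taylor1 (h * (toC w)^*%C).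
    rewrite cnormM cnormJ; set t := cnorm (toC w) => tay.
    have t0 : 0 <= t := cnorm_ge0 _.
    apply: (le_trans (ler_wpM2r (cnorm_ge0 _) tay)).
    have -> : 4 * ((cnorm h * t) ^+ 2 * expR (cnorm h * t)) * cnorm (k z w)
        = 4 * cnorm h ^+ 2 * (t ^+ 2 * expR (cnorm h * t) * cnorm (k z w)) by ring.
    rewrite ler_wpM2l ?mulr_ge0 ?sqr_ge0 //; apply: kQ.
    by rewrite mulr_ge0 //= -/t -[leRHS]mul1r ler_wpM2r // ltW.
apply: (@le_trans _ _ (pi^-1 * (4 * cnorm h ^+ 2 * I))).
  by rewrite ler_wpM2l // invr_ge0 ltW.
have -> : pi^-1 * (4 * cnorm h ^+ 2 * I) = (pi^-1 * 4 * I) * cnorm h * cnorm h by ring.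
rewrite ler_wpM2r //; apply: le_trans (ltW hB).
by rewrite mulrC ler_wpM2l // /B lerDl.
Qed.

End KernelHolomorphic.

Section StrongContinuity.
Context {R : realType}.
Notation plane := (@plane_measure R).
Notation RR := (measurableTypeR R * measurableTypeR R)%type.

(* Fatou's lemma applied to 2|a_k|^2 + 2|b|^2 - |a_k - b|^2. *)
Lemma N2_strong_cvg (a : nat -> R[i] -> R[i]) (b : R[i] -> R[i]) :
  (forall k, L2 (a k)) -> L2 b -> (forall k, N2 (a k) = N2 b) ->
  (forall w, (fun k => cnorm (a k (toC w) - b (toC w))) @ \oo --> (0 : R)) ->
  (fun k => N2 (fun z => a k z - b z)) @ \oo --> 0%E.
Proof.
move=> ha hb Nab cab.
have hd k : L2 (fun z => a k z - b z) by exact: L2B.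
pose g k (w : RR) := (2 * cnorm (a k (toC w)) ^+ 2 + 2 * cnorm (b (toC w)) ^+ 2
  - cnorm (a k (toC w) - b (toC w)) ^+ 2) * gauss w.
have g0 k w : 0 <= g k w.
  rewrite /g mulr_ge0 ?gauss_ge0 // subr_ge0 -[cnorm (b _)]cnormN.
  exact: cnorm_sqrD.
have int2 (F : R[i] -> R[i]) : L2 F ->
    plane.-integrable setT (EFin \o (fun w => cnorm (F (toC w)) ^+ 2 * gauss w)).
  move=> [mF fF]; apply/integrableP; split; first exact: measurable_N2_integrand.
  by under eq_integral do rewrite /= (ger0_norm (mulr_ge0 (sqr_ge0 _) (gauss_ge0 _))).
have mg k : measurable_fun setT (EFin \o g k).
  apply/measurable_EFinP; apply: measurable_funM; last exact: measurable_gauss.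
  apply: measurable_funB; [apply: measurable_funD|].
  - apply: measurable_funM; first exact: measurable_cst.
    by apply: measurable_funX; exact: (measurable_cnorm (ha k).1).
  - apply: measurable_funM; first exact: measurable_cst.
    by apply: measurable_funX; exact: (measurable_cnorm hb.1).
  - by apply: measurable_funX; exact: (measurable_cnorm (hd k).1).
have gint k : (\int[plane]_w (g k w)%:E = (4 * fine (N2 b))%:E - N2 (fun z => a k z - b z)%R)%E.
  have -> : (4 * fine (N2 b))%:E = (2%:E * N2 (a k) + 2%:E * N2 b)%E.
    by rewrite Nab (N2_fin hb.2) /= -!EFinM -EFinD; congr EFin; ring.
  rewrite /N2 -!integralZl // ?int2 //.
  have Z (F : R[i] -> R[i]) : L2 F -> plane.-integrable setT
      (fun w => (2%:E * (cnorm (F (toC w)) ^+ 2 * gauss w)%:E)%E).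
    by move=> hF; apply: integrableZl => //; exact: int2.
  have i1 := Z _ (ha k); have i2 := Z _ hb.
  rewrite -(integralD measurableT i1 i2).
  rewrite -(integralB measurableT (integrableD measurableT i1 i2) (int2 _ (hd k))).
  apply: eq_integral => w _.
  suff -> : g k w = 2 * (cnorm (a k (toC w)) ^+ 2 * gauss w)
    + 2 * (cnorm (b (toC w)) ^+ 2 * gauss w)
    - cnorm (a k (toC w) - b (toC w)) ^+ 2 * gauss w by [].
  by rewrite /g; ring.
have N4 : ((4 * fine (N2 b))%:E = \int[plane]_w (4 * (cnorm (b (toC w)) ^+ 2 * gauss w))%:E)%E.
  under eq_integral do rewrite EFinM.
  by rewrite integralZl ?int2 // -/(N2 b) (N2_fin hb.2).
have glim w : (fun k => (g k w)%:E) @ \oo --> (4 * (cnorm (b (toC w)) ^+ 2 * gauss w))%:E.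
  apply: cvg_EFin; first by apply: nearW.
  have c1 := cab w.
  have c2 : (fun k => cnorm (a k (toC w))) @ \oo --> cnorm (b (toC w)).
    apply/cvgrPdist_lt => e e0; move/cvgrPdist_lt/(_ e e0): c1.
    apply: filterS => k; rewrite sub0r normrN ger0_norm ?cnorm_ge0 //.
    apply: le_lt_trans; rewrite ler_norml.
    have := cnormD (a k (toC w) - b (toC w)) (b (toC w)); rewrite subrK.
    have := cnormD (- (a k (toC w) - b (toC w))) (a k (toC w)).
    rewrite opprB subrK -opprB cnormN.
    by move=> h1 h2; apply/andP; split; lra.
  have -> : 4 * (cnorm (b (toC w)) ^+ 2 * gauss w) =
      (2 * cnorm (b (toC w)) ^+ 2 + 2 * cnorm (b (toC w)) ^+ 2 - 0 ^+ 2) * gauss w.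
    by ring.
  apply: cvgM; last exact: cvg_cst.
  apply: cvgB; [apply: cvgD|].
  - by apply: cvgM; [exact: cvg_cst|rewrite expr2; under eq_fun do rewrite expr2; exact: cvgM].
  - exact: cvg_cst.
  - by rewrite expr2; under eq_fun do rewrite expr2; exact: cvgM.
have := @fatou _ _ _ plane setT measurableT (fun k => EFin \o g k) mg
  (fun k w _ => g0 k w : (0 <= (g k w)%:E)%E).
under eq_integral => w _ do rewrite (cvg_limn_einf_sup (glim w)).1.
rewrite -N4.
under [X in (_ <= limn_einf X)%E]eq_fun do rewrite gint.
rewrite limn_einf_shift // => h.
(* Fatou's inequality reads 4N <= 4N - limsup with N = N2(b) finite, so the limsup is at most 0. *)
apply: limn_esup_le_cvg; last by move=> k; exact: N2_ge0.
move: h; rewrite limn_einfN.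
set L := limn_esup _; case: L => [r||] //=.
- by rewrite -EFinB !lee_fin; lra.
Qed.

End StrongContinuity.

Section Beta.
Context {R : realType}.
Notation RR := (measurableTypeR R * measurableTypeR R)%type.
Notation HH := (measurableTypeR R * measurableTypeR R * measurableTypeR R)%type.
Implicit Types (F G K : R[i] -> R[i]) (h : R) (p q : heis R) (w : R * R).

(** The automorphism (z, t) -> (conj z, -t) when h is not positive; it reduces both signs of h to
    [beta_pos]. *)
Definition hsig h q : heis R :=
  if 0 < h then q else (q.1.1, - q.1.2, - q.2).

Lemma betaE h q F : beta h q F = beta_pos `|h| (hsig h q) F.
Proof.
by rewrite /beta /hsig; case: ifP => // h0; rewrite gtr0_norm.
Qed.

Lemma hmulA p q (s : heis R) : hmul p (hmul q s) = hmul (hmul p q) s.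
Proof. by rewrite /hmul /=; congr (_, _, _); ring. Qed.

Lemma hmulV q : hmul q (hinv q) = (0, 0, 0).
Proof. by rewrite /hmul /hinv /=; congr (_, _, _); ring. Qed.

Lemma hmul0 q : hmul q (0, 0, 0) = q.
Proof. by case: q => [[x y] t]; rewrite /hmul /=; congr (_, _, _); ring. Qed.

Lemma hinvM p q : hinv (hmul p q) = hmul (hinv q) (hinv p).
Proof. by rewrite /hmul /hinv /=; congr (_, _, _); ring. Qed.

Lemma hsigM h p q : hsig h (hmul p q) = hmul (hsig h p) (hsig h q).
Proof. by rewrite /hsig; case: ifP => // _; rewrite /hmul /=; congr (_, _, _); ring. Qed.

Lemma hsigV h q : hsig h (hinv q) = hinv (hsig h q).
Proof. by rewrite /hsig; case: ifP. Qed.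

Lemma beta_pos_mul h p q F : 0 <= h ->
  beta_pos h p (beta_pos h q F) = beta_pos h (hmul p q) F.
Proof.
move=> h0; apply: funC_ext => w; rewrite !beta_posE mulrA -cexpD.
have hE : h = Num.sqrt h * Num.sqrt h by rewrite -expr2 sqr_sqrtr.
congr (cexp _ * F (toC _)); last first.
  by rewrite /bshift /=; congr (_, _); ring.
rewrite /bexp /bshift; move: (Num.sqrt h) hE => s ->.
by apply: complex_ext; rewrite ?ReD ?ImD /=; field.
Qed.

Lemma beta_mul h p q F : beta h p (beta h q F) = beta h (hmul p q) F.
Proof. by rewrite !betaE hsigM beta_pos_mul. Qed.

Lemma fock_beta h q F : fock F -> fock (beta h q F).
Proof. by rewrite betaE; exact: fock_beta_pos. Qed.

Lemma N2_beta h q F : fock F -> N2 (beta h q F) = N2 F.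
Proof. by move=> /fock_L2[mF _]; rewrite betaE N2_beta_pos. Qed.

(** The adjoint is a choice among all solutions; beta_h(q^-1) F is a solution and [fock_dot_inj]
    leaves no other. *)
Lemma fock_adjoint_beta h q F : fock F ->
  fock_adjoint (beta h q) F = beta h (hinv q) F.
Proof.
move=> fF; have Padj K : fock K -> fock_dot (beta h q K) F = fock_dot K (beta h (hinv q) F).
  by move=> fK; rewrite !betaE hsigV beta_pos_adjoint //; exact: fock_L2.
apply: xget_unique; first by split; [exact: fock_beta|].
move=> G [fG hG]; apply: fock_dot_inj => // [|K fK]; first exact: fock_beta.
by rewrite -hG // Padj.
Qed.

Lemma cmeas_beta_pos d (T : measurableType d) h F (q : T -> HH) (w : T -> RR) :
  ccont F -> measurable_fun setT q -> measurable_fun setT w ->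
  cmeas (fun s => beta_pos h (q s) F (toC (w s))).
Proof.
move=> cF mq mw; under eq_fun do rewrite beta_posE.
have m11 : measurable_fun setT (fun s => (q s).1.1).
  exact: (measurableT_comp (@measurable_fst _ _ _ _) (measurableT_comp (@measurable_fst _ _ _ _) mq)).
have m12 : measurable_fun setT (fun s => (q s).1.2).
  exact: (measurableT_comp (@measurable_snd _ _ _ _) (measurableT_comp (@measurable_fst _ _ _ _) mq)).
have m2 : measurable_fun setT (fun s => (q s).2).
  exact: (measurableT_comp (@measurable_snd _ _ _ _) mq).
have w1 : measurable_fun setT (fun s => (w s).1).
  exact: (measurableT_comp (@measurable_fst _ _ _ _) mw).
have w2 : measurable_fun setT (fun s => (w s).2).
  exact: (measurableT_comp (@measurable_snd _ _ _ _) mw).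
have Z (c : R) (u : T -> R) : measurable_fun setT u -> measurable_fun setT (fun s => c * u s).
  by move=> mu; apply: measurable_funM => //; exact: measurable_cst.
apply: cmeasM.
  apply: cmeas_cexp; apply: cmeas_pair.
    apply: measurable_funB; apply: Z; apply: measurable_funD.
    - exact: measurable_funM.
    - exact: measurable_funM.
    - exact: measurable_funX.
    - exact: measurable_funX.
  apply: measurable_funB; apply: Z => //.
  by apply: measurable_funB; exact: measurable_funM.
apply: (@cmeas_comp _ _ _ _ _ (fun w : RR => F (toC w)) (fun s => bshift h (q s) (w s) : RR)).
  exact: ccont_cmeas.
by apply: measurable_fun_pair; apply: measurable_funD => //; exact: Z.
Qed.

Lemma measurable_hsig_inv h : measurable_fun setT (fun q : HH => hsig h (hinv q) : HH).
Proof.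
have m11 : measurable_fun setT (fun q : HH => q.1.1).
  exact: (measurableT_comp (@measurable_fst _ _ _ _) (@measurable_fst _ _ _ _)).
have m12 : measurable_fun setT (fun q : HH => q.1.2).
  exact: (measurableT_comp (@measurable_snd _ _ _ _) (@measurable_fst _ _ _ _)).
have m2 : measurable_fun setT (fun q : HH => q.2) by exact: measurable_snd.
have mi : measurable_fun setT (fun q : HH => hinv q : HH).
  apply: measurable_fun_pair; last exact: measurable_funN.
  by apply: measurable_fun_pair; exact: measurable_funN.
rewrite /hsig; case: (0 < h) => //.
apply: measurable_fun_pair; last by apply: measurable_funN; exact: measurable_funN.
apply: measurable_fun_pair; first exact: measurable_funN.
by apply: measurable_funN; exact: measurable_funN.
Qed.

Lemma cmeas_beta_inv d (T : measurableType d) h F (q : T -> HH) (w : T -> RR) :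
  ccont F -> measurable_fun setT q -> measurable_fun setT w ->
  cmeas (fun s => beta h (hinv (q s)) F (toC (w s))).
Proof.
move=> cF mq mw; under eq_fun do rewrite betaE.
apply: cmeas_beta_pos => //.
exact: (measurableT_comp (measurable_hsig_inv h) mq).
Qed.

Definition ccvg (z : nat -> R[i]) (l : R[i]) : Prop :=
  (fun k => complex.Re (z k)) @ \oo --> complex.Re l /\
  (fun k => complex.Im (z k)) @ \oo --> complex.Im l.

Lemma ccvg_cnorm z l : ccvg z l -> (fun k => cnorm (z k - l)) @ \oo --> (0 : R).
Proof.
move=> [h1 h2]; apply/cvgrPdist_lt => e e0.
have e2 : 0 < e / 2 by rewrite divr_gt0.
move/cvgrPdist_lt/(_ _ e2): h1 => h1; move/cvgrPdist_lt/(_ _ e2): h2 => h2.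
apply: filterS2 h1 h2 => k h1 h2; rewrite sub0r normrN ger0_norm ?cnorm_ge0 //.
apply: (le_lt_trans (cnorm_le _)); rewrite ReD ReN ImD ImN.
by rewrite distrC [`|complex.Im (z k) - _|]distrC; lra.
Qed.

Lemma cnorm_ccvg z l : (fun k => cnorm (z k - l)) @ \oo --> (0 : R) -> ccvg z l.
Proof.
move=> h; split; apply/cvgrPdist_lt => e e0; move/cvgrPdist_lt/(_ e e0): h;
  apply: filterS => k; rewrite sub0r normrN ger0_norm ?cnorm_ge0 //; apply: le_lt_trans.
- by rewrite distrC -ReN -ReD normRe_le.
- by rewrite distrC -ImN -ImD normIm_le.
Qed.

Lemma ccvgM z l z' l' : ccvg z l -> ccvg z' l' -> ccvg (fun k => z k * z' k) (l * l').
Proof.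
move=> [a1 a2] [b1 b2]; split.
- by under eq_fun do rewrite ReM; rewrite ReM; apply: cvgB; exact: cvgM.
- by under eq_fun do rewrite ImM; rewrite ImM; apply: cvgD; exact: cvgM.
Qed.

Lemma ccvg_ccont F z l : ccont F -> ccvg z l -> ccvg (fun k => F (z k)) (F l).
Proof.
move=> cF /ccvg_cnorm h; apply: cnorm_ccvg; apply/cvgrPdist_lt => e e0.
have [d d0 hd] := cF l e e0.
move/cvgrPdist_lt/(_ d d0): h; apply: filterS => k.
rewrite !sub0r !normrN !ger0_norm ?cnorm_ge0 // => /hd.
by rewrite [l + _]addrC subrK.
Qed.

Lemma ccont_cexp : ccont (cexp : R[i] -> R[i]).
Proof. by move=> z e e0; apply: cdiff_cont => //; exact: cdiff_cexp. Qed.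

Lemma beta_pos_cvg h F (q : nat -> heis R) (l : heis R) w : ccont F ->
  (fun k => (q k).1.1) @ \oo --> l.1.1 -> (fun k => (q k).1.2) @ \oo --> l.1.2 ->
  (fun k => (q k).2) @ \oo --> l.2 ->
  ccvg (fun k => beta_pos h (q k) F (toC w)) (beta_pos h l F (toC w)).
Proof.
move=> cF c1 c2 c3; under eq_fun do rewrite beta_posE; rewrite beta_posE.
have Z (c a : R) (u : nat -> R) : u @ \oo --> a -> (fun k => c * u k) @ \oo --> c * a.
  by move=> cu; apply: cvgM => //; exact: cvg_cst.
have S (a : R) (u : nat -> R) : u @ \oo --> a -> (fun k => u k ^+ 2) @ \oo --> a ^+ 2.
  by move=> cu; rewrite expr2; under eq_fun do rewrite expr2; exact: cvgM.
apply: ccvgM.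
  apply: (ccvg_ccont ccont_cexp); split => /=.
    apply: cvgB; apply: (Z); apply: cvgD; [exact: Z|exact: Z|exact: S|exact: S].
  by apply: cvgB; apply: (Z) => //; apply: cvgB; exact: (Z).
apply: (ccvg_ccont cF); split => /=; apply: cvgD; try exact: cvg_cst; exact: Z.
Qed.

(** Strong continuity along sequences: pointwise convergence is visible from the formula, and it
    becomes norm convergence because all norms are equal. *)
Lemma beta_inv_N2_cvg h F (q : nat -> heis R) (l : heis R) : fock F ->
  (fun k => (q k).1.1) @ \oo --> l.1.1 -> (fun k => (q k).1.2) @ \oo --> l.1.2 ->
  (fun k => (q k).2) @ \oo --> l.2 ->
  (fun k => N2 (fun z => beta h (hinv (q k)) F z - beta h (hinv l) F z)) @ \oo --> 0%E.
Proof.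
move=> fF c1 c2 c3; have cF := holomorphic_ccont ((fockP F).1 fF).1.
apply: N2_strong_cvg.
- by move=> k; apply: fock_L2; exact: fock_beta.
- by apply: fock_L2; exact: fock_beta.
- by move=> k; rewrite !N2_beta.
- move=> w; apply: ccvg_cnorm; under eq_fun do rewrite betaE; rewrite betaE.
  apply: beta_pos_cvg => //; rewrite /hsig; case: ifP => _ /=; try exact: cvgN; try exact: c1.
  + by apply: cvgN; exact: cvgN.
  + by apply: cvgN; exact: cvgN.
Qed.

End Beta.

Lemma ecvg0_lt {R : realType} (u : nat -> \bar R) (e : R) :
  u @ \oo --> 0%E -> 0 < e -> \forall k \near \oo, (u k < e%:E)%E.
Proof.
move=> /fine_cvgP[uf /cvgrPdist_lt uc] e0.
apply: filterS2 uf (uc _ e0) => k fk; rewrite sub0r normrN => h.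
by rewrite -(fineK fk) lte_fin; apply: le_lt_trans h; exact: ler_norm.
Qed.

(** * Bochner integrals in Fock space *)

Section BochnerFormula.
Context {R : realType} {d : measure_display} {T : measurableType d}.
Variables (mu : {measure set T -> \bar R}) (D : set T).
Hypothesis mD : measurable D.
Implicit Types s : seq (set T * (R[i] -> R[i])).

Lemma fock_normE_le (G : R[i] -> R[i]) z : fock G -> cnorm (G z) <= Num.sqrt (expR (cnorm z ^+ 2)) * fock_norm G.
Proof.
move=> fG; rewrite fock_normE -sqrtrM ?expR_ge0 //.
rewrite -[leLHS](ger0_norm (cnorm_ge0 _)) -sqrtr_sqr ler_wsqrtr //.
by rewrite mulrCA mulrA; exact: fock_eval_le.
Qed.

Lemma fock_simple_cons a s : fock_simple mu D (a :: s) ->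
  [/\ measurable a.1, (mu (a.1 `&` D) < +oo)%E & fock a.2] /\ fock_simple mu D s.
Proof.
move=> h; split; first by apply: h; rewrite mem_head.
by move=> b bs; apply: h; rewrite in_cons bs orbT.
Qed.

Lemma simple_cintegral s z : fock_simple mu D s ->
  cintegrable mu D (fun q => simple_eval s q z) /\
  cintegral mu D (fun q => simple_eval s q z) = simple_integral mu D s z.
Proof.
elim: s => [_|a s IH /fock_simple_cons[[ma fa _] /IH[i1 e1]]].
  rewrite /simple_eval /simple_integral big_nil; split; last first.
    by under eq_cintegral do rewrite big_nil; rewrite cintegral0.
  have : cintegrable mu D (fun=> 0 : R[i]) by split => /=; exact: integrable0.
  by apply: (eq_cintegrable mD) => x _; rewrite big_nil.
have ia : cintegrable mu D (fun q => cind a.1 q : R[i]).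
  split => /=; last exact: integrable0.
  apply/integrableP; split; first by apply/measurable_EFinP; exact: measurable_indic.
  under eq_integral do rewrite gee0_abs ?lee_fin ?indicE ?ler0n // -indicE.
  by rewrite integral_indic.
have ia2 := cintegrableZ (a.2 z) mD ia.
have E q : simple_eval (a :: s) q z = a.2 z * cind a.1 q + simple_eval s q z.
  by rewrite /simple_eval big_cons mulrC.
split; first by apply: (eq_cintegrable mD _ (cintegrableD mD ia2 i1)) => q _; rewrite E.
under eq_cintegral do rewrite E.
rewrite cintegralD // cintegralZ // e1 /simple_integral big_cons mulrC.
congr (_ * _ + _); apply: complex_ext => /=; last by rewrite /Rintegral integral0.
by rewrite /Rintegral integral_indic.
Qed.

Lemma fock_simple_eval s q : fock_simple mu D s -> fock (simple_eval s q).
Proof.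
elim: s => [_|a s IH /fock_simple_cons[[_ _ fa] /IH fs]]; rewrite /simple_eval.
  by under eq_fun do rewrite big_nil; exact: fock0.
by under eq_fun do rewrite big_cons; apply: fockD => //; exact: fockZ.
Qed.

Lemma fock_simple_integral s : fock_simple mu D s -> fock (simple_integral mu D s).
Proof.
elim: s => [_|a s IH /fock_simple_cons[[_ _ fa] /IH fs]]; rewrite /simple_integral.
  by under eq_fun do rewrite big_nil; exact: fock0.
by under eq_fun do rewrite big_cons; apply: fockD => //; exact: fockZ.
Qed.

(** Evaluation at z is bounded by C = e^(|z|^2/2) and commutes with integrals of simple functions.
    Both the error of V and the L^1 error of Phi contribute at most e / 2. Every Bochner integral is
    thereby determined by its scalar integrals. *)
Lemma bochner_pointwise (Phi : T -> R[i] -> R[i]) V z : is_bochner_integral mu D Phi V ->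
  cintegrable mu D (fun q => Phi q z) ->
  V z = cintegral mu D (fun q => Phi q z).
Proof.
move=> [fPhi fV [s [fs _ cs cV]]] iPhi.
set C := Num.sqrt (expR (cnorm z ^+ 2)).
have C0 : 0 < C by rewrite sqrtr_gt0 expR_gt0.
apply/eqP; rewrite -subr_eq0; apply/eqP/cnorm_eq0/le_anti; rewrite cnorm_ge0 andbT.
apply/ler_addgt0Pr => e e0; rewrite add0r.
have eC : 0 < e / (2 * C) by rewrite divr_gt0 // mulr_gt0.
have [k [hk1 hk2]] : exists k,
    (\int[mu]_(q in D) (fock_norm (Phi q \- simple_eval (s k) q))%:E < (e / (2 * C))%:E)%E
    /\ fock_norm (V \- simple_integral mu D (s k)) < e / (2 * C).
  have n1 : \forall k \near \oo, (\int[mu]_(q in D) (fock_norm (Phi q \- simple_eval (s k) q))%:E < (e / (2 * C))%:E)%E.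
    exact: (ecvg0_lt cs eC).
  have n2 : \forall k \near \oo, fock_norm (V \- simple_integral mu D (s k)) < e / (2 * C).
    move/cvgrPdist_lt/(_ _ eC): cV; apply: filterS => k.
    by rewrite sub0r normrN; apply: le_lt_trans; exact: ler_norm.
  have [k _ h] : \forall k \near \oo, (\int[mu]_(q in D) (fock_norm (Phi q \- simple_eval (s k) q))%:E < (e / (2 * C))%:E)%E
     /\ fock_norm (V \- simple_integral mu D (s k)) < e / (2 * C).
    exact: filterS2 n1 n2.
  by exists k; exact: h (leqnn k).
have [is_ es] := simple_cintegral z (fs k).
have -> : V z - cintegral mu D (fun q => Phi q z) =
  (V z - simple_integral mu D (s k) z) - cintegral mu D (fun q => Phi q z - simple_eval (s k) q z).
  by rewrite cintegralB // es; ring.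
apply: (le_trans (cnormB _ _)); rewrite [e]splitr; apply: lerD.
  apply: (le_trans (fock_normE_le z (fockB fV (fock_simple_integral (fs k))))).
  by rewrite -/C mulrC -ler_pdivlMr // -mulrA -invfM ltW.
have iD := cintegrableB mD iPhi is_.
rewrite -lee_fin; apply: (le_trans (le_cnorm_cintegralE mD iD)).
have iN := cintegrable_norm mD iD.
have Ci : 0 < C^-1 by rewrite invr_gt0.
rewrite -(@lee_pmul2l _ C^-1%:E) ?lte_fin //.
rewrite -ge0_integralZl //; last 3 first.
- exact: measurable_int iN.
- by move=> q _; rewrite lee_fin cnorm_ge0.
- by rewrite lee_fin ltW.
apply: (@le_trans _ _ (e / (2 * C))%:E); last first.
  by rewrite -EFinM lee_fin le_eqVlt; apply/orP; left; apply/eqP; field; rewrite gt_eqF.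
apply: le_trans (ltW hk1); apply: ge0_le_integral_nonmeas => q Dq.
  by rewrite -EFinM lee_fin mulr_ge0 ?cnorm_ge0 // ltW.
rewrite -EFinM lee_fin ler_pdivrMl //.
exact: (fock_normE_le z (fockB (fPhi q Dq) (fock_simple_eval q (fs k)))).
Qed.

End BochnerFormula.

Lemma cconjK {R : realType} (z : R[i]) : (z^*%C)^*%C = z.
Proof. by case: z => a b; apply: complex_ext; rewrite /= ?opprK. Qed.

(** * Integrals of Fock-space-valued maps defined pointwise *)

Section FockIntegral.
Context {R : realType} {d : measure_display} {T : measurableType d}.
Notation leb := (@lebesgue_measure R).
Notation plane := (@plane_measure R).
Notation RR := (measurableTypeR R * measurableTypeR R)%type.
Variable mu : {sigma_finite_measure set T -> \bar R}.
Variables (b : T -> R[i]) (M : T -> R[i] -> R[i]) (K : R).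
Hypothesis bi : cintegrable mu setT b.
Hypothesis mM : cmeas (fun p : T * RR => M p.1 (toC p.2)).
Hypothesis k0 : 0 <= K.
Hypothesis fM : forall q, fock (M q).
Hypothesis NM : forall q, (N2 (M q) <= K%:E)%E.

(** The candidate for the Bochner integral of b M; measurability, norm bounds and holomorphy are
    proved for it directly. *)
Let W z := cintegral mu setT (fun q => b q * M q z).

Let mb : cmeas b. Proof. exact: cintegrable_cmeas bi. Qed.

Let bfin : (\int[mu]_q (cnorm (b q))%:E < +oo)%E.
Proof. by have [] := (cintegrableP _ _).1 bi. Qed.

Let mMz z : cmeas (fun q => M q z).
Proof.
rewrite -(toC_ReIm z).
apply: (cmeas_comp mM (phi := fun q => (q, (complex.Re z, complex.Im z)))).
by apply: measurable_fun_pair => //; exact: measurable_cst.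
Qed.

Let K0 q z : cnorm (M q z) ^+ 2 <= pi^-1 * expR (cnorm z ^+ 2) * K.
Proof.
apply: (le_trans (fock_eval_le z (fM q))).
rewrite ler_wpM2l ?mulr_ge0 ?expR_ge0 ?invr_ge0 ?pi_ge0 //.
by have := NM q; rewrite (N2_fin (fock_L2 (fM q)).2) lee_fin.
Qed.

Let b2fin z : (\int[mu]_q (cnorm (b q) * cnorm (M q z) ^+ 2)%:E < +oo)%E.
Proof.
pose C := pi^-1 * expR (cnorm z ^+ 2) * K.
have C0 : 0 <= C by rewrite /C !mulr_ge0 ?expR_ge0 ?invr_ge0 ?pi_ge0.
apply: (@le_lt_trans _ _ (C%:E * \int[mu]_q (cnorm (b q))%:E)%E); last first.
  exact: lte_mul_pinfty.
rewrite -ge0_integralZl //; last 2 first.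
- exact: measurable_cnormE.
- by move=> q _; rewrite lee_fin cnorm_ge0.
apply: ge0_le_integral_nonmeas => q _; first by rewrite lee_fin mulr_ge0 ?cnorm_ge0 ?sqr_ge0.
by rewrite -EFinM lee_fin mulrC ler_wpM2r ?cnorm_ge0 // K0.
Qed.

Lemma fock_integral_jensen z :
  cintegrable mu setT (fun q => b q * M q z) /\
  cnorm (W z) ^+ 2 <= (\int[mu]_q cnorm (b q)) *
    \int[mu]_q (cnorm (b q) * cnorm (M q z) ^+ 2).
Proof.
have [i1 j1] := weighted_jensen (measurable_cnorm mb) (measurable_cnorm (mMz z))
  (fun q => cnorm_ge0 _) (fun q => cnorm_ge0 _) bfin (b2fin z).
have ci : cintegrable mu setT (fun q => b q * M q z).
  by apply: le_cintegrable i1 => [|q]; [exact: cmeasM|rewrite cnormM].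
split => //; apply: le_trans j1.
have := le_cnorm_cintegral measurableT ci.
have -> : \int[mu]_q cnorm (b q * M q z) = \int[mu]_q (cnorm (b q) * cnorm (M q z)).
  by apply: eq_Rintegral => q _; rewrite cnormM.
move=> h; rewrite lerXn2r ?nnegrE ?cnorm_ge0 //.
exact: le_trans (cnorm_ge0 _) h.
Qed.

Let mbp : cmeas (fun p : T * RR => b p.1).
Proof. exact: (cmeas_comp mb (@measurable_fst _ _ _ _)). Qed.

Let mUp (U : R[i] -> R[i]) : cmeas (fun w : RR => U (toC w)) ->
  cmeas (fun p : T * RR => U (toC p.2)).
Proof. by move=> mU; exact: (cmeas_comp mU (@measurable_snd _ _ _ _)). Qed.

Let mgp : cmeas (fun p : T * RR => (gauss p.2)%:C : R[i]).
Proof.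
apply: (@cmeas_comp _ _ _ _ _ (fun w : RR => (gauss w)%:C) snd) => //.
by apply: cmeas_real; exact: measurable_gauss.
Qed.

(** Integrability on the product, against an arbitrary test function U, licenses the exchanges of
    integrals below; the bound is |M U| <= |M|^2 + |U|^2. *)
Let joint (U : R[i] -> R[i]) : L2 U -> cintegrable (mu \x sfprod leb leb)%E setT
  (fun p => b p.1 * (M p.1 (toC p.2) * U (toC p.2) * (gauss p.2)%:C)).
Proof.
move=> [mU fU]; apply/cintegrable_prodP; split.
  exact: (cmeasM mbp (cmeasM (cmeasM mM (mUp mU)) mgp)).
pose C := K + fine (N2 U).
have C0 : 0 <= C by rewrite addr_ge0 // fine_ge0 // N2_ge0.
apply: (@le_lt_trans _ _ (C%:E * \int[mu]_q (cnorm (b q))%:E)%E); last first.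
  exact: lte_mul_pinfty.
rewrite -ge0_integralZl //; last 2 first.
- exact: measurable_cnormE.
- by move=> q _; rewrite lee_fin cnorm_ge0.
apply: ge0_le_integral_nonmeas => q _.
  by apply: integral_ge0 => w _; rewrite lee_fin cnorm_ge0.
rewrite /=; under eq_integral do rewrite cnormM EFinM.
have [mMq fMq] := fock_L2 (fM q).
have mI : cmeas (fun w : RR => M q (toC w) * U (toC w) * (gauss w)%:C).
  by apply: cmeasM; [exact: cmeasM|apply: cmeas_real; exact: measurable_gauss].
rewrite ge0_integralZl //; last 3 first.
- exact: measurable_cnormE.
- by move=> w _; rewrite lee_fin cnorm_ge0.
- by rewrite lee_fin cnorm_ge0.
rewrite muleC; apply: lee_wpmul2r; first by rewrite lee_fin cnorm_ge0.
apply: (@le_trans _ _ (N2 (M q) + N2 U)%E); last first.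
  by rewrite /C EFinD -(N2_fin fU) leeD2r.
rewrite /N2 -ge0_integralD //; last 4 first.
- by move=> w _; rewrite lee_fin mulr_ge0 ?sqr_ge0 ?gauss_ge0.
- exact: measurable_N2_integrand.
- by move=> w _; rewrite lee_fin mulr_ge0 ?sqr_ge0 ?gauss_ge0.
- exact: measurable_N2_integrand.
apply: ge0_le_integral_nonmeas => w _; first by rewrite lee_fin cnorm_ge0.
rewrite -EFinD lee_fin !cnormM cnormR (ger0_norm (gauss_ge0 _)) -mulrDl.
rewrite ler_wpM2r ?gauss_ge0 //.
set x := cnorm _; set y := cnorm _.
have := sqr_ge0 (x - y); have := sqr_ge0 x; have := sqr_ge0 y; nra.
Qed.

(** Fubini's theorem with U = 1 yields measurability only for W times the Gaussian; the Gaussian is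
    divided out afterwards. *)
Let cmeas_gaussW : cmeas (fun w : RR => (gauss w)%:C * W (toC w)).
Proof.
have h1 : L2 (fun=> 1 : R[i]).
  split; first exact: cmeas_cst.
  rewrite /N2; under eq_integral do rewrite -[1]/(1%:C) cnormR normr1 expr1n mul1r.
  by rewrite integral_gauss ltry.
have := cintegrable_cmeas (cintegrable_fubini2 (joint h1)).
congr cmeas; apply/funext => w; rewrite /W -cintegralZ //; last exact: (fock_integral_jensen _).1.
by apply: eq_cintegral => q _ /=; ring.
Qed.

Lemma fock_integral_cmeas : cmeas (fun w : RR => W (toC w)).
Proof.
have mgi : cmeas (fun w : RR => (expR (w.1 ^+ 2 + w.2 ^+ 2))%:C : R[i]).
  apply: cmeas_real; apply: measurableT_comp; first exact: measurable_expR.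
  by apply: measurable_funD; apply: measurable_funX; [exact: measurable_fst|exact: measurable_snd].
have := cmeasM mgi cmeas_gaussW; congr cmeas; apply/funext => w.
by rewrite mulrA -RCM /gauss -expRD subrr expR0 mul1r.
Qed.

(** Cauchy-Schwarz at each w, integrated by Tonelli's theorem. It replaces Minkowski's integral
    inequality, and gives finiteness of the norm as well as the convergence of approximations. *)
Lemma fock_integral_N2 :
  (N2 W <= (\int[mu]_q cnorm (b q))%:E * \int[mu]_q ((cnorm (b q))%:E * N2 (M q)))%E.
Proof.
set A := \int[mu]_q cnorm (b q).
have A0 : 0 <= A by apply: Rintegral_ge0 => q _; exact: cnorm_ge0.
pose f (p : T * RR) := (cnorm (b p.1) * (cnorm (M p.1 (toC p.2)) ^+ 2 * gauss p.2))%:E.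
have mf : measurable_fun setT f.
  apply/measurable_EFinP; apply: measurable_funM; first exact: measurable_cnorm.
  apply: measurable_funM.
    by apply: measurable_funX; exact: (measurable_cnorm mM).
  exact: (measurableT_comp measurable_gauss (@measurable_snd _ _ _ _)).
have f0 p : (0 <= f p)%E.
  by rewrite lee_fin !mulr_ge0 ?cnorm_ge0 ?sqr_ge0 ?gauss_ge0.
have E : (\int[mu]_q ((cnorm (b q))%:E * N2 (M q)) = \int[plane]_w \int[mu]_q f (q, w))%E.
  rewrite -(@fubini_tonelli _ _ _ _ _ mu (sfprod leb leb)) //.
  apply: eq_integral => q _; rewrite /f /=; under [RHS]eq_integral do rewrite EFinM.
  rewrite ge0_integralZl //.
  - by apply: measurable_N2_integrand; have [] := fock_L2 (fM q).
  - by move=> w _; rewrite lee_fin mulr_ge0 ?sqr_ge0 ?gauss_ge0.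
  - by rewrite lee_fin cnorm_ge0.
rewrite E -ge0_integralZl //; last 2 first.
- exact: (@measurable_fun_fubini_tonelli_G _ _ _ _ _ mu f mf f0).
- by move=> w _; apply: integral_ge0 => q _; exact: f0.
apply: ge0_le_integral_nonmeas => w _.
  by rewrite lee_fin mulr_ge0 ?sqr_ge0 ?gauss_ge0.
have [_ j1] := fock_integral_jensen (toC w).
pose B := \int[mu]_q (cnorm (b q) * cnorm (M q (toC w)) ^+ 2).
rewrite -/A -/B in j1.
have EB : (\int[mu]_q f (q, w) = (B * gauss w)%:E)%E.
  rewrite /f /=; under eq_integral => q _.
    rewrite (_ : _ * _ = (cnorm (b q) * cnorm (M q (toC w)) ^+ 2) * gauss w); last by rewrite mulrA.
    rewrite EFinM; over.
  rewrite ge0_integralZr //; last 3 first.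
  - apply/measurable_EFinP; apply: measurable_funM; first exact: measurable_cnorm.
    by apply: measurable_funX; exact: measurable_cnorm.
  - by move=> q _; rewrite lee_fin mulr_ge0 ?cnorm_ge0 ?sqr_ge0.
  - by rewrite lee_fin gauss_ge0.
  rewrite EFinM /B /Rintegral fineK //.
  rewrite ge0_fin_numE; first exact: b2fin.
  by apply: integral_ge0 => q _; rewrite lee_fin mulr_ge0 ?cnorm_ge0 ?sqr_ge0.
by rewrite EB -EFinM lee_fin mulrA ler_wpM2r ?gauss_ge0.
Qed.

Lemma fock_integral_L2 : L2 W.
Proof.
split; first exact: fock_integral_cmeas.
apply: le_lt_trans fock_integral_N2 _.
apply: lte_mul_pinfty => //.
  by rewrite lee_fin; apply: Rintegral_ge0 => q _; exact: cnorm_ge0.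
apply: (@le_lt_trans _ _ (K%:E * \int[mu]_q (cnorm (b q))%:E)%E); last first.
  exact: lte_mul_pinfty.
rewrite -ge0_integralZl //; last 2 first.
- exact: measurable_cnormE.
- by move=> q _; rewrite lee_fin cnorm_ge0.
apply: ge0_le_integral_nonmeas => q _.
  by rewrite mule_ge0 ?N2_ge0 // lee_fin cnorm_ge0.
by rewrite muleC; apply: lee_wpmul2r => //; rewrite lee_fin cnorm_ge0.
Qed.

(** Each M q satisfies the reproducing formula; exchanging the integrals transfers it to W, and
    [kernel_holomorphic] concludes. *)
Lemma fock_integral_fock : fock W.
Proof.
have [_ fW] := fock_integral_L2; apply/fockP; split => //.
apply: (kernel_holomorphic fock_integral_L2) => z.
have hk := L2_exp_kernel z.
pose k (y : R[i]) := cexp (z * y^*%C).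
have hkL : L2 k.
  have [mk fk] := L2_exp_kernel z^*%C.
  have E y : k y = (cexp (z^*%C * y))^*%C.
    by rewrite /k cexp_conj conjM cconjK.
  split; first by under eq_fun do rewrite E; exact: cmeasJ.
  have -> : N2 k = N2 (fun y => cexp (z^*%C * y)).
    by rewrite /N2; apply: eq_integral => w _; rewrite E cnormJ.
  exact: fk.
have J := joint hkL.
have -> : cintegral plane setT (fun w => W (toC w) * cexp (z * (toC w)^*%C) * (gauss w)%:C)
    = cintegral plane setT (fun w => cintegral mu setT (fun q => b q * (M q (toC w) * k (toC w) * (gauss w)%:C))).
  apply: eq_cintegral => w _.
  transitivity (cintegral mu setT (fun q => (k (toC w) * (gauss w)%:C) * (b q * M q (toC w)))).
    by rewrite cintegralZ; [rewrite /k /W; ring| |exact: (fock_integral_jensen _).1].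
  by apply: eq_cintegral => q _; ring.
rewrite -(@cintegral_fubini _ _ _ _ _ mu (sfprod leb leb) _ J).
rewrite /W -cintegralZ //; last exact: (fock_integral_jensen z).1.
apply: eq_cintegral => q _ /=.
rewrite [RHS]cintegralZ; first by rewrite /k fock_reproducing //; ring.
  by [].
have := L2_dot_cintegrable (fock_L2 (fM q)) (L2_exp_kernel z^*%C).
apply: (eq_cintegrable measurableT) => w _.
by rewrite cexp_conj conjM cconjK.
Qed.

End FockIntegral.

Section Approximation.
Context {R : realType} {d : measure_display} {T : measurableType d}.
Variable mu : {measure set T -> \bar R}.
Import HBNNSimple.

(** Positive and negative parts are approximated from below by simple functions. Hence the
    difference of the approximants is dominated by |u|, and convergence holds at every point. *)
Lemma finite_approx (u : T -> R) : measurable_fun setT u ->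
  exists g : nat -> T -> R, [/\ forall k, measurable_fun setT (g k),
    forall k, finite_set (range (g k)),
    forall x, (fun k => g k x) @ \oo --> u x &
    forall k x, `|g k x| <= `|u x|].
Proof.
move=> mu'.
pose up x := Num.max (u x) 0; pose un x := Num.max (- u x) 0.
have up0 x : 0 <= up x by rewrite le_max lexx orbT.
have un0 x : 0 <= un x by rewrite le_max lexx orbT.
have key (v : T -> R) : measurable_fun setT v -> (forall x, 0 <= v x) ->
  exists g : nat -> T -> R, [/\ forall k, measurable_fun setT (g k),
    forall k, finite_set (range (g k)),
    forall x, (fun k => g k x) @ \oo --> v x &
    forall k x, 0 <= g k x <= v x].
  move=> mv v0; have mE : measurable_fun setT (EFin \o v) by exact/measurable_EFinP.
  pose g := nnsfun_approx measurableT mE.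
  have cg x : (fun k => g k x) @ \oo --> v x.
    have : EFin \o g ^~ x @ \oo --> (EFin \o v) x.
      by apply: cvg_nnsfun_approx => // y _; rewrite lee_fin.
    by move/fine_cvg.
  exists (fun k => g k); split => //.
  move=> k x; apply/andP; split; first exact: fun_ge0.
    have nd : nondecreasing_seq (fun k => g k x).
      by move=> m n mn; exact/lefP/nd_nnsfun_approx.
    have cx : cvgn (fun k => g k x) by apply/cvg_ex; exists (v x).
    by rewrite -(cvg_lim _ (cg x)) //; exact: nondecreasing_cvgn_le.
have mup : measurable_fun setT up by apply: measurable_maxr => //; exact: measurable_cst.
have mun : measurable_fun setT un.
  by apply: measurable_maxr; [exact: measurable_funN|exact: measurable_cst].
have [p [mp fp cp bp]] := key _ mup up0; have [n [mn fn cn bn]] := key _ mun un0.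
exists (fun k x => p k x - n k x); split.
- by move=> k; exact: measurable_funB.
- move=> k; apply: (@sub_finite_set _ _ ((fun ab : R * R => ab.1 - ab.2) @` (range (p k) `*` range (n k)))).
    by move=> _ [x _ <-]; exists (p k x, n k x) => //; split; exists x.
  by apply: finite_image; exact: finite_setX.
- move=> x; have -> : u x = up x - un x.
    by rewrite /up /un; case: (leP (u x) 0) => h; case: (leP (- u x) 0) => h'; lra.
  exact: cvgB.
- move=> k x; have /andP[p0 pu] := bp k x; have /andP[n0 nu] := bn k x.
  have hu : up x <= `|u x| by rewrite ge_max ler_norm normr_ge0.
  have hn : un x <= `|u x| by rewrite ge_max -normrN ler_norm normr_ge0.
  by rewrite ler_norml; apply/andP; split; lra.
Qed.

Lemma dominated_cvg0 (g : nat -> T -> R) (G : T -> R) :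
  (forall k, measurable_fun setT (g k)) -> (forall k x, 0 <= g k x <= G x) ->
  mu.-integrable setT (EFin \o G) -> (forall x, (fun k => g k x) @ \oo --> (0 : R)) ->
  (fun k => \int[mu]_x (g k x)%:E)%E @ \oo --> 0%E.
Proof.
move=> mg gG iG cg.
have mg' k : measurable_fun setT (EFin \o g k) by exact/measurable_EFinP.
have cg' : {ae mu, forall x, setT x -> (fun k => (g k x)%:E) @ \oo --> 0%E}.
  by apply: nearW => x _; apply: cvg_EFin; [exact: nearW|exact: cg].
have bg : {ae mu, forall x k, setT x -> (`|(g k x)%:E| <= (G x)%:E)%E}.
  apply: nearW => x k _ /=; case/andP: (gG k x) => g0 gg.
  by rewrite lee_fin ger0_norm.
have [_ _] := dominated_convergence measurableT mg' (measurable_cst _) cg' iG bg.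
by rewrite integral0.
Qed.

End Approximation.

Lemma cnorm1 {R : realType} : cnorm (1 : R[i]) = 1.
Proof. by rewrite -[1 : R[i]]/(1%:C) cnormR normr1. Qed.

Lemma cvg0_le {R : realType} (u v : nat -> R) : (forall k, 0 <= u k <= v k) ->
  v @ \oo --> (0 : R) -> u @ \oo --> (0 : R).
Proof.
move=> uv cv; have c0 : (fun _ : nat => 0 : R) @ \oo --> (0 : R) by exact: cvg_cst.
by apply: (squeeze_cvgr _ c0 cv); apply: nearW.
Qed.

Lemma ecvg0_le {R : realType} (u v : nat -> \bar R) : (forall k, 0 <= u k <= v k)%E ->
  v @ \oo --> 0%E -> u @ \oo --> 0%E.
Proof.
move=> uv cv; have c0 : (fun _ : nat => 0%E : \bar R) @ \oo --> 0%E by exact: cvg_cst.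
by apply: (squeeze_cvge _ c0 cv); apply: nearW.
Qed.

(** * Existence of the Bochner integral on the group *)

Section BochnerHeis.
Context {R : realType}.
Notation leb := (@lebesgue_measure R).
Notation RR := (measurableTypeR R * measurableTypeR R)%type.
Notation HH := (measurableTypeR R * measurableTypeR R * measurableTypeR R)%type.
Notation hm := (sfprod (sfprod leb leb) leb).

Definition box (k : nat) : set HH :=
  (`[- k%:R, k%:R]%classic `*` `[- k%:R, k%:R]%classic) `*` `[- k%:R, k%:R]%classic.

Lemma measurable_box k : measurable (box k).
Proof. by apply: measurableX; [apply: measurableX|]; exact: measurable_itv. Qed.

Lemma box_finite k : (hm (box k) < +oo)%E.
Proof.
pose I : set R := `[- k%:R, k%:R]%classic.
have l : (leb I < +oo)%E.
  by rewrite lebesgue_measure_itv /=; case: ifP => _; rewrite ?ltry // -EFinB ltry.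
have mI : measurable I by exact: measurable_itv.
have e1 : (sfprod leb leb (I `*` I) = leb I * leb I)%E by exact: product_measure1E.
have e2 : (hm (box k) = sfprod leb leb (I `*` I) * leb I)%E.
  by apply: product_measure1E => //; exact: measurableX.
by rewrite e2 e1; apply: lte_mul_pinfty => //; rewrite ?ge0_fin_numE // ?mule_ge0 // lte_mul_pinfty // ge0_fin_numE.
Qed.

Lemma box_eventually (q : HH) : \forall k \near \oo, box k q.
Proof.
have h (a : R) : \forall k \near \oo, a \in `[- k%:R, k%:R].
  have := nbhs_infty_ger (`|a|); apply: filterS => k ak.
  by rewrite in_itv /= -ler_norml.
apply: filterS3 (h q.1.1) (h q.1.2) (h q.2) => k h1 h2 h3.
by split => //; split.
Qed.

Variables (h : R) (F : R[i] -> R[i]).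
Hypothesis fF : fock F.
Variables (D : set HH) (f : HH -> R[i]).
Hypothesis mD : measurable D.
Hypothesis fi : cintegrable hm setT f.
Hypothesis f0 : forall q, ~ D q -> f q = 0.

Let Psi (q : heis R) := beta h (hinv q) F.
Let N := fine (N2 F).
Let NE (q : heis R) : N2 (Psi q) = N%:E.
Proof. by rewrite N2_beta // (N2_fin (fock_L2 fF).2). Qed.
Let N0 : 0 <= N. Proof. by rewrite fine_ge0 // N2_ge0. Qed.
Let fPsi q : fock (Psi q). Proof. exact: fock_beta. Qed.
Let mf : cmeas f. Proof. exact: cintegrable_cmeas fi. Qed.

Variables gx gy gt gu gv : nat -> HH -> R.
Hypothesis hx : [/\ forall k, measurable_fun setT (gx k),
    forall k, finite_set (range (gx k)),
    forall q, (fun k => gx k q) @ \oo --> q.1.1 & forall k q, `|gx k q| <= `|q.1.1| ].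
Hypothesis hy : [/\ forall k, measurable_fun setT (gy k),
    forall k, finite_set (range (gy k)),
    forall q, (fun k => gy k q) @ \oo --> q.1.2 & forall k q, `|gy k q| <= `|q.1.2| ].
Hypothesis ht : [/\ forall k, measurable_fun setT (gt k),
    forall k, finite_set (range (gt k)),
    forall q, (fun k => gt k q) @ \oo --> q.2 & forall k q, `|gt k q| <= `|q.2| ].
Hypothesis hu : [/\ forall k, measurable_fun setT (gu k),
    forall k, finite_set (range (gu k)),
    forall q, (fun k => gu k q) @ \oo --> complex.Re (f q) &
    forall k q, `|gu k q| <= `|complex.Re (f q)| ].
Hypothesis hv : [/\ forall k, measurable_fun setT (gv k),
    forall k, finite_set (range (gv k)),
    forall q, (fun k => gv k q) @ \oo --> complex.Im (f q) &
    forall k q, `|gv k q| <= `|complex.Im (f q)| ].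

Let A k : set HH := box k `&` D.
Let mA k : measurable (A k).
Proof. by apply: measurableI => //; exact: measurable_box. Qed.

(** Approximating the point q, rather than the vector Psi(q), by finitely many values yields simple
    functions at once; strong continuity of Psi makes them converge, with no appeal to separability
    of Fock space. *)
Let sg k (q : HH) : R * R * R * R * R := (gx k q, gy k q, gt k q, gu k q, gv k q).
Let vec (c : R * R * R * R * R) : R[i] -> R[i] :=
  fun z => (c.1.2 +i* c.2) * Psi c.1.1 z.

Let finite_sg k : finite_set (range (sg k)).
Proof.
have [_ fx _ _] := hx; have [_ fy _ _] := hy; have [_ ft _ _] := ht.
have [_ fu _ _] := hu; have [_ fv _ _] := hv.
apply: (@sub_finite_set _ _ ((((range (gx k) `*` range (gy k)) `*` range (gt k))
  `*` range (gu k)) `*` range (gv k))).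
  by move=> _ [q _ <-]; do 4!(split; last by exists q); exists q.
by do 4!(apply: finite_setX => //).
Qed.

Let lst k : {l : seq (R * R * R * R * R) | uniq l /\ forall q, sg k q \in l}.
Proof.
apply: cid; have [l hl] := (finite_seqP _).1 (finite_sg k).
exists (undup l); rewrite undup_uniq; split => // q; rewrite mem_undup.
have : range (sg k) (sg k q) by exists q.
by rewrite hl.
Qed.

(* Psi is sampled at finitely many points: the coordinates of q and the value
   of f are replaced by finitely-valued approximations, on a bounded box. *)
Let s k : seq (set HH * (R[i] -> R[i])) :=
  [seq (sg k @^-1` [set c] `&` A k, vec c) | c <- projT1 (lst k)].

Let evalE k q z : simple_eval (s k) q z = cind (A k) q * vec (sg k q) z.
Proof.
rewrite /simple_eval /s big_map.
have [Aq|Aq] := pselect (A k q); last first.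
  rewrite (cindN Aq) mul0r big1 // => c _ /=.
  by rewrite indicE memNset ?mul0r // => -[].
have [ul ql] := projT2 (lst k).
rewrite (bigD1_seq (sg k q)) //= big1 ?addr0; last first.
  move=> c cq; rewrite indicE memNset ?mul0r // => -[/= qc _].
  by move: cq; rewrite qc eqxx.
by rewrite cindE // indicE mem_set.
Qed.

Let fock_s k : fock_simple hm D (s k).
Proof.
move=> a /mapP[c _ ->] /=.
have [mx _ _ _] := hx; have [my _ _ _] := hy; have [mt _ _ _] := ht.
have [mu' _ _ _] := hu; have [mv _ _ _] := hv.
have mc : measurable (sg k @^-1` [set c]).
  rewrite (_ : _ @^-1` _ = gx k @^-1` [set c.1.1.1.1] `&` (gy k @^-1` [set c.1.1.1.2]
    `&` (gt k @^-1` [set c.1.1.2] `&` (gu k @^-1` [set c.1.2] `&` gv k @^-1` [set c.2])))).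
    have P (g : nat -> HH -> R) (e : R) : (forall k, measurable_fun setT (g k)) ->
        measurable (g k @^-1` [set e]).
      by move=> mg; rewrite -[X in measurable X]setTI; apply: mg => //; exact: measurable_set1.
    by do 4!(apply: measurableI; first exact: P); exact: P.
  apply/seteqP; split => q /=; first by move=> <-.
  by case: c => [[[[a1 a2] a3] a4] a5] /= [h1 [h2 [h3 [h4 h5]]]]; rewrite /sg h1 h2 h3 h4 h5.
split; [exact: measurableI| |exact: fockZ].
apply: le_lt_trans (box_finite k); apply: le_measure; rewrite ?inE.
- by apply: measurableI => //; exact: measurableI.
- exact: measurable_box.
- by move=> q [[_ [bq _]] _].
Qed.

Let fk k q : R[i] := gu k q +i* gv k q.
Let pk k (q : HH) : heis R := (gx k q, gy k q, gt k q).
(** The two sources of error: f Psi(q) minus the simple function equals a_k Psi(p_k(q)) + f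
    dPsi_k(q), where p_k(q) is the sampling point. *)
Let a k q := f q - cind (A k) q * fk k q.
Let dPsi k (q : HH) z := Psi q z - Psi (pk k q) z.
Let del k q := fine (N2 (dPsi k q)).

Let cmeas_a k : cmeas (a k).
Proof.
have [mu' _ _ _] := hu; have [mv _ _ _] := hv.
apply: cmeasB => //; apply: cmeasM; first exact: cmeas_cind.
exact: cmeas_pair.
Qed.

(** Here 3 is 1 for f plus 2 for [fk], each coordinate of which is bounded by |f|. *)
Let le_a k q : cnorm (a k q) <= 3 * cnorm (f q).
Proof.
have [_ _ _ bu] := hu; have [_ _ _ bv] := hv.
apply: (le_trans (cnormB _ _)); rewrite cnormM.
have h1 : cnorm (fk k q) <= 2 * cnorm (f q).
  apply: (le_trans (cnorm_le _)) => /=.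
  have := le_trans (bu k q) (normRe_le (f q)); have := le_trans (bv k q) (normIm_le (f q)).
  by lra.
have h2 : cnorm (cind (A k) q : R[i]) * cnorm (fk k q) <= 1 * cnorm (fk k q).
  by rewrite ler_wpM2r ?cnorm_ge0 // cnorm_cind_le1.
by lra.
Qed.

Let cvg_a q : (fun k => cnorm (a k q)) @ \oo --> (0 : R).
Proof.
have [_ _ cu _] := hu; have [_ _ cv _] := hv.
have [Dq|Dq] := pselect (D q); last first.
  rewrite (_ : (fun k => _) = (fun=> 0)); first exact: cvg_cst.
  apply/funext => k; rewrite /a f0 // cindN ?mul0r ?subr0 ?cnorm0 //.
  by move=> [].
have : (fun k => cnorm (fk k q - f q)) @ \oo --> (0 : R).
  by apply: ccvg_cnorm; split => /=; [exact: cu|exact: cv].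
move=> c; apply: cvg_trans c; apply: near_eq_cvg.
apply: filterS (box_eventually q) => k bq.
by rewrite /a cindE // mul1r -cnormN opprB.
Qed.

Let measurable_pk k : measurable_fun setT (pk k : HH -> HH).
Proof.
have [mx _ _ _] := hx; have [my _ _ _] := hy; have [mt _ _ _] := ht.
exact: (measurable_fun_pair (measurable_fun_pair (mx k) (my k)) (mt k)).
Qed.

Let cF : ccont F. Proof. by apply: holomorphic_ccont; case/fockP: fF. Qed.

Let joint_Psi : cmeas (fun p : HH * RR => Psi p.1 (toC p.2)).
Proof. exact: (cmeas_beta_inv h cF (@measurable_fst _ _ _ _) (@measurable_snd _ _ _ _)). Qed.

Let joint_Psik k : cmeas (fun p : HH * RR => Psi (pk k p.1) (toC p.2)).
Proof.
apply: (cmeas_beta_inv h cF _ (@measurable_snd _ _ _ _)).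
exact: (measurableT_comp (measurable_pk k) (@measurable_fst _ _ _ _)).
Qed.

Let fock_dPsi k q : fock (dPsi k q).
Proof. exact: (fockB (fPsi q) (fPsi (pk k q))). Qed.

Let N2_dPsi k q : (N2 (dPsi k q) <= (4 * N)%:E)%E.
Proof.
rewrite /dPsi; have -> : (fun z => Psi q z - Psi (pk k q) z)
    = (fun z => Psi q z + -1 * Psi (pk k q) z).
  by apply/funext => z; rewrite mulN1r.
have [m1 _] := fock_L2 (fPsi q); have [m2 _] := fock_L2 (fPsi (pk k q)).
apply: (le_trans (@N2D _ (Psi q) (fun z => -1 * Psi (pk k q) z) m1 (cmeasM (cmeas_cst _) m2))).
rewrite (N2Z _ m2) !NE cnormN cnorm1 expr1n mul1e.
by rewrite -EFinM -EFinD lee_fin; lra.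
Qed.

Let delE k q : N2 (dPsi k q) = (del k q)%:E.
Proof. by rewrite -N2_fin // (fock_L2 (fock_dPsi k q)).2. Qed.

Let del0 k q : 0 <= del k q. Proof. by rewrite fine_ge0 // N2_ge0. Qed.

Let del4 k q : del k q <= 4 * N.
Proof. by rewrite -lee_fin -delE. Qed.

Let measurable_del k : measurable_fun setT (del k).
Proof.
apply: measurableT_comp => //.
apply: (@measurable_fun_fubini_tonelli_F _ _ _ _ _ (sfprod leb leb)
  (fun p : HH * RR => (cnorm (dPsi k p.1 (toC p.2)) ^+ 2 * gauss p.2)%:E)).
  apply/measurable_EFinP; apply: measurable_funM; last first.
    exact: (measurableT_comp (@measurable_gauss R) (@measurable_snd _ _ _ _)).
  apply: measurable_funX; apply: measurable_cnorm.
  exact: (cmeasB joint_Psi (joint_Psik k)).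
by move=> p; rewrite lee_fin mulr_ge0 ?sqr_ge0 ?gauss_ge0.
Qed.

Let cvg_del q : (fun k => del k q) @ \oo --> (0 : R).
Proof.
have [_ _ cx _] := hx; have [_ _ cy _] := hy; have [_ _ ct _] := ht.
have := @beta_inv_N2_cvg _ h F (fun k => pk k q) q fF (cx q) (cy q) (ct q).
move/fine_cvg => c; apply: cvg_trans c; apply: near_eq_cvg; apply: nearW => k /=.
rewrite /del; have -> // : N2 (fun z => Psi (pk k q) z - Psi q z) = N2 (dPsi k q).
by apply: eq_integral => w _; rewrite /dPsi -cnormN opprB.
Qed.

Let f_norm_int : hm.-integrable setT (fun q => (cnorm (f q))%:E).
Proof. exact: cintegrable_norm. Qed.

Let scaled_int (C : R) : hm.-integrable setT (EFin \o (fun q => C * cnorm (f q))).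
Proof. by rewrite /comp; under eq_fun do rewrite EFinM; exact: integrableZl. Qed.

(** A measurable majorant of the Fock norm of the error: 1 / pi comes from the normalization of the
    norm, 2 from [N2D]. *)
Let bnd k q := Num.sqrt (pi^-1 * 2) *
  (cnorm (a k q) * Num.sqrt N + cnorm (f q) * Num.sqrt (del k q)).

Let fock_norm_bnd k q :
  fock_norm ((fun z => f q * Psi q z) \- simple_eval (s k) q) <= bnd k q.
Proof.
rewrite fock_normE.
have [m1 _] := fock_L2 (fPsi (pk k q)); have [m2 _] := fock_L2 (fock_dPsi k q).
have E : (fun z => f q * Psi q z) \- simple_eval (s k) q =
    (fun z => a k q * Psi (pk k q) z + f q * dPsi k q z).
  by apply/funext => z /=; rewrite evalE /vec /= /a /dPsi /fk /pk; ring.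
have Nle : fine (N2 ((fun z => f q * Psi q z) \- simple_eval (s k) q)) <=
    2 * (cnorm (a k q) * Num.sqrt N + cnorm (f q) * Num.sqrt (del k q)) ^+ 2.
  have hE := fockB (fockZ (f q) (fPsi q)) (fock_simple_eval q (@fock_s k)).
  rewrite -lee_fin -(N2_fin (fock_L2 hE).2) -[X in N2 X]/(_ \- _) E.
  apply: (le_trans (@N2D _ (fun z => a k q * Psi (pk k q) z) (fun z => f q * dPsi k q z)
    (cmeasM (cmeas_cst _) m1) (cmeasM (cmeas_cst _) m2))).
  rewrite (N2Z _ m1) (N2Z _ m2) NE delE -!EFinM -EFinD lee_fin sqrrD !exprMn.
  rewrite !sqr_sqrtr //.
  have : 0 <= cnorm (a k q) * Num.sqrt N * (cnorm (f q) * Num.sqrt (del k q)).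
    by rewrite !mulr_ge0 ?cnorm_ge0 ?sqrtr_ge0.
  by lra.
have pi0 : 0 <= pi^-1 :> R by rewrite invr_ge0 pi_ge0.
apply: (@le_trans _ _ (Num.sqrt (pi^-1 * 2 * (cnorm (a k q) * Num.sqrt N + cnorm (f q) * Num.sqrt (del k q)) ^+ 2))).
  by rewrite ler_wsqrtr // -mulrA ler_wpM2l.
rewrite sqrtrM ?mulr_ge0 // sqrtr_sqr ger0_norm //.
by rewrite addr_ge0 // mulr_ge0 ?cnorm_ge0 ?sqrtr_ge0.
Qed.

Let bnd0 k q : 0 <= bnd k q.
Proof. by rewrite mulr_ge0 ?sqrtr_ge0 // addr_ge0 // mulr_ge0 ?cnorm_ge0 ?sqrtr_ge0. Qed.

Let sqrt_cont (u : nat -> R) : u @ \oo --> (0 : R) -> (fun k => Num.sqrt (u k)) @ \oo --> (0 : R).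
Proof.
move=> cu; rewrite -[X in _ --> X]sqrtr0.
by apply: (cvg_comp _ _ cu); exact: sqrt_continuous.
Qed.

Let cvg_bnd q : (fun k => bnd k q) @ \oo --> (0 : R).
Proof.
have -> : (0 : R) = Num.sqrt (pi^-1 * 2) * (0 * Num.sqrt N + cnorm (f q) * 0) by ring.
apply: cvgM; first exact: cvg_cst.
apply: cvgD; apply: cvgM; [exact: cvg_a|exact: cvg_cst|exact: cvg_cst|].
exact: sqrt_cont.
Qed.

Let int_bnd : (fun k => \int[hm]_q (bnd k q)%:E)%E @ \oo --> 0%E.
Proof.
(* The constants are those of |a_k| <= 3 |f| and of the uniform bound 4N on the squared distance
   between two vectors of squared norm N. *)
apply: (@dominated_cvg0 _ _ _ _ bnd (fun q => Num.sqrt (pi^-1 * 2) * (3 * Num.sqrt N + Num.sqrt (4 * N)) * cnorm (f q))).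
- move=> k; apply: measurable_funM; first exact: measurable_cst.
  apply: measurable_funD; apply: measurable_funM.
  + exact: measurable_cnorm.
  + exact: measurable_cst.
  + exact: measurable_cnorm.
  + apply: measurableT_comp; last exact: measurable_del.
    exact: continuous_measurable_fun (@sqrt_continuous R).
- move=> k q; rewrite bnd0 /= /bnd -mulrA ler_wpM2l ?sqrtr_ge0 // mulrDl.
  apply: lerD.
    by rewrite mulrAC ler_wpM2r ?sqrtr_ge0.
  by rewrite mulrC ler_wpM2r ?cnorm_ge0 // ler_wsqrtr.
- exact: scaled_int.
- exact: cvg_bnd.
Qed.

Let int_a : (fun k => \int[hm]_q (cnorm (a k q))%:E)%E @ \oo --> 0%E.
Proof.
apply: (@dominated_cvg0 _ _ _ _ (fun k q => cnorm (a k q)) (fun q => 3 * cnorm (f q))).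
- by move=> k; exact: measurable_cnorm.
- by move=> k q; rewrite cnorm_ge0 le_a.
- exact: scaled_int.
- exact: cvg_a.
Qed.

Let int_del : (fun k => \int[hm]_q (cnorm (f q) * del k q)%:E)%E @ \oo --> 0%E.
Proof.
apply: (@dominated_cvg0 _ _ _ _ (fun k q => cnorm (f q) * del k q) (fun q => (4 * N) * cnorm (f q))).
- by move=> k; apply: measurable_funM => //; exact: measurable_cnorm.
- move=> k q; rewrite mulr_ge0 ?cnorm_ge0 //= mulrC ler_wpM2r ?cnorm_ge0 //.
- exact: scaled_int.
- move=> q; rewrite -[X in _ --> X](mulr0 (cnorm (f q))).
  by apply: cvgM; [exact: cvg_cst|exact: cvg_del].
Qed.

Let ai k : cintegrable hm setT (a k).
Proof. by apply: (le_cintegrable (cmeas_a k) (le_a k)); exact: scaled_int. Qed.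

Definition bochner_value (z : R[i]) : R[i] :=
  cintegral hm setT (fun q => f q * Psi q z).

Let fock_value : fock bochner_value.
Proof.
by apply: (fock_integral_fock fi joint_Psi N0 fPsi) => q; rewrite NE.
Qed.

Let W1 k z := cintegral hm setT (fun q => a k q * Psi (pk k q) z).
Let W2 k z := cintegral hm setT (fun q => f q * dPsi k q z).

Let hN1 k q : (N2 (Psi (pk k q)) <= N%:E)%E. Proof. by rewrite NE. Qed.
Let hN2 k q : (N2 (dPsi k q) <= (4 * N)%:E)%E. Proof. exact: N2_dPsi. Qed.
Let N40 : 0 <= 4 * N. Proof. by rewrite mulr_ge0. Qed.
Let joint_d k : cmeas (fun p : HH * RR => dPsi k p.1 (toC p.2)).
Proof. exact: (cmeasB joint_Psi (joint_Psik k)). Qed.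

Let value_sub k z : bochner_value z - simple_integral hm D (s k) z = W1 k z + W2 k z.
Proof.
have [i1 _] := fock_integral_jensen (ai k) (joint_Psik k) N0 (fun q => fPsi (pk k q)) (hN1 k) z.
have [i2 _] := fock_integral_jensen fi (joint_d k) N40 (fock_dPsi k) (hN2 k) z.
have [i3 _] := fock_integral_jensen fi joint_Psi N0 fPsi (fun q => eq_ind_r (fun x => x <= N%:E)%E (lexx _) (NE q)) z.
have [is_ es] := simple_cintegral mD z (@fock_s k).
have is' := (cintegrable_cind _ _ mD).1 is_.
rewrite -es cintegral_cind /bochner_value -cintegralB // /W1 /W2 -cintegralD //.
apply: eq_cintegral => q _; rewrite evalE /vec /= /a /dPsi /fk /pk.
rewrite /A; have [Dq|Dq] := pselect (D q); first by rewrite (cindE Dq); ring.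
by rewrite f0 // (cindN Dq) (_ : cind (box k `&` D) q = 0) ?cindN //; [ring|case].
Qed.

(** The difference splits into the integrals W1 and W2 of the two errors; [fock_integral_N2] bounds
    each by quantities that tend to 0 by dominated convergence. *)
Let cvg_value : (fun k => fock_norm (bochner_value \- simple_integral hm D (s k))) @ \oo --> (0 : R).
Proof.
pose al k := fine (\int[hm]_q (cnorm (a k q))%:E)%E.
pose be k := fine (\int[hm]_q (cnorm (f q) * del k q)%:E)%E.
pose I := \int[hm]_q cnorm (f q).
have cal : al @ \oo --> (0 : R) by move/fine_cvg: int_a.
have cbe : be @ \oo --> (0 : R) by move/fine_cvg: int_del.
pose B k := pi^-1 * (2 * (al k * (al k * N)) + 2 * (I * be k)).
have cB : (fun k => Num.sqrt (B k)) @ \oo --> (0 : R).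
  apply: sqrt_cont.
  have -> : (0 : R) = pi^-1 * (2 * (0 * (0 * N)) + 2 * (I * 0)) by ring.
  apply: cvgM; first exact: cvg_cst.
  apply: cvgD; (apply: cvgM; first exact: cvg_cst).
    by apply: cvgM => //; apply: cvgM => //; exact: cvg_cst.
  by apply: cvgM => //; exact: cvg_cst.
apply: (cvg0_le _ cB) => k; rewrite {1}/fock_norm sqrtr_ge0 /= fock_normE.
apply: ler_wsqrtr; rewrite ler_wpM2l ?invr_ge0 ?pi_ge0 //.
have E : bochner_value \- simple_integral hm D (s k) = (fun z => W1 k z + W2 k z).
  by apply/funext => z; exact: value_sub.
have h1 := fock_integral_N2 (ai k) (joint_Psik k) N0 (fun q => fPsi (pk k q)) (hN1 k).
have h2 := fock_integral_N2 fi (joint_d k) N40 (fock_dPsi k) (hN2 k).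
have m1 := fock_integral_cmeas (ai k) (joint_Psik k) N0 (fun q => fPsi (pk k q)) (hN1 k).
have m2 := fock_integral_cmeas fi (joint_d k) N40 (fock_dPsi k) (hN2 k).
have fE := fockB fock_value (fock_simple_integral (@fock_s k)).
rewrite -lee_fin -(N2_fin (fock_L2 fE).2) -[X in N2 X]/(_ \- _) E.
have fa : (\int[hm]_q (cnorm (a k q))%:E = (al k)%:E)%E.
  rewrite /al fineK //; have := cintegrable_norm measurableT (ai k).
  exact: integrable_fin_num.
apply: (le_trans (N2D m1 m2)); rewrite (EFinD (2 * _) (2 * _)); apply: leeD;
  rewrite (EFinM 2); apply: lee_wpmul2l => //.
  apply: (le_trans h1); rewrite (_ : Rintegral _ _ _ = al k) // EFinM.
  apply: lee_wpmul2l; first by rewrite lee_fin fine_ge0 // integral_ge0 // => q _; rewrite lee_fin cnorm_ge0.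
  under eq_integral do rewrite NE.
  by rewrite ge0_integralZr // ?fa //; [exact: measurable_cnormE|move=> q _; rewrite lee_fin cnorm_ge0].
apply: (le_trans h2); rewrite EFinM.
apply: lee_wpmul2l; first by rewrite lee_fin; apply: Rintegral_ge0 => q _; exact: cnorm_ge0.
under eq_integral do rewrite delE -EFinM.
rewrite /be fineK //.
rewrite ge0_fin_numE; last by apply: integral_ge0 => q _; rewrite lee_fin mulr_ge0 ?cnorm_ge0.
have /integrableP[_] := scaled_int (4 * N).
apply: le_lt_trans; apply: ge0_le_integral_nonmeas => q _.
  by rewrite lee_fin mulr_ge0 ?cnorm_ge0.
by rewrite /= lee_fin ger0_norm ?mulr_ge0 ?cnorm_ge0 // mulrC ler_wpM2r ?cnorm_ge0.
Qed.

Lemma is_bochner_approx : is_bochner_integral hm D (fun q z => f q * Psi q z) bochner_value.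
Proof.
split; [by move=> q _; exact: fockZ|exact: fock_value|exists s; split].
- exact: fock_s.
- apply: nearW => q _.
  apply: (cvg0_le _ (cvg_bnd q)) => k.
  by rewrite fock_norm_bnd andbT /fock_norm sqrtr_ge0.
- apply: (ecvg0_le _ int_bnd) => k; apply/andP; split.
    by apply: integral_ge0 => q _; rewrite lee_fin /fock_norm sqrtr_ge0.
  apply: (@le_trans _ _ (\int[hm]_(q in D) (bnd k q)%:E)%E).
    apply: ge0_le_integral_nonmeas => q _; first by rewrite lee_fin /fock_norm sqrtr_ge0.
    by rewrite lee_fin fock_norm_bnd.
  rewrite integral_mkcond; apply: ge0_le_integral_nonmeas => q _; rewrite patchE;
    by case: ifP => _; rewrite ?lee_fin ?lexx.
- exact: cvg_value.
Qed.

End BochnerHeis.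

Section BochnerExistence.
Context {R : realType}.
Notation leb := (@lebesgue_measure R).
Notation HH := (measurableTypeR R * measurableTypeR R * measurableTypeR R)%type.
Notation hm := (sfprod (sfprod leb leb) leb).
Variables (h : R) (F : R[i] -> R[i]) (D : set HH).
Hypotheses (fF : fock F) (mD : measurable D).

Let exists0 (f : HH -> R[i]) : cintegrable hm setT f -> (forall q, ~ D q -> f q = 0) ->
  is_bochner_integral hm D (fun q z => f q * beta h (hinv q) F z) (bochner_value h F f).
Proof.
move=> fi f0; have [mu mv] := cintegrable_cmeas fi.
have mx : measurable_fun setT (fun q : HH => q.1.1).
  exact: (measurableT_comp (@measurable_fst _ _ _ _) (@measurable_fst _ _ _ _)).
have my : measurable_fun setT (fun q : HH => q.1.2).
  exact: (measurableT_comp (@measurable_snd _ _ _ _) (@measurable_fst _ _ _ _)).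
have [gx hx] := finite_approx mx; have [gy hy] := finite_approx my.
have [gt ht] := finite_approx (@measurable_snd _ _ _ _ : measurable_fun setT (fun q : HH => q.2)).
have [gu hu] := finite_approx mu; have [gv hv] := finite_approx mv.
exact: (is_bochner_approx h fF mD fi f0 hx hy ht hu hv).
Qed.

(** The construction over the whole group is applied to 1_D f, which is integrable everywhere and
    vanishes off D. *)
Lemma bochner_exists (f : HH -> R[i]) : cintegrable hm D f ->
  is_bochner_integral hm D (fun q z => f q * fock_adjoint (beta h q) F z)
    (fun z => cintegral hm D (fun q => f q * beta h (hinv q) F z)) /\
  forall z, cintegrable hm D (fun q => f q * beta h (hinv q) F z).
Proof.
move=> fi; have fi' := (cintegrable_cind _ _ mD).1 fi.
have f0 q : ~ D q -> cind D q * f q = 0 by move=> Dq; rewrite cindN // mul0r.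
have E : bochner_value h F (fun q => cind D q * f q) =
    (fun z => cintegral hm D (fun q => f q * beta h (hinv q) F z)).
  apply/funext => z; rewrite cintegral_cind; apply: eq_cintegral => q _.
  by rewrite mulrA.
have [_ fV [s [h1 h2 h3 h4]]] := exists0 fi' f0.
have Dq q : D q -> (fun z => cind D q * f q * beta h (hinv q) F z)
    = (fun z => f q * fock_adjoint (beta h q) F z).
  by move=> Dq; apply/funext => z; rewrite cindE // mul1r fock_adjoint_beta.
split.
  split.
  - by move=> q _; apply: fockZ; rewrite fock_adjoint_beta //; exact: fock_beta.
  - by rewrite -E.
  exists s; split.
  - exact: h1.
  - by apply: filterS h2 => q hq Dq'; have := hq Dq'; rewrite Dq.
  - apply: cvg_trans h3; apply: near_eq_cvg; apply: nearW => k; apply: eq_integral => q.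
    by rewrite inE => qD; rewrite Dq.
  - by rewrite -E.
move=> z; apply/(cintegrable_cind _ _ mD).
have mPsi : cmeas (fun p : HH * (measurableTypeR R * measurableTypeR R) => beta h (hinv p.1) F (toC p.2)).
  apply: (cmeas_beta_inv h _ (@measurable_fst _ _ _ _) (@measurable_snd _ _ _ _)).
  by apply: holomorphic_ccont; case/fockP: fF.
have N0 : 0 <= fine (N2 F) by rewrite fine_ge0 // N2_ge0.
have NM q : (N2 (beta h (hinv q) F) <= (fine (N2 F))%:E)%E.
  by rewrite N2_beta // -(N2_fin (fock_L2 fF).2).
have [i1 _] := fock_integral_jensen fi' mPsi N0 (fun q => fock_beta h (hinv q) fF) NM z.
by apply: (eq_cintegrable measurableT _ i1) => q _; rewrite mulrA.
Qed.

(** Existence is [bochner_exists]; any other choice has the same value at each point by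
    [bochner_pointwise]. From here on the operators are scalar integrals. *)
Lemma bochner_integralE (f : HH -> R[i]) : cintegrable hm D f ->
  bochner_integral hm D (fun q z => f q * fock_adjoint (beta h q) F z)
  = (fun z => cintegral hm D (fun q => f q * beta h (hinv q) F z)).
Proof.
move=> fi; have [b1 i1] := bochner_exists fi.
apply: xget_unique => // V bV; apply/funext => z.
have E q : f q * fock_adjoint (beta h q) F z = f q * beta h (hinv q) F z.
  by rewrite fock_adjoint_beta.
rewrite (bochner_pointwise mD bV) //; first by apply: eq_cintegral => q _.
by apply: (eq_cintegrable mD _ (i1 z)) => q _; rewrite E.
Qed.

Lemma bochner_integral_fock (f : HH -> R[i]) : cintegrable hm D f ->
  fock (fun z => cintegral hm D (fun q => f q * beta h (hinv q) F z)).
Proof. by move=> /bochner_exists[[]]. Qed.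

End BochnerExistence.

(** * The X-ray transform on L1 *)

Section CcDense.
Context {R : realType}.
Notation leb := (@lebesgue_measure R).
Notation HH := (measurableTypeR R * measurableTypeR R * measurableTypeR R)%type.
Notation hm := (sfprod (sfprod leb leb) leb).

Let hcont (d : heis R -> R) := continuous d.

Let hcontD d1 d2 : hcont d1 -> hcont d2 -> hcont (fun q => d1 q + d2 q).
Proof. by move=> h1 h2 q; apply: cvgD; [exact: h1|exact: h2]. Qed.

Let hcontM d1 d2 : hcont d1 -> hcont d2 -> hcont (fun q => d1 q * d2 q).
Proof. by move=> h1 h2 q; apply: cvgM; [exact: h1|exact: h2]. Qed.

Let hcont_norm d : hcont d -> hcont (fun q => `|d q|).
Proof. by move=> h q; apply: cvg_norm; exact: h. Qed.

Let hcont_cst (a : R) : hcont (fun=> a).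
Proof. by move=> q; exact: cvg_cst. Qed.

Let hcont_x : hcont (fun q => q.1.1).
Proof. by move=> [[x y] t]; apply: (cvg_comp fst fst); exact: cvg_fst. Qed.
Let hcont_y : hcont (fun q => q.1.2).
Proof. by move=> [[x y] t]; apply: (cvg_comp fst snd); [exact: cvg_fst|exact: cvg_snd]. Qed.
Let hcont_t : hcont (fun q => q.2).
Proof. by move=> [[x y] t]; exact: cvg_snd. Qed.

(** Vanishing off some box replaces compact support: it is visibly stable under sums, and [CbC]
    recovers compactness at the end. *)
Let Cb (u : heis R -> R[i]) := [/\ hcont (fun q => complex.Re (u q)),
  hcont (fun q => complex.Im (u q)) & exists k, forall q, ~ box k q -> u q = 0].

Let box_le k m (q : HH) : (k <= m)%N -> box k q -> box m q.
Proof.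
move=> km; have km' : (k%:R <= m%:R :> R) by rewrite ler_nat.
have km2 : (- m%:R <= - k%:R :> R) by rewrite lerN2.
move=> [[/= /andP[a1 a2] /andP[a3 a4]] /andP[a5 a6]].
rewrite !bnd_simp in a1 a2 a3 a4 a5 a6.
by split; [split|]; rewrite /= in_itv /=; apply/andP; split;
  (apply: le_trans km2 _ || apply: le_trans km').
Qed.

Let CbD u v : Cb u -> Cb v -> Cb (fun q => u q + v q).
Proof.
move=> [u1 u2 [k uk]] [v1 v2 [m vm]]; split.
- by rewrite /hcont; under eq_fun do rewrite ReD; exact: hcontD.
- by rewrite /hcont; under eq_fun do rewrite ImD; exact: hcontD.
- exists (maxn k m) => q qn; rewrite uk ?vm ?addr0 // => b; apply: qn.
  + exact: box_le (leq_maxr _ _) b.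
  + exact: box_le (leq_maxl _ _) b.
Qed.

Let CbZ c u : Cb u -> Cb (fun q => c * u q).
Proof.
move=> [u1 u2 [k uk]]; split.
- rewrite /hcont; under eq_fun do rewrite ReM -mulNr.
  by apply: hcontD; apply: hcontM => //; exact: hcont_cst.
- rewrite /hcont; under eq_fun do rewrite ImM.
  by apply: hcontD; apply: hcontM => //; exact: hcont_cst.
- by exists k => q qn; rewrite uk ?mulr0.
Qed.

Let CbC u : Cb u -> Cc u.
Proof.
move=> [u1 u2 [k uk]]; split.
  move=> q; apply/cvgrPdist_lt => e e0.
  have eE : e = (complex.Re e)%:C.
    by move: e0; rewrite ltcE => /andP[/eqP ie _]; apply: complex_ext.
  have r0 : 0 < complex.Re e by move: e0; rewrite eE ltcR.
  have /cvgrPdist_lt/(_ _ (divr_gt0 r0 (ltr0Sn _ 1))) h1 := u1 q.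
  have /cvgrPdist_lt/(_ _ (divr_gt0 r0 (ltr0Sn _ 1))) h2 := u2 q.
  apply: filterS2 h1 h2 => p h1 h2; rewrite normC_cnorm eE ltcR.
  apply: (le_lt_trans (cnorm_le _)); rewrite ReD ImD ReN ImN.
  by rewrite (splitr (complex.Re e)) ltrD.
apply: (@subclosed_compact _ _ (box k : set (heis R))).
- exact: closed_closure.
- by apply: compact_setX; [apply: compact_setX|]; exact: segment_compact.
- have cb : closed (box k : set (heis R)).
    by apply: compact_closed; [exact: norm_hausdorff|]; apply: compact_setX; [apply: compact_setX|]; exact: segment_compact.
  rewrite closureE; apply: smallest_sub => // q /eqP uq; apply: contrapT => qn.
  by apply: uq; exact: uk.
Qed.

Let App (g : HH -> R[i]) := cmeas g /\ forall e : R, 0 < e ->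
  exists u, Cb u /\ (L1norm hm setT (fun q => (u q - g q)%R) <= e%:E)%E.

Let Cb_cmeas u : Cb u -> cmeas (u : HH -> R[i]).
Proof. by move=> /CbC[cu _]; exact: heis_cont_cmeas. Qed.

Lemma L1normD (D : set HH) (a b : HH -> R[i]) : measurable D -> cmeas a -> cmeas b ->
  (L1norm hm D (fun q => (a q + b q)%R) <= L1norm hm D a + L1norm hm D b)%E.
Proof.
move=> mD ma mb; rewrite /L1norm -ge0_integralD //; last 4 first.
- by move=> q _; rewrite lee_fin cnorm_ge0.
- exact: (measurable_funS measurableT (@subsetT _ _) (measurable_cnormE ma)).
- by move=> q _; rewrite lee_fin cnorm_ge0.
- exact: (measurable_funS measurableT (@subsetT _ _) (measurable_cnormE mb)).
apply: ge0_le_integral_nonmeas => q _; first by rewrite lee_fin cnorm_ge0.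
by rewrite -EFinD lee_fin cnormD.
Qed.

Let AppL g : cmeas g -> (forall e : R, 0 < e -> exists g', App g' /\
  (L1norm hm setT (fun q => (g' q - g q)%R) <= e%:E)%E) -> App g.
Proof.
move=> mg hg; split => // e e0.
have e2 : 0 < e / 2 by rewrite divr_gt0.
have [g' [[mg' hg'] ge]] := hg _ e2; have [u [cu ue]] := hg' _ e2.
exists u; split => //.
rewrite (_ : (fun q => u q - g q) = (fun q => (u q - g' q) + (g' q - g q))); last first.
  by apply/funext => q; ring.
apply: (le_trans (L1normD measurableT (cmeasB (Cb_cmeas cu) mg') (cmeasB mg' mg))).
by rewrite (splitr e) EFinD; exact: leeD.
Qed.

Let AppD g1 g2 : App g1 -> App g2 -> App (fun q => g1 q + g2 q).
Proof.
move=> [m1 h1] [m2 h2]; split; first exact: cmeasD.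
move=> e e0; have e2 : 0 < e / 2 by rewrite divr_gt0.
have [u1 [c1 b1]] := h1 _ e2; have [u2 [c2 b2]] := h2 _ e2.
exists (fun q => u1 q + u2 q); split; first exact: CbD.
rewrite (_ : (fun q => _) = (fun q => (u1 q - g1 q) + (u2 q - g2 q))); last first.
  by apply/funext => q; ring.
apply: (le_trans (L1normD measurableT (cmeasB (Cb_cmeas c1) m1) (cmeasB (Cb_cmeas c2) m2))).
by rewrite (splitr e) EFinD; exact: leeD.
Qed.

Let AppZ c g : App g -> App (fun q => c * g q).
Proof.
move=> [m1 h1]; split; first exact: cmeasM (cmeas_cst _) m1.
move=> e e0; have c0 : 0 < 1 + cnorm c by rewrite ltr_pwDl ?cnorm_ge0.
have [u [cu b]] := h1 _ (divr_gt0 e0 c0).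
exists (fun q => c * u q); split; first exact: CbZ.
rewrite /L1norm; under eq_integral do rewrite -mulrBr cnormM EFinM.
rewrite ge0_integralZl //; last 3 first.
- by apply: measurable_cnormE; apply: cmeasB => //; exact: Cb_cmeas.
- by move=> q _; rewrite lee_fin cnorm_ge0.
- by rewrite lee_fin cnorm_ge0.
apply: (@le_trans _ _ ((cnorm c)%:E * (e / (1 + cnorm c))%:E)%E).
  by apply: lee_wpmul2l => //; rewrite lee_fin cnorm_ge0.
rewrite -EFinM lee_fin mulrCA ger_pMr // ler_pdivrMr // mul1r.
by rewrite lerDr.
Qed.

Let mx (d : heis R -> R) : hcont d -> measurable_fun setT (d : HH -> R).
Proof.
move=> cd; have [] // := @heis_cont_cmeas R (fun q => (d q)%:C) _.
move=> q; apply/cvgrPdist_lt => e e0.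
have eE : e = (complex.Re e)%:C.
  by move: e0; rewrite ltcE => /andP[/eqP ie _]; apply: complex_ext.
have r0 : 0 < complex.Re e by move: e0; rewrite eE ltcR.
have /cvgrPdist_lt/(_ _ r0) h1 := cd q.
apply: filterS h1 => p h1; rewrite normC_cnorm eE ltcR.
by rewrite (_ : _ - _ = (d q - d p)%:C) ?cnormR //; apply: complex_ext; rewrite /= ?subr0.
Qed.

(* The zero sets of continuous functions are a pi-system, and the indicator of
   a bounded one is a limit of C_c functions. *)
Let zeros : set (set HH) :=
  [set Z | exists d, [/\ hcont d, forall q, 0 <= d q & Z = [set q | d q = 0]]].

Let zerosI : setI_closed zeros.
Proof.
move=> A B [d [cd d0 ->]] [d' [cd' d0' ->]].
exists (fun q => d q + d' q); split; [exact: hcontD|by move=> q; rewrite addr_ge0|].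
apply/seteqP; split => q /=; first by move=> [-> ->]; rewrite addr0.
by move/eqP; rewrite paddr_eq0 // => /andP[/eqP -> /eqP ->].
Qed.

Let zeros_gen : @measurable _ HH = <<s zeros >>.
Proof.
apply/seteqP; split; last first.
  apply: smallest_sub; first exact: sigma_algebra_measurable.
  move=> Z [d [cd d0 ->]]; rewrite -[X in measurable X]setTI.
  exact: (mx cd measurableT (measurable_set1 0)).
pose S := g_sigma_algebraType zeros.
have coord (c : heis R -> R) : hcont c -> measurable_fun setT (c : S -> R).
  move=> cc; apply: (measurability _ (RGenCInfty.measurableE R)) => _ [_ [a ->] <-].
  (* The closed half-space c >= a is the zero set of twice the positive part of a - c. *)
  rewrite setTI; apply: sub_sigma_algebra; exists (fun q => `|a - c q| + (a - c q)); split.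
  - have h : hcont (fun q => a - c q).
      rewrite /hcont; under eq_fun do rewrite -mulN1r.
      by apply: hcontD; [exact: hcont_cst|apply: hcontM => //; exact: hcont_cst].
    by apply: hcontD => //; exact: hcont_norm.
  - by move=> q; have := ler_norm (- (a - c q)); rewrite normrN; lra.
  - apply/seteqP; split => q /=; rewrite in_itv /= andbT.
      by move=> h; rewrite ler0_norm; [ring|lra].
    by case: (lerP 0 (a - c q)) => h; [rewrite ger0_norm //; lra|lra].
have mid : measurable_fun setT (id : S -> HH).
  have -> : (id : S -> HH) = (fun q => (q.1.1, q.1.2, q.2)) by apply/funext => -[[x y] t].
  by apply: measurable_fun_pair; [apply: measurable_fun_pair|]; exact: coord.
by move=> A mA; have := mid measurableT A mA; rewrite setTI.
Qed.

Let box_int k : hm.-integrable setT (EFin \o (\1_(box k) : HH -> R)).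
Proof.
apply/integrableP; split.
  by apply/measurable_EFinP; exact: measurable_indic (measurable_box k).
rewrite (_ : (\int[hm]_q _ = \int[hm]_q (\1_(box k) q)%:E)%E); last first.
  by apply: eq_integral => q _ /=; rewrite ger0_norm.
by rewrite integral_indic ?setIT; [exact: box_finite|exact: measurableT|exact: measurable_box].
Qed.

(** Since |x| + x is twice the positive part of x, this is twice the total excess of the coordinates
    over m. It is continuous, vanishes exactly on [box m], and is at least 1 off [box m.+1]. *)
Let dbox (m : nat) (q : heis R) : R :=
  (`| `|q.1.1| - m%:R| + (`|q.1.1| - m%:R)) + (`| `|q.1.2| - m%:R| + (`|q.1.2| - m%:R))
  + (`| `|q.2| - m%:R| + (`|q.2| - m%:R)).

Let normD_ge0 (x : R) : 0 <= `|x| + x.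
Proof. by have := ler_norm (- x); rewrite normrN; lra. Qed.

Let dbox_ge0 m q : 0 <= dbox m q.
Proof. exact: (addr_ge0 (addr_ge0 (normD_ge0 _) (normD_ge0 _)) (normD_ge0 _)). Qed.

Let hcont_dbox m : hcont (dbox m).
Proof.
have h c : hcont c -> hcont (fun q => `| `|c q| - m%:R| + (`|c q| - m%:R)).
  move=> hc; have h' : hcont (fun q => `|c q| - m%:R).
    by apply: hcontD; [exact: hcont_norm|exact: hcont_cst].
  by apply: hcontD => //; exact: hcont_norm.
by apply: hcontD; [apply: hcontD|]; exact: h.
Qed.

Let boxE m (q : HH) : box m q <-> [/\ `|q.1.1| <= m%:R, `|q.1.2| <= m%:R & `|q.2| <= m%:R].
Proof.
rewrite /box /= !in_itv /= -!ler_norml; split; first by move=> [[]].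
by move=> [].
Qed.

Let dbox0 m q : dbox m q = 0 <-> box m q.
Proof.
have h (x : R) : `|x| + x = 0 <-> x <= 0.
  split=> h; first by rewrite leNgt; apply/negP => x0; move: h; rewrite gtr0_norm //; lra.
  by rewrite ler0_norm // addNr.
rewrite boxE; split.
  move/eqP; rewrite paddr_eq0 ?(addr_ge0 (normD_ge0 _) (normD_ge0 _)) // paddr_eq0 // => /andP[/andP[/eqP/h h1 /eqP/h h2] /eqP/h h3].
  by split; lra.
move=> [h1 h2 h3]; rewrite /dbox; have [-> [-> ->]] : `| `|q.1.1| - m%:R| + (`|q.1.1| - m%:R) = 0 /\
   `| `|q.1.2| - m%:R| + (`|q.1.2| - m%:R) = 0 /\ `| `|q.2| - m%:R| + (`|q.2| - m%:R) = 0.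
  by do 2?split; apply/h; lra.
by rewrite !addr0.
Qed.

Let dbox_gt1 m q : ~ box m.+1 q -> 1 <= dbox m q.
Proof.
move=> qn; rewrite leNgt; apply/negP => h; apply: qn; apply/boxE.
have h1 := normD_ge0 (`|q.1.1| - m%:R).
have h2 := normD_ge0 (`|q.1.2| - m%:R).
have h3 := normD_ge0 (`|q.2| - m%:R).
rewrite /dbox in h; have k1 := ler_norm (`|q.1.1| - m%:R).
have k2 := ler_norm (`|q.1.2| - m%:R).
have k3 := ler_norm (`|q.2| - m%:R).
rewrite -[m.+1]addn1 natrD; split; lra.
Qed.

Let App_zeros m Z : zeros Z -> App (cind (box m `&` Z)).
Proof.
move=> [d [cd d0 EZ]].
have mZ : measurable Z by rewrite zeros_gen; apply: sub_sigma_algebra; exists d.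
have mB : measurable (box m `&` Z) by apply: measurableI => //; exact: measurable_box.
have mi := cmeas_cind mB.
split; first exact: mi.
pose D q := d q + dbox m q.
have D0 q : 0 <= D q by rewrite addr_ge0.
have cD : hcont D by exact: hcontD.
(* The positive part u_k of s_k is 1 on the zero set of D, which is the part of Z in the box. It
   tends to 0 elsewhere, and it vanishes off [box m.+1] because D >= 1 there. *)
pose s k q := 1 - k.+1%:R * D q.
pose u k q : R := 2^-1 * (`|s k q| + s k q).
have s1 k q : s k q <= 1 by rewrite /s gerBl mulr_ge0.
have cu k : hcont (u k).
  have cs : hcont (s k).
    rewrite /hcont /s; under eq_fun do rewrite -mulNr.
    by apply: hcontD; [exact: hcont_cst|apply: hcontM => //; exact: hcont_cst].
  apply: hcontM; first exact: hcont_cst.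
  by apply: hcontD => //; exact: hcont_norm.
have u01 k q : 0 <= u k q <= 1.
  rewrite mulr_ge0 //= /u; case: (lerP 0 (s k q)) => h.
    by rewrite ger0_norm //; have := s1 k q; lra.
  by rewrite ltr0_norm //; lra.
have u0 k q : 1 <= k.+1%:R * D q -> u k q = 0.
  by move=> h; rewrite /u ler0_norm /s; [ring|lra].
have ub k q : ~ box m.+1 q -> u k q = 0.
  move=> /dbox_gt1 h; apply: u0.
  have h1 : 1 <= k.+1%:R :> R by rewrite ler1n.
  have h2 : 1 <= D q by rewrite /D; have := d0 q; lra.
  by rewrite -[leLHS](mulr1 1); apply: ler_pM.
have cb k : Cb (fun q => (u k q)%:C).
  split; [exact: cu|exact: hcont_cst|exists m.+1 => q qn].
  by rewrite ub.
have DE q : D q = 0 <-> (box m `&` Z) q.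
  rewrite EZ /D; split.
    by move/eqP; rewrite paddr_eq0 // => /andP[/eqP dq /eqP/dbox0].
  by move=> [/dbox0 -> /= ->]; rewrite addr0.
have ind1 k q : (box m `&` Z) q -> (u k q)%:C - cind (box m `&` Z) q = 0.
  move=> h; rewrite cindE // /u /s (DE q).2 // mulr0 subr0 normr1.
  by apply: complex_ext => /=; [field|ring].
have ind0 q : ~ (box m `&` Z) q -> forall k, (u k q)%:C - cind (box m `&` Z) q = (u k q)%:C.
  by move=> h k; rewrite cindN // subr0.
have lim : (fun k => \int[hm]_q (cnorm ((u k q)%:C - cind (box m `&` Z) q))%:E)%E @ \oo --> 0%E.
  apply: (@dominated_cvg0 R _ HH hm (fun k q => cnorm ((u k q)%:C - cind (box m `&` Z) q)) (\1_(box m.+1) : HH -> R)).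
  - by move=> k; apply: measurable_cnorm; apply: cmeasB => //; exact: (Cb_cmeas (cb k)).
  - move=> k q; apply/andP; split; first exact: cnorm_ge0.
    have [h|h] := pselect ((box m `&` Z) q); first by rewrite ind1 // cnorm0 indicE.
    rewrite ind0 // cnormR; case/andP: (u01 k q) => h1 h2; rewrite ger0_norm //.
    have [b|b] := pselect (box m.+1 q); first by rewrite indicE mem_set.
    by rewrite ub.
  - exact: box_int.
  - move=> q; have [h|h] := pselect ((box m `&` Z) q).
      rewrite (_ : (fun k => _) = fun=> 0); first exact: cvg_cst.
      by apply/funext => k; rewrite ind1 // cnorm0.
    have Dp : 0 < D q.
      by rewrite lt_neqAle D0 andbT eq_sym; apply/eqP => /DE.
    have c0 : (fun _ : nat => 0 : R) @ \oo --> (0 : R) by exact: cvg_cst.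
    apply: cvg_trans c0; apply: near_eq_cvg.
    apply: filterS (nbhs_infty_ger (D q)^-1) => k kD.
    rewrite ind0 // u0 ?cnorm0 //.
    by rewrite -ler_pdivrMr // mul1r (le_trans kD) // ler_nat leqnSn.
move=> e e0; have [k _ /(_ k (leqnn k)) hk] := ecvg0_lt lim e0.
by exists (fun q => (u k q)%:C); split => //; exact: ltW.
Qed.

Let App0 : App (fun=> 0).
Proof.
split=> [|e e0]; first exact: cmeas_cst.
exists (fun=> 0); split; first by split; [exact: hcont_cst|exact: hcont_cst|exists 0%N].
by rewrite /L1norm; under eq_integral do rewrite subr0 cnorm0; rewrite integral0 lee_fin ltW.
Qed.

Let App_sum (I : eqType) (l : seq I) (g : I -> HH -> R[i]) : (forall i, App (g i)) ->
  App (fun q => \sum_(i <- l) g i q).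
Proof.
move=> hg; elim: l => [|i l IH]; first by under eq_fun do rewrite big_nil.
by under eq_fun do rewrite big_cons; exact: AppD.
Qed.

Let AppB g1 g2 : App g1 -> App g2 -> App (fun q => g1 q - g2 q).
Proof.
move=> h1 h2; have := AppD h1 (AppZ (-1) h2).
by under eq_fun do rewrite mulN1r.
Qed.

Let App_dom (g : HH -> R[i]) (G : HH -> R) (h : nat -> HH -> R[i]) : cmeas g ->
  (forall k, App (h k)) -> (forall k q, cnorm (h k q - g q) <= G q) ->
  hm.-integrable setT (EFin \o G) ->
  (forall q, (fun k => cnorm (h k q - g q)) @ \oo --> (0 : R)) -> App g.
Proof.
move=> mg Ah hG iG hc; apply: AppL => // e e0.
have lim : (fun k => \int[hm]_q (cnorm (h k q - g q))%:E)%E @ \oo --> 0%E.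
  apply: (@dominated_cvg0 R _ HH hm (fun k q => cnorm (h k q - g q)) G) => //.
    by move=> k; apply: measurable_cnorm; apply: cmeasB => //; case: (Ah k).
  by move=> k q; apply/andP; split; [exact: cnorm_ge0|exact: hG].
have [k _ /(_ k (leqnn k)) hk] := ecvg0_lt lim e0.
by exists (h k); split => //; exact: ltW.
Qed.

(** Dynkin's pi-lambda theorem. Cutting by a box makes the indicators integrable: complements are
    differences within the box, and partial sums of a disjoint union stay within 1 of the limit on
    the box. *)
Let App_measurable m (A : set HH) : measurable A -> App (cind (box m `&` A)).
Proof.
move=> mA; have := mA; rewrite zeros_gen.
apply: (@dynkin_induction _ HH zeros (fun A => App (cind (box m `&` A)))).
- exact: zeros_gen.
- exact: zerosI.
- apply: App_zeros; exists (fun=> 0); split; [exact: hcont_cst|by []|].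
  by apply/seteqP; split.
- by move=> Z; exact: App_zeros.
- move=> S mS AS; have AT : App (cind (box m `&` setT)).
    apply: App_zeros; exists (fun=> 0); split; [exact: hcont_cst|by []|].
    by apply/seteqP; split.
  have := AppB AT AS; congr App; apply/funext => q.
  have [b|b] := pselect (box m q); last by rewrite !cindN ?subr0 //; case.
  have [s|s] := pselect (S q).
    by rewrite cindE // cindE // cindN ?subrr //; case.
  by rewrite cindE // cindN ?cindE ?subr0 //; case.
- move=> F mF tF AF.
  pose h n q : R[i] := \sum_(i <- iota 0 n) cind (box m `&` F i) q.
  have hE j q : box m q -> F j q -> forall n, h n q = if (j < n)%N then 1 else 0.
    move=> bq Fj n; rewrite /h.
    have o i : i != j -> cind (box m `&` F i) q = 0.
      move=> ij; rewrite cindN // => -[_ Fi]; move/negP: ij; apply; apply/eqP.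
      by apply: (tF i j) => //; exists q.
    case: ifP => jn.
      rewrite (bigD1_seq j) /= ?iota_uniq ?mem_iota //.
      rewrite big1 ?addr0 ?cindE // => i ij; exact: o.
    rewrite big_seq big1 // => i; rewrite mem_iota /= => ik; apply: o.
    by apply/eqP => ij; move: ik; rewrite ij add0n jn.
  have hN q : ~ (box m `&` \bigcup_k F k) q -> forall n, h n q = 0.
    move=> qn n; rewrite /h big1_seq // => i _; rewrite cindN // => -[bq Fi].
    by apply: qn; split => //; exists i.
  apply: (@App_dom _ (\1_(box m)) h).
  + by apply: cmeas_cind; apply: measurableI; [exact: measurable_box|exact: bigcup_measurable].
  + by move=> k; exact: App_sum.
  + move=> k q; have [[bq [j _ Fj]]|qn] := pselect ((box m `&` \bigcup_k F k) q).
      rewrite (hE j) // cindE; last by split => //; exists j.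
      rewrite indicE mem_set //=; case: ifP => _; rewrite ?subrr ?cnorm0 //.
      by rewrite sub0r cnormN cnorm1.
    by rewrite hN // cindN // subrr cnorm0 indicE.
  + exact: box_int.
  + move=> q; have c0 : (fun _ : nat => 0 : R) @ \oo --> (0 : R) by exact: cvg_cst.
    apply: cvg_trans c0; apply: near_eq_cvg.
    have [[bq [j _ Fj]]|qn] := pselect ((box m `&` \bigcup_k F k) q); last first.
      by apply: nearW => k; rewrite hN // cindN // subrr cnorm0.
    exists j.+1 => // k /= jk; rewrite (hE j) // jk cindE ?subrr ?cnorm0 //.
    by split => //; exists j.
Qed.

(** Restricted to [box k], finitely valued approximants of f are combinations of indicators already
    treated, and they converge to f dominated by 3 |f|. *)
Lemma Cc_dense (f : HH -> R[i]) : cintegrable hm setT f ->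
  exists u : nat -> heis R -> R[i], (forall k, Cc (u k)) /\
    (fun k => L1norm hm setT (u k \- f)) @ \oo --> 0%E.
Proof.
move=> fi; have mf := cintegrable_cmeas fi.
have Af : App f.
  have [gu [mu' fu cu bu]] := finite_approx mf.1.
  have [gv [mv fv cv bv]] := finite_approx mf.2.
  pose sg k q := (gu k q, gv k q).
  have fsg k : finite_set (range (sg k)).
    apply: (@sub_finite_set _ _ (range (gu k) `*` range (gv k))).
      by move=> _ [q _ <-]; split; exists q.
    exact: finite_setX.
  have lst k : {l : seq (R * R) | uniq l /\ forall q, sg k q \in l}.
    apply: cid; have [l hl] := (finite_seqP _).1 (fsg k).
    exists (undup l); rewrite undup_uniq; split => // q; rewrite mem_undup.
    have : range (sg k) (sg k q) by exists q.
    by rewrite hl.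
  pose h k q : R[i] := \sum_(c <- projT1 (lst k)) (c.1 +i* c.2) * cind (box k `&` (sg k @^-1` [set c])) q.
  have hE k q : h k q = cind (box k) q * (gu k q +i* gv k q).
    rewrite /h; have [ul ql] := projT2 (lst k).
    have [b|b] := pselect (box k q); last first.
      by rewrite (cindN b) mul0r big1 // => c _; rewrite cindN ?mulr0 //; case.
    rewrite (bigD1_seq (sg k q)) //= big1 ?addr0; last first.
      move=> c cq; rewrite cindN ?mulr0 // => -[_ /= qc]; by rewrite qc eqxx in cq.
    by rewrite !cindE // mulr1 mul1r.
  have nf k q : cnorm (gu k q +i* gv k q) <= 2 * cnorm (f q).
    apply: (le_trans (cnorm_le _)) => /=.
    have := le_trans (bu k q) (normRe_le (f q)); have := le_trans (bv k q) (normIm_le (f q)).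
    by lra.
  apply: (@App_dom _ (fun q => 3 * cnorm (f q)) h) => //.
  - move=> k; apply: App_sum => c; apply: AppZ; apply: App_measurable.
    rewrite (_ : _ @^-1` _ = gu k @^-1` [set c.1] `&` gv k @^-1` [set c.2]).
      by apply: measurableI; rewrite -[X in measurable X]setTI;
        [apply: (mu' k)|apply: (mv k)] => //; exact: measurable_set1.
    apply/seteqP; split => q /=; first by move=> <-.
    by case: c => a b /= [<- <-].
  - move=> k q; rewrite hE; apply: (le_trans (cnormB _ _)); rewrite cnormM.
    have := nf k q; have := cnorm_ge0 (gu k q +i* gv k q).
    have : cnorm (cind (box k) q : R[i]) * cnorm (gu k q +i* gv k q) <= 1 * cnorm (gu k q +i* gv k q).
      by rewrite ler_wpM2r ?cnorm_ge0 // cnorm_cind_le1.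
    by lra.
  - rewrite /comp; under eq_fun do rewrite EFinM; apply: integrableZl => //.
    exact: cintegrable_norm.
  - move=> q; have c : (fun k => cnorm ((gu k q +i* gv k q) - f q)) @ \oo --> (0 : R).
      by apply: ccvg_cnorm; split => /=; [exact: cu|exact: cv].
    apply: cvg_trans c; apply: near_eq_cvg.
    apply: filterS (box_eventually q) => k bq.
    by rewrite hE cindE // mul1r.
have [_ hf] := Af.
have pos (k : nat) : 0 < (k.+1%:R^-1 : R) by rewrite invr_gt0.
have w k := cid (hf _ (pos k)).
exists (fun k => projT1 (w k)); split; first by move=> k; apply: CbC; case: (projT2 (w k)).
apply: (ecvg0_le (v := fun k => (k.+1%:R^-1)%:E)).
  move=> k; apply/andP; split; last by have [_] := projT2 (w k).
  by apply: integral_ge0 => q _; rewrite lee_fin cnorm_ge0.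
apply: cvg_EFin; first exact: nearW.
exact: cvg_harmonic.
Qed.

End CcDense.

(** * Periodization and unfolding *)

Section Periodize.
Context {R : realType}.
Notation leb := (@lebesgue_measure R).
Variable P : R.
Hypothesis P0 : 0 < P.

(* The terms of the sum over Z of the translates of u, enumerated by nat. *)
Definition translate (u : R -> \bar R) (i : nat) (x : R) : \bar R :=
  if pickle_inv i is Some k then u (x + (k : int)%:~R * P) else 0%E.

Let I : set R := `[0, P[%classic.
Let mI : measurable I. Proof. exact: measurable_itv. Qed.

(** The indicators of the translates of [0, P[ sum to 1; inserting this sum and translating each
    term back to [0, P[ gives the formula. *)
Lemma integral_periodize (u : R -> \bar R) :
  measurable_fun (setT : set (measurableTypeR R)) u -> (forall x, 0 <= u x)%E ->
  (\int[leb]_x u x = \int[leb]_x ((\1_I x)%:E * \sum_(i <oo) translate u i x))%E.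
Proof.
move=> mu u0.
have mi (k : int) : measurable_fun setT (fun x : measurableTypeR R => (\1_I (x - k%:~R * P))%:E).
  apply/measurable_EFinP; apply: (measurableT_comp (measurable_indic mI)).
  by apply: measurable_funB => //; exact: measurable_cst.
have i0 x : (0 <= (\1_I x)%:E :> \bar R)%E by rewrite lee_fin.
pose c i (x : R) : \bar R := if pickle_inv i is Some k then (\1_I (x - (k : int)%:~R * P))%:E else 0%E.
have c0 i x : (0 <= c i x)%E by rewrite /c; case: pickle_inv => [k|//].
have mt i : measurable_fun (setT : set (measurableTypeR R)) (translate u i).
  rewrite /translate; case: pickle_inv => [k|]; last exact: measurable_cst.
  exact: (measurableT_comp mu (measurable_addr _)).
have t0 i x : (0 <= translate u i x)%E by rewrite /translate; case: pickle_inv => [k|//].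
have mc i : measurable_fun (setT : set (measurableTypeR R)) (c i).
  by rewrite /c; case: pickle_inv => [k|]; [exact: mi|exact: measurable_cst].
have mJ : measurable_fun (setT : set (measurableTypeR R)) (fun x => (\1_I x)%:E : \bar R).
  by apply/measurable_EFinP; exact: measurable_indic.
have hfl x : exists k : int, I (x - k%:~R * P).
  exists (Num.floor (x / P)); rewrite /I /= in_itv /=.
  have := ge_floor (x / P); have := lt_succ_floor (x / P).
  rewrite ltr_pdivrMr // ler_pdivlMr // rmorphD /= mulrDl mul1r.
  by move=> h1 h2; apply/andP; split; lra.
have uniq x (k l : int) : I (x - k%:~R * P) -> I (x - l%:~R * P) -> k = l.
  rewrite /I /= !in_itv /= => /andP[h1 h2] /andP[h3 h4].
  have a1 : (k%:~R < (l + 1)%:~R :> R) by rewrite rmorphD /= -(ltr_pM2r P0) mulrDl mul1r; lra.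
  have a2 : (l%:~R < (k + 1)%:~R :> R) by rewrite rmorphD /= -(ltr_pM2r P0) mulrDl mul1r; lra.
  by apply/le_anti; rewrite -!ltzD1 -!(ltr_int R) a1 a2.
have cu x : (\sum_(i <oo) (c i x * u x) = u x)%E.
  have [k Ik] := hfl x.
  have E i : (c i x * u x = if i == pickle k then u x else 0)%E.
    rewrite /c; case: eqP => [->|ne]; first by rewrite pickleK_inv indicE mem_set // mul1e.
    case e : (pickle_inv i) => [l|]; last by rewrite mul0e.
    rewrite indicE memNset ?mul0e // => Il; apply: ne.
    have lk := uniq _ _ _ Il Ik; move: e; rewrite lk => e.
    by have := @pickle_invK int i; rewrite e.
  rewrite (@nneseriesD1 _ _ (pickle k)) //; last by move=> i _; rewrite mule_ge0.
  rewrite E eqxx eseries0 ?adde0 // => i _ /= ik; by rewrite E (negbTE ik).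
transitivity (\sum_(i <oo) \int[leb]_x (c i x * u x))%E.
  rewrite -integral_nneseries //; last 2 first.
  - by move=> i; exact: emeasurable_funM.
  - by move=> i x _; exact: mule_ge0.
  by apply: eq_integral => x _; rewrite cu.
transitivity (\sum_(i <oo) \int[leb]_x ((\1_I x)%:E * translate u i x))%E; last first.
  rewrite -integral_nneseries //; last 2 first.
  - by move=> i; exact: emeasurable_funM.
  - by move=> i x _; exact: mule_ge0.
  by apply: eq_integral => x _; rewrite nneseriesZl.
apply: eq_eseriesr => i _; rewrite /c /translate; case: pickle_inv => [k|]; last first.
  by under eq_integral do rewrite mul0e; under [RHS]eq_integral do rewrite mule0.
have [_ h] := mpres_addr (k%:~R * P).
rewrite -(h (fun x => (\1_I (x - k%:~R * P))%:E * u x)%E).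
- by apply: eq_integral => x _; rewrite addrK.
- exact: emeasurable_funM.
- by move=> x; exact: mule_ge0.
Qed.

End Periodize.

Section Unfolding.
Context {R : realType}.
Notation leb := (@lebesgue_measure R).
Notation HH := (measurableTypeR R * measurableTypeR R * measurableTypeR R)%type.
Notation hm := (sfprod (sfprod leb leb) leb).
Variables L P : R.
Hypotheses (L0 : 0 < L) (P0 : 0 < P).

Let I : set R := `[0, L[%classic.
Let K : set R := `[0, P[%classic.

(** By hypothesis the sum of Q over translates of s by multiples of L equals its sum G over
    translates of t by multiples of P. Periodizing in s on the left and in t on the right makes both
    sides the integral of 1_K 1_I G. *)
Lemma unfold_ge0 (Q : measurableTypeR R * HH -> \bar R) : measurable_fun setT Q ->
  (forall p, 0 <= Q p)%E ->
  (forall s (q : HH), Q (s + L, q) = Q (s, (q.1, q.2 + P))) ->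
  (\int[leb \x hm]_p ((\1_K p.2.2)%:E * Q p) = \int[leb \x hm]_p ((\1_I p.1)%:E * Q p))%E.
Proof.
move=> mQ Q0 hQ.
have mI : measurable I by exact: measurable_itv.
have mK : measurable K by exact: measurable_itv.
have mIp : measurable_fun setT (fun p : measurableTypeR R * HH => (\1_I p.1)%:E : \bar R).
  apply/measurable_EFinP; exact: (measurableT_comp (measurable_indic mI) (@measurable_fst _ _ _ _)).
have mKq : measurable_fun setT (fun q : HH => (\1_K q.2)%:E : \bar R).
  apply/measurable_EFinP; exact: (measurableT_comp (measurable_indic mK) (@measurable_snd _ _ _ _)).
have mKp : measurable_fun setT (fun p : measurableTypeR R * HH => (\1_K p.2.2)%:E : \bar R).
  exact: (measurableT_comp mKq (@measurable_snd _ _ _ _)).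
have mIs : measurable_fun setT (fun s : measurableTypeR R => (\1_I s)%:E : \bar R).
  by apply/measurable_EFinP; exact: measurable_indic.
have mKs : measurable_fun setT (fun s : measurableTypeR R => (\1_K s)%:E : \bar R).
  by apply/measurable_EFinP; exact: measurable_indic.
have i0 (A : set R) x : (0 <= (\1_A x)%:E :> \bar R)%E by rewrite lee_fin.
have hn (n : nat) s (q : HH) : Q (s + n%:R * L, q) = Q (s, (q.1, q.2 + n%:R * P)).
  elim: n s q => [|n IH] s q; first by rewrite !mul0r !addr0; case: q.
  have -> : s + n.+1%:R * L = (s + n%:R * L) + L by rewrite -natr1; ring.
  by rewrite hQ IH /=; congr (Q (_, (_, _))); rewrite -natr1; ring.
have hz (k : int) s (q : HH) : Q (s + k%:~R * L, q) = Q (s, (q.1, q.2 + k%:~R * P)).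
  case: k => n; first exact: hn.
  rewrite NegzE !mulrNz -!pmulrn; symmetry.
  have := hn n.+1 (s + - n.+1%:R * L) (q.1, q.2 + - n.+1%:R * P); rewrite /=.
  have -> : s + - n.+1%:R * L + n.+1%:R * L = s by ring.
  have -> : q.2 + - n.+1%:R * P + n.+1%:R * P = q.2 by ring.
  by move=> ->; case: q.
pose G (p : measurableTypeR R * HH) := (\sum_(i <oo) translate L (fun s => Q (s, p.2)) i p.1)%E.
have tr i s (q : HH) : translate L (fun s => Q (s, q)) i s = translate P (fun t => Q (s, (q.1, t))) i q.2.
  by rewrite /translate; case: pickle_inv => // k; exact: hz.
have G0 p : (0 <= G p)%E.
  by apply: nneseries_ge0 => i _ _; rewrite /translate; case: pickle_inv.
have mG : measurable_fun setT G.
  apply: (@ge0_emeasurable_sum _ _ _ _ (fun i p => translate L (fun s => Q (s, p.2)) i p.1) predT).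
    by move=> i p _ _; rewrite /translate; case: pickle_inv.
  move=> i _; rewrite /translate; case: pickle_inv => [k|]; last exact: measurable_cst.
  apply: (measurableT_comp mQ); apply: measurable_fun_pair; last exact: measurable_snd.
  exact: (measurableT_comp (measurable_addr _) (@measurable_fst _ _ _ _)).
have mQs q : measurable_fun (setT : set (measurableTypeR R)) (fun s => Q (s, q)).
  by apply: (measurableT_comp mQ); exact: measurable_fun_pair.
have mQq s : measurable_fun (setT : set HH) (fun q => Q (s, q)).
  by apply: (measurableT_comp mQ); exact: measurable_fun_pair.
have mGs q : measurable_fun (setT : set (measurableTypeR R)) (fun s => G (s, q)).
  by apply: (measurableT_comp mG); exact: measurable_fun_pair.
have mGq s : measurable_fun (setT : set HH) (fun q => G (s, q)).
  by apply: (measurableT_comp mG); exact: measurable_fun_pair.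
pose E (p : measurableTypeR R * HH) : \bar R := ((\1_K p.2.2)%:E * ((\1_I p.1)%:E * G p))%E.
have mE : measurable_fun setT E by exact: (emeasurable_funM mKp (emeasurable_funM mIp mG)).
have E0 p : (0 <= E p)%E by rewrite /E !mule_ge0.
transitivity (\int[leb \x hm]_p E p)%E.
  rewrite fubini_tonelli2 //; last 2 first.
  - exact: emeasurable_funM.
  - by move=> p; exact: mule_ge0.
  rewrite (fubini_tonelli2 E mE E0).
  apply: eq_integral => q _; rewrite /fubini_G /E /=.
  rewrite ge0_integralZl //.
  rewrite ge0_integralZl //; last 2 first.
  - exact: emeasurable_funM.
  - by move=> s _; exact: mule_ge0.
  by congr (_ * _)%E; exact: (integral_periodize L0).
rewrite (fubini_tonelli1 E mE E0).
pose B (p : measurableTypeR R * HH) : \bar R := ((\1_I p.1)%:E * Q p)%E.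
have mB : measurable_fun setT B by exact: (emeasurable_funM mIp mQ).
have B0 p : (0 <= B p)%E by rewrite /B mule_ge0.
rewrite -/B (fubini_tonelli1 B mB B0).
apply: eq_integral => s _; rewrite /fubini_F /E /B /=.
under eq_integral do rewrite muleCA.
rewrite ge0_integralZl //; last 2 first.
- exact: emeasurable_funM.
- by move=> q _; exact: mule_ge0.
rewrite ge0_integralZl //; congr (_ * _)%E.
rewrite (@fubini_tonelli1 _ _ _ _ _ (sfprod leb leb) leb (fun q => (\1_K q.2)%:E * G (s, q))%E); last 2 first.
- exact: emeasurable_funM.
- by move=> p; exact: mule_ge0.
rewrite (@fubini_tonelli1 _ _ _ _ _ (sfprod leb leb) leb (fun q => Q (s, q))%E) //.
apply: eq_integral => z _; rewrite /fubini_F /=.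
rewrite [RHS](integral_periodize P0) //; last by apply: (measurableT_comp (mQq s)); exact: measurable_fun_pair.
apply: eq_integral => t _; congr (_ * _)%E.
by apply: eq_eseriesr => i _; exact: tr.
Qed.

Lemma unfold_cintegral (Q : measurableTypeR R * HH -> R[i]) : cmeas Q ->
  (forall s (q : HH), Q (s + L, q) = Q (s, (q.1, q.2 + P))) ->
  cintegral (leb \x hm)%E setT (fun p => (\1_K p.2.2)%:C * Q p)
  = cintegral (leb \x hm)%E setT (fun p => (\1_I p.1)%:C * Q p).
Proof.
move=> mQ hQ; apply: cintegral_transfer => u u0 uz mu.
have ui (A : set R) x z : (u ((\1_A x)%:C * z))%:E = ((\1_A x)%:E * (u z)%:E)%E.
  by rewrite indicE; case: (_ \in _); rewrite ?mul1r ?mul1e // mul0r mul0e uz.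
under eq_integral do rewrite ui; under [RHS]eq_integral do rewrite ui.
apply: (unfold_ge0 (Q := fun p => (u (Q p))%:E)).
- by apply/measurable_EFinP; exact: mu.
- by move=> p; rewrite lee_fin.
- by move=> s q; rewrite hQ.
Qed.

End Unfolding.

Lemma cnorm_dist3 {R : realType} (a b c : R[i]) : cnorm (b - c) <= cnorm (a - b) + cnorm (a - c).
Proof.
have -> : b - c = - (a - b) + (a - c) by ring.
by apply: (le_trans (cnormD _ _)); rewrite cnormN.
Qed.

(** * Helix integrals and the X-ray transform *)

Section Helix.
Context {R : realType}.
Notation leb := (@lebesgue_measure R).
Notation HH := (measurableTypeR R * measurableTypeR R * measurableTypeR R)%type.
Notation hm := (sfprod (sfprod leb leb) leb).
Variable lambda : R.
Hypothesis l0 : 0 < lambda.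

(** [L] is the parameter length of one turn of the helix, and [P] the height gained in that turn,
    which generates Gamma_lambda. *)
Let L := 2 * pi / lambda.
Let P := pi * lambda^-1 ^+ 2.
Let I : set R := `[0, L[%classic.
Let K : set R := `[0, P[%classic.
Let D : set HH := fund_domain lambda.

Let L0 : 0 < L. Proof. by rewrite divr_gt0 // mulr_gt0 // pi_gt0. Qed.
Let P0 : 0 < P. Proof. by rewrite mulr_gt0 ?pi_gt0 // exprn_gt0 // invr_gt0. Qed.
Let mI : measurable I. Proof. exact: measurable_itv. Qed.
Let mK : measurable K. Proof. exact: measurable_itv. Qed.

Let lebI : leb I = L%:E.
Proof. by rewrite lebesgue_measure_itv /= lte_fin L0 sube0. Qed.

Let DE : D = [set q : HH | K q.2].
Proof. by apply/seteqP; split => q; rewrite /D /fund_domain /K /= in_itv. Qed.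

Lemma measurable_fund_domain : measurable D.
Proof.
have h : measurable_fun setT (fun q : HH => q.2) by exact: measurable_snd.
by rewrite DE -[X in measurable X]setTI; exact: (h measurableT K mK).
Qed.
Let mD := measurable_fund_domain.

Let cindD (q : HH) : cind D q = (\1_K q.2)%:C :> R[i].
Proof. by rewrite /cind DE !indicE; congr (_%:R%:C); apply/idP/idP; rewrite !inE. Qed.

Lemma gamma_periodic s : gamma lambda (s + L) = ((gamma lambda s).1, (gamma lambda s).2 + P).
Proof.
have ln0 : lambda != 0 by rewrite gt_eqF.
rewrite /gamma; have -> : (s + L) / lambda^-1 = s / lambda^-1 + pi *+ 2.
  by rewrite /L invrK mulrDl divfK // [2 * pi]mulr_natl.
rewrite cosD2pi sinD2pi /=; congr (_, _, _).
by rewrite /L /P; field.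
Qed.

Let hmul_shift (q : heis R) s : hmul q (gamma lambda (s + L)) = hmul (q.1, q.2 + P) (gamma lambda s).
Proof. by rewrite gamma_periodic /hmul /=; congr (_, _, _); ring. Qed.

Let measurable_gamma : measurable_fun (setT : set (measurableTypeR R)) (gamma lambda : _ -> HH).
Proof.
have ms : measurable_fun setT (fun s : measurableTypeR R => s / lambda^-1).
  by apply: measurable_funM => //; exact: measurable_cst.
apply: measurable_fun_pair; [apply: measurable_fun_pair|].
- apply: measurable_funM; first exact: measurable_cst.
  exact: (measurableT_comp (continuous_measurable_fun (@continuous_cos R)) ms).
- apply: measurable_funM; first exact: measurable_cst.
  exact: (measurableT_comp (continuous_measurable_fun (@continuous_sin R)) ms).
- apply: measurable_funM; last exact: measurable_cst.
  by apply: measurable_funM => //; exact: measurable_cst.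
Qed.

Lemma measurable_hmul d (S : measurableType d) (a b : S -> HH) :
  measurable_fun setT a -> measurable_fun setT b ->
  measurable_fun setT (fun x => hmul (a x) (b x) : HH).
Proof.
move=> ma mb.
have f1 := measurableT_comp (@measurable_fst _ _ (measurableTypeR R) (measurableTypeR R)) (@measurable_fst _ _ (measurableTypeR R * measurableTypeR R)%type (measurableTypeR R)).
have f2 := measurableT_comp (@measurable_snd _ _ (measurableTypeR R) (measurableTypeR R)) (@measurable_fst _ _ (measurableTypeR R * measurableTypeR R)%type (measurableTypeR R)).
have f3 := (@measurable_snd _ _ (measurableTypeR R * measurableTypeR R)%type (measurableTypeR R)).
have a1 := measurableT_comp f1 ma; have a2 := measurableT_comp f2 ma; have a3 := measurableT_comp f3 ma.
have b1 := measurableT_comp f1 mb; have b2 := measurableT_comp f2 mb; have b3 := measurableT_comp f3 mb.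
apply: measurable_fun_pair; [apply: measurable_fun_pair|].
- exact: (measurable_funD a1 b1).
- exact: (measurable_funD a2 b2).
- apply: measurable_funD; first exact: (measurable_funD a3 b3).
  apply: measurable_funM; first exact: measurable_cst.
  exact: (measurable_funB (measurable_funM a1 b2) (measurable_funM a2 b1)).
Qed.

Let measurable_helix : measurable_fun setT
  (fun p : measurableTypeR R * HH => hmul p.2 (gamma lambda p.1) : HH).
Proof.
apply: measurable_hmul; first exact: measurable_snd.
exact: (measurableT_comp measurable_gamma (@measurable_fst _ _ _ _)).
Qed.

(** After unfolding, s ranges over one turn and q over the whole group, where right translation by
    gamma(s) preserves the norm of f. The constant is therefore the length of one turn. *)
Lemma helix_norm (f : HH -> R[i]) : cmeas f ->
  (\int[hm]_(q in D) \int[leb]_s (cnorm (f (hmul q (gamma lambda s))))%:E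
     = L%:E * L1norm hm setT f /\
   (\int[leb \x hm]_p ((\1_K p.2.2)%:E * (cnorm (f (hmul p.2 (gamma lambda p.1))))%:E)
     = L%:E * L1norm hm setT f /\
    \int[leb \x hm]_p ((\1_I p.1)%:E * (cnorm (f (hmul p.2 (gamma lambda p.1))))%:E)
     = L%:E * L1norm hm setT f))%E.
Proof.
move=> mf; pose Q (p : measurableTypeR R * HH) : \bar R := (cnorm (f (hmul p.2 (gamma lambda p.1))))%:E.
have mQ : measurable_fun setT Q by exact: (measurable_cnormE (cmeas_comp mf measurable_helix)).
have Q0 p : (0 <= Q p)%E by rewrite lee_fin cnorm_ge0.
have hQ s (q : HH) : Q (s + L, q) = Q (s, (q.1, q.2 + P)) by rewrite /Q /= hmul_shift.
have := unfold_ge0 L0 P0 mQ Q0 hQ.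
pose B1 (p : measurableTypeR R * HH) : \bar R := ((\1_K p.2.2)%:E * Q p)%E.
pose B2 (p : measurableTypeR R * HH) : \bar R := ((\1_I p.1)%:E * Q p)%E.
have mB1 : measurable_fun setT B1.
  apply: emeasurable_funM => //; apply/measurable_EFinP.
  apply: (measurableT_comp (measurable_indic mK)).
  exact: (measurableT_comp (@measurable_snd _ _ _ _) (@measurable_snd _ _ _ _)).
have mB2 : measurable_fun setT B2.
  apply: emeasurable_funM => //; apply/measurable_EFinP.
  exact: (measurableT_comp (measurable_indic mI) (@measurable_fst _ _ _ _)).
have B10 p : (0 <= B1 p)%E by rewrite mule_ge0 // lee_fin.
have B20 p : (0 <= B2 p)%E by rewrite mule_ge0 // lee_fin.
rewrite -/B1 -/B2 => E.
have mQs q : measurable_fun (setT : set (measurableTypeR R)) (fun s => Q (s, q)).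
  by apply: (measurableT_comp mQ); exact: measurable_fun_pair.
have mQq s : measurable_fun (setT : set HH) (fun q => Q (s, q)).
  by apply: (measurableT_comp mQ); exact: measurable_fun_pair.
have i0 (A : set R) x : (0 <= (\1_A x)%:E :> \bar R)%E by rewrite lee_fin.
have N0 : (0 <= L1norm hm setT f)%E by apply: integral_ge0 => q _; rewrite lee_fin cnorm_ge0.
have mIs : measurable_fun (setT : set (measurableTypeR R)) (fun s => (\1_I s)%:E : \bar R).
  by apply/measurable_EFinP; exact: measurable_indic.
have EQ s : (\int[hm]_q Q (s, q) = L1norm hm setT f)%E.
  have [_ h] := mpres_hmulr (gamma lambda s).
  apply: (h (fun q => (cnorm (f q))%:E)); first exact: measurable_cnormE.
  by move=> q; rewrite lee_fin cnorm_ge0.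
have E2 : (\int[leb \x hm]_p B2 p = L%:E * L1norm hm setT f)%E.
  rewrite (fubini_tonelli1 B2 mB2 B20); transitivity (\int[leb]_s ((\1_I s)%:E * L1norm hm setT f))%E.
    apply: eq_integral => s _; rewrite /fubini_F /B2 /=.
    by rewrite (ge0_integralZl hm measurableT (mQq s) (fun q _ => Q0 (s, q)) (i0 I s)) EQ.
  rewrite (ge0_integralZr leb measurableT mIs (fun s _ => i0 I s) N0).
  rewrite integral_indic // setIT; congr (_ * _)%E; exact: lebI.

split; last by rewrite -E2.
rewrite -E2 -E (fubini_tonelli2 B1 mB1 B10).
rewrite integral_mkcond; apply: eq_integral => q _; rewrite /fubini_G /B1 /= patchE.
rewrite (ge0_integralZl leb measurableT (mQs q) (fun s _ => Q0 (s, q))); last by rewrite lee_fin.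
rewrite DE indicE; have [Kq|Kq] := pselect (K q.2).
  by rewrite !mem_set //= mul1e.
by rewrite !memNset //= mul0e.
Qed.

Let mfp (f : HH -> R[i]) : cmeas f ->
  cmeas (fun p : measurableTypeR R * HH => f (hmul p.2 (gamma lambda p.1))).
Proof. by move=> mf; exact: (cmeas_comp mf measurable_helix). Qed.

Lemma helix_cintegrable (f w : HH -> R[i]) (C : R) : cintegrable hm setT f -> cmeas w ->
  (forall q, cnorm (w q) <= C) ->
  cintegrable (leb \x hm)%E setT (fun p : measurableTypeR R * HH =>
    (\1_K p.2.2)%:C * (f (hmul p.2 (gamma lambda p.1)) * w p.2)) /\
  cintegrable (leb \x hm)%E setT (fun p : measurableTypeR R * HH =>
    (\1_I p.1)%:C * (f (hmul p.2 (gamma lambda p.1)) * w p.2)).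
Proof.
move=> fi mw wC; have [mf ff] := (cintegrableP _ _).1 fi.
have C0 : 0 <= C by apply: le_trans (cnorm_ge0 _) (wC (0, 0, 0)).
have [_ [e1 e2]] := helix_norm mf.
have mwp : cmeas (fun p : measurableTypeR R * HH => w p.2).
  exact: (cmeas_comp mw (@measurable_snd _ _ _ _)).
have mx : measurable_fun setT (fun p : measurableTypeR R * HH => (\1_K p.2.2) : R).
  apply: (measurableT_comp (measurable_indic mK)).
  exact: (measurableT_comp (@measurable_snd _ _ _ _) (@measurable_snd _ _ _ _)).
have my : measurable_fun setT (fun p : measurableTypeR R * HH => (\1_I p.1) : R).
  exact: (measurableT_comp (measurable_indic mI) (@measurable_fst _ _ _ _)).
have key (a : measurableTypeR R * HH -> R) : measurable_fun setT a -> (forall p, 0 <= a p) ->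
    (\int[leb \x hm]_p ((a p)%:E * (cnorm (f (hmul p.2 (gamma lambda p.1))))%:E)
     = L%:E * L1norm hm setT f)%E ->
    cintegrable (leb \x hm)%E setT (fun p : measurableTypeR R * HH =>
      (a p)%:C * (f (hmul p.2 (gamma lambda p.1)) * w p.2)).
  move=> ma a0 ea; apply/cintegrableP; split.
    exact: (cmeasM (cmeas_real ma) (cmeasM (mfp mf) mwp)).
  apply: (@le_lt_trans _ _ (C%:E * (L%:E * L1norm hm setT f))%E); last first.
    apply: lte_mul_pinfty; [by []|by []|].
    by apply: lte_mul_pinfty; [rewrite lee_fin ltW|by []|exact: ff].
  have mA : measurable_fun setT (fun p : measurableTypeR R * HH =>
      ((a p)%:E * (cnorm (f (hmul p.2 (gamma lambda p.1))))%:E)%E).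
    apply: emeasurable_funM; first exact/measurable_EFinP.
    exact: (measurable_cnormE (mfp mf)).
  rewrite -ea -(ge0_integralZl _ measurableT mA) //; last first.
    by move=> p _; rewrite -EFinM lee_fin mulr_ge0 ?cnorm_ge0.
  apply: ge0_le_integral_nonmeas => p _; first by rewrite lee_fin cnorm_ge0.
  rewrite -!EFinM lee_fin !cnormM cnormR ger0_norm // mulrA [leRHS]mulrC.
  by apply: ler_wpM2l => //; rewrite mulr_ge0 ?cnorm_ge0.
by split; apply: key => // p; rewrite ?lee_fin.
Qed.

(** For f merely in L^1 the integral along the helix through q is controlled only for almost every
    q, by Fubini's theorem with weight w = 1. *)
Lemma helix_integrable (f : HH -> R[i]) : cintegrable hm setT f ->
  cintegrable hm D (helix_integral lambda f) /\
  {ae hm, forall q, D q -> cintegrable leb setT (fun s => f (hmul q (gamma lambda s)))}.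
Proof.
move=> fi; have [j _] := helix_cintegrable (C := 1) fi (cmeas_cst 1) (fun q => eq_ind_r (fun x => x <= 1) (lexx 1) (@cnorm1 R)).
have E (q : HH) : (fun s : R => (\1_K q.2)%:C * (f (hmul q (gamma lambda s)) * 1)) =
    (fun s => cind D q * f (hmul q (gamma lambda s))).
  by apply/funext => s; rewrite mulr1 cindD.
split.
  apply/(cintegrable_cind _ _ mD).
  have := cintegrable_fubini2 j; apply: (eq_cintegrable measurableT) => q _ /=.
  rewrite E; have [Dq|Dq] := pselect (D q).
    by rewrite (cindE Dq) mul1r; apply: eq_cintegral => s _; rewrite mul1r.
  rewrite (cindN Dq) mul0r -[RHS](cintegral0 leb setT).
  by apply: eq_cintegral => s _; rewrite mul0r.
have a1 := ae_integrable2 j.1; have a2 := ae_integrable2 j.2.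
apply: filterS2 a1 a2 => q a1 a2 Dq; split.
  by apply: eq_integrable a1 => // s _ /=; rewrite mulr1 -cindD cindE // mul1r.
by apply: eq_integrable a2 => // s _ /=; rewrite mulr1 -cindD cindE // mul1r.
Qed.

Lemma helix_L1norm (u f : HH -> R[i]) : cmeas u -> cintegrable hm setT f ->
  (L1norm hm D (helix_integral lambda u \- helix_integral lambda f)%R
   <= L%:E * L1norm hm setT (u \- f)%R)%E.
Proof.
move=> mu fi; have mf := cintegrable_cmeas fi.
have mv : cmeas (u \- f) by exact: cmeasB.
have N0 : (0 <= L1norm hm setT (u \- f)%R)%E by apply: integral_ge0 => q _; rewrite lee_fin cnorm_ge0.
(* [u] is only measurable. If its distance to f is infinite the bound is trivial since L > 0;
   otherwise u is integrable as well. *)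
have [oo|fin] := eqVneq (L1norm hm setT (u \- f)%R) +oo%E.
  by rewrite oo gt0_muley ?leey.
have vi : cintegrable hm setT (u \- f) by apply/cintegrableP; split => //; rewrite ltey.
have ui : cintegrable hm setT u.
  have := cintegrableD measurableT vi fi; apply: (eq_cintegrable measurableT) => q _ /=.
  by rewrite subrK.
have [uD ua] := helix_integrable ui; have [fD fa] := helix_integrable fi.
have [<- _] := helix_norm mv.
have mQ := measurable_cnormE (mfp mv).
apply: ae_ge0_le_integral => //.
- by move=> q _; rewrite lee_fin cnorm_ge0.
- exact: measurable_int (cintegrable_norm mD (cintegrableB mD uD fD)).
- by move=> q _; apply: integral_ge0 => s _; rewrite lee_fin cnorm_ge0.
- apply: (measurable_funS measurableT (@subsetT _ _)).
  apply: (@measurable_fun_fubini_tonelli_G _ _ _ _ _ leb _ mQ _) => p.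
  by rewrite lee_fin cnorm_ge0.
apply: filterS2 ua fa => q uq fq Dq; have := uq Dq; have := fq Dq => fs us.
rewrite -[X in cnorm X]/(helix_integral lambda u q - helix_integral lambda f q) /helix_integral -(cintegralB measurableT us fs).
by apply: le_cnorm_cintegralE => //; exact: cintegrableB.
Qed.

Let section_cmeas (f : HH -> R[i]) (q : HH) : cmeas f ->
  cmeas (fun s : measurableTypeR R => f (hmul q (gamma lambda s))).
Proof.
move=> mf; apply: (cmeas_comp (mfp mf) (phi := fun s => (s, q))).
exact: measurable_fun_pair.
Qed.

(** Translating by the k-th central element advances the helix by k full turns, a translation of the
    parameter s. *)
Lemma helix_invariant (f : HH -> R[i]) : cmeas f -> Gamma_invariant lambda (helix_integral lambda f).
Proof.
move=> mf q c [k ->]; rewrite /helix_integral.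
have hn (n : nat) s : gamma lambda (s + n%:R * L) = ((gamma lambda s).1, (gamma lambda s).2 + n%:R * P).
  elim: n => [|n IH]; first by rewrite !mul0r !addr0; case: (gamma _ _).
  have -> : s + n.+1%:R * L = (s + n%:R * L) + L by rewrite -natr1; ring.
  by rewrite gamma_periodic IH /=; congr (_, _); rewrite -natr1; ring.
have hz s : gamma lambda (s + k%:~R * L) = ((gamma lambda s).1, (gamma lambda s).2 + k%:~R * P).
  case: k => n; first exact: hn.
  rewrite NegzE !mulrNz -!pmulrn.
  have := hn n.+1 (s + - n.+1%:R * L).
  have -> : s + - n.+1%:R * L + n.+1%:R * L = s by ring.
  by case: (gamma lambda _) => a b -> /=; congr (_, _); ring.
rewrite -(mpres_cintegral (mpres_addr (k%:~R * L)) (section_cmeas q mf)).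
apply: eq_cintegral => s _; rewrite hz; congr f.
by rewrite /hmul /P /=; congr (_, _, _); ring.
Qed.

(** The helix integral of f itself is an admissible value of the bounded extension; it is the
    witness needed to unfold [Xray]. *)
Lemma helix_is_Xray (f : HH -> R[i]) : cintegrable hm setT f ->
  is_Xray lambda f (helix_integral lambda f).
Proof.
move=> fi; have mf := cintegrable_cmeas fi; have [fD _] := helix_integrable fi.
have [u [cu lu]] := Cc_dense fi.
split; [exact: helix_invariant|exact: fD|exists u; split; [exact: cu|exact: lu|]].
have l2 : (fun k => L%:E * L1norm hm setT (u k \- f)%R)%E @ \oo --> 0%E.
  by rewrite -(mule0 L%:E); apply: cvgeZl.
apply: (ecvg0_le _ l2) => k; apply/andP; split.
  by apply: integral_ge0 => q _; rewrite lee_fin cnorm_ge0.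
exact: (helix_L1norm (heis_cont_cmeas (cu k).1) fi).
Qed.

(** Both functions are L^1 limits of the helix integrals of one C_c sequence, so whichever
    representative is chosen agrees in L^1 with the helix integral. *)
Lemma is_Xray_L1 (f g : HH -> R[i]) : cintegrable hm setT f -> is_Xray lambda f g ->
  L1norm hm D (helix_integral lambda f \- g)%R = 0%E.
Proof.
move=> fi [_ gi [u [cu lu lg]]]; have [fD _] := helix_integrable fi.
have mf := cintegrable_cmeas fi.
have mu k : cmeas (u k : HH -> R[i]) by apply: heis_cont_cmeas; case: (cu k).
apply/eqP; rewrite eq_le; apply/andP; split; last first.
  by apply: integral_ge0 => q _; rewrite lee_fin cnorm_ge0.
apply/lee_addgt0Pr => e e0; rewrite add0e.
have e2 : 0 < e / 2 by rewrite divr_gt0.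
have eL : 0 < e / 2 / L by exact: divr_gt0.
have [k0 _ hk] : \forall k \near \oo,
   (L1norm hm setT (u k \- f)%R < (e / 2 / L)%:E)%E /\ (L1norm hm D (helix_integral lambda (u k) \- g)%R < (e / 2)%:E)%E.
  by apply: filterS2 (ecvg0_lt lu eL) (ecvg0_lt lg e2).
have [h1 h2] := hk k0 (leqnn k0).
have ui : cintegrable hm setT (u k0).
  have vi : cintegrable hm setT (u k0 \- f).
    apply/cintegrableP; split; first exact: cmeasB.
    by apply: lt_trans h1 _; rewrite ltry.
  have := cintegrableD measurableT vi fi; apply: (eq_cintegrable measurableT) => q _ /=.
  by rewrite subrK.
have [uD _] := helix_integrable ui.
have i1 := cintegrable_norm mD (cintegrableB mD uD fD).
have i2 := cintegrable_norm mD (cintegrableB mD uD gi).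
apply: (@le_trans _ _ (L1norm hm D (helix_integral lambda (u k0) \- helix_integral lambda f)%R
   + L1norm hm D (helix_integral lambda (u k0) \- g)%R)%E).
  rewrite /L1norm -ge0_integralD //; last 4 first.
  - by move=> q _; rewrite lee_fin cnorm_ge0.
  - exact: measurable_int i1.
  - by move=> q _; rewrite lee_fin cnorm_ge0.
  - exact: measurable_int i2.
  apply: ge0_le_integral_nonmeas => q _; first by rewrite lee_fin cnorm_ge0.
  by rewrite -EFinD lee_fin; exact: cnorm_dist3.
rewrite (splitr e) EFinD; apply: leeD; last exact: ltW.
apply: (le_trans (helix_L1norm (mu k0) fi)).
have -> : e / 2 = L * (e / 2 / L) by rewrite [RHS]mulrC divfK // gt_eqF.
rewrite (EFinM L); apply: lee_wpmul2l; last exact: ltW.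
by rewrite lee_fin ltW.
Qed.

Lemma ae_eq_cintegral d (S : measurableType d) (mu : {measure set S -> \bar R})
    (a b : S -> R[i]) : cintegrable mu setT a -> cintegrable mu setT b ->
  {ae mu, forall x, a x = b x} -> cintegral mu setT a = cintegral mu setT b.
Proof.
move=> [a1 a2] [b1 b2] ab; rewrite /cintegral /Rintegral.
congr (fine _ +i* fine _); apply: ae_eq_integral => //.
- exact: measurable_int a1.
- exact: measurable_int b1.
- by apply: filterS ab => x -> _.
- exact: measurable_int a2.
- exact: measurable_int b2.
- by apply: filterS ab => x -> _.
Qed.

Lemma Xray_spec (f : HH -> R[i]) : cintegrable hm setT f -> is_Xray lambda f (Xray lambda f).
Proof. by move=> fi; apply: xgetPex; exists (helix_integral lambda f); exact: helix_is_Xray. Qed.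

Lemma bounded_mul_cintegrable (g w : HH -> R[i]) (C : R) : cintegrable hm D g -> cmeas w ->
  (forall q, cnorm (w q) <= C) -> cintegrable hm D (fun q => g q * w q).
Proof.
move=> gi mw wC; have gi' := (cintegrable_cind _ _ mD).1 gi.
have mg := cintegrable_cmeas gi'; have ng := cintegrable_norm measurableT gi'.
apply/(cintegrable_cind _ _ mD); under eq_fun do rewrite mulrA.
apply: (le_cintegrable (g := fun q => C * cnorm (cind D q * g q))).
- exact: cmeasM.
- by move=> q; rewrite cnormM mulrC ler_wpM2r ?cnorm_ge0.
- by rewrite /comp; under eq_fun do rewrite EFinM; exact: integrableZl.
Qed.

Lemma Xray_pairing (f w : HH -> R[i]) (C : R) : cintegrable hm setT f -> cmeas w ->
  (forall q, cnorm (w q) <= C) ->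
  cintegral hm D (fun q => Xray lambda f q * w q)
  = cintegral hm D (fun q => helix_integral lambda f q * w q).
Proof.
move=> fi mw wC; have [_ gi _] := Xray_spec fi; have [fD _] := helix_integrable fi.
have C0 : 0 <= C by apply: le_trans (cnorm_ge0 _) (wC (0, 0, 0)).
have N0 := is_Xray_L1 fi (Xray_spec fi).
apply/esym/eqP; rewrite -subr_eq0 -cintegralB //; try exact: (bounded_mul_cintegrable _ mw wC).
apply/eqP/cnorm_eq0/eqP; rewrite eq_le cnorm_ge0 andbT -lee_fin.
apply: (le_trans (le_cnorm_cintegralE mD _)).
  by apply: cintegrableB => //; exact: (bounded_mul_cintegrable _ mw wC).
apply: (@le_trans _ _ (C%:E * L1norm hm D (helix_integral lambda f \- Xray lambda f)%R)%E); last by rewrite N0 mule0.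
rewrite -ge0_integralZl //; last 2 first.
- exact: measurable_int (cintegrable_norm mD (cintegrableB mD fD gi)).
- by move=> q _; rewrite lee_fin cnorm_ge0.
apply: ge0_le_integral_nonmeas => q _; first by rewrite lee_fin cnorm_ge0.
by rewrite -EFinM lee_fin -mulrBl cnormM mulrC ler_wpM2r ?cnorm_ge0.
Qed.

Lemma helix_pairing (f w : HH -> R[i]) (C : R) : cintegrable hm setT f -> cmeas w ->
  (forall q, cnorm (w q) <= C) -> (forall q : HH, w (q.1, q.2 + P) = w q) ->
  cintegral hm D (fun q => helix_integral lambda f q * w q)
  = cintegral leb I (fun s => cintegral hm setT (fun p => f p * w (hmul p (hinv (gamma lambda s))))).
Proof.
move=> fi mw wC wP; have mf := cintegrable_cmeas fi.
have [j1 j2] := helix_cintegrable fi mw wC.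
pose Q (p : measurableTypeR R * HH) := f (hmul p.2 (gamma lambda p.1)) * w p.2.
have mQ : cmeas Q.
  exact: (cmeasM (mfp mf) (cmeas_comp mw (@measurable_snd _ _ _ _))).
have hQ s (q : HH) : Q (s + L, q) = Q (s, (q.1, q.2 + P)).
  by rewrite /Q /= hmul_shift wP.
have := unfold_cintegral L0 P0 mQ hQ.
rewrite -(cintegral_fubini2 j1) -(cintegral_fubini1 j2) => E.
have [fD fa] := helix_integrable fi.
rewrite cintegral_cind; transitivity (cintegral hm setT (fun q =>
    cintegral leb setT (fun s => (\1_K q.2)%:C * Q (s, q)))).
  (* The weight w(q) enters the inner integral only where the helix integral through q converges,
     hence equality almost everywhere only. *)
  apply: ae_eq_cintegral.
  - exact: (cintegrable_cind _ _ mD).1 (bounded_mul_cintegrable fD mw wC).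
  - exact: cintegrable_fubini2 j1.
  apply: filterS fa => q fq; rewrite -cindD.
  have [Dq|Dq] := pselect (D q); last first.
    rewrite (cindN Dq) mul0r -[LHS](cintegral0 leb setT).
    by apply: eq_cintegral => s _; rewrite mul0r.
  rewrite (cindE Dq) mul1r /helix_integral mulrC -cintegralZ //; last exact: fq.
  by apply: eq_cintegral => s _; rewrite mul1r mulrC.
rewrite E [RHS]cintegral_cind; apply: eq_cintegral => s _ /=.
have [Is|Is] := pselect (I s); last first.
  rewrite (cindN Is) mul0r -[RHS](cintegral0 hm setT).
  by apply: eq_cintegral => q _; rewrite indicE memNset //= mul0r.
rewrite (cindE Is) mul1r; symmetry.
have mws : cmeas (fun p : HH => f p * w (hmul p (hinv (gamma lambda s)))).
  have mh : measurable_fun setT (fun p : HH => hmul p (hinv (gamma lambda s)) : HH).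
    exact: (measurable_hmul (@measurable_id _ _ _) (measurable_cst _)).
  exact: (cmeasM mf (cmeas_comp mw mh)).
rewrite -(mpres_cintegral (mpres_hmulr (gamma lambda s)) mws).
apply: eq_cintegral => q _; rewrite indicE mem_set //= mul1r /Q /=.
by rewrite -hmulA hmulV hmul0.
Qed.

End Helix.

(** * The contour integral J *)

Section LineIntegrals.
Context {R : realType}.
Notation leb := (@lebesgue_measure R).
Implicit Types g : R -> R[i].

Lemma lcont_line (F : R[i] -> R[i]) (a c : R) : (forall z, cdiff F z) ->
  lcont (fun s => F (a +i* (s * c))).
Proof.
move=> hF; apply: lcontP => x e e0.
have [d d0 hd] := cdiff_cont (hF (a +i* (x * c))) e0.
have c0 : 0 < 1 + `|c| by rewrite ltr_pwDl.
exists (d / (1 + `|c|)); first by rewrite divr_gt0.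
move=> h hh; have -> : a +i* ((x + h) * c) = a +i* (x * c) + 'i%C * (h * c)%:C.
  by apply: complex_ext; rewrite ?ReD ?ImD ?ReM ?ImM /=; ring.
apply: hd; rewrite cnormM cnormI mul1r cnormR normrM.
apply: (@le_lt_trans _ _ (`|h| * (1 + `|c|))); first by rewrite ler_wpM2l // lerDr.
by rewrite -ltr_pdivlMr.
Qed.

Lemma cintegral_scale g (b c : R) : lcont g -> 0 <= b -> 0 < c ->
  cintegral leb `[0, b * c] g = c%:C * cintegral leb `[0, b] (fun t => g (t * c)).
Proof.
move=> [g1 g2] b0 c0.
have key (u : R -> R) : continuous u ->
    Rintegral leb `[0, b * c] u = c * Rintegral leb `[0, b] (fun t => u (t * c)).
  move=> cu; have cuc : continuous (fun t : R => u (t * c)).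
    move=> t; apply: (@continuous_comp _ _ _ (fun t : R => t * c) u); last exact: cu.
    by apply: cvgM; [exact: cvg_id|exact: cvg_cst].
  have ui : leb.-integrable `[0, b] (EFin \o (fun t => u (t * c))).
    by apply: continuous_compact_integrable; [exact: segment_compact|exact: continuous_subspaceT].
  rewrite -RintegralZl // /Rintegral; congr fine.
  pose F (t : R) : R := t * c.
  have dF (t : R) : is_derive t (1 : R) F c.
    rewrite (_ : F = c \*: (id : R -> R)); last by apply/funext => x; rewrite /F mulrC.
    have := is_deriveZ c (is_derive_id t (1 : R)).
    by move=> h; apply: (is_derive_eq h); rewrite /GRing.scale /= mulr1.
  have DF : derive1 F = cst c.
    by apply/funext => z; rewrite derive1E (@derive_val _ _ _ _ _ _ _ (dF z)).
  have -> : `[0, b * c]%classic = `[F 0, F b]%classic by rewrite /F mul0r.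
  rewrite (@integration_by_substitution_increasing _ F) //.
  - by apply: eq_integral => x _; rewrite DF /= mulrC.
  - by move=> x y _ _ xy; rewrite /F ltr_pM2r.
  - by rewrite DF => ? _; exact: cvg_cst.
  - by rewrite DF; exact: is_cvg_cst.
  - by rewrite DF; exact: is_cvg_cst.
  - have cF : continuous F by move=> t; apply: cvgM; [exact: cvg_id|exact: cvg_cst].
    split; first by move=> x _; have [] := dF x.
    + by apply: cvg_at_right_filter; exact: cF.
    + by apply: cvg_at_left_filter; exact: cF.
  - exact: continuous_subspaceT.
by apply: complex_ext; rewrite ?ReM ?ImM /= ?(key _ g1) ?(key _ g2); ring.
Qed.

Lemma cintegral_reflect g (b : R) : cmeas (g : measurableTypeR R -> R[i]) ->
  cintegral leb `[0, b] (fun t => g (b - t)) = cintegral leb `[0, b] g.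
Proof.
move=> mg; rewrite cintegral_cind [RHS]cintegral_cind.
have mG : cmeas (fun x : measurableTypeR R => cind `[0, b] x * g x).
  by apply: cmeasM => //; apply: cmeas_cind; exact: measurable_itv.
rewrite -(mpres_cintegral (mpres_comp (mpres_addr b) (@mpres_opp R)) mG).
apply: eq_cintegral => t _ /=; rewrite [- t + b]addrC; congr (_ * _).
rewrite /cind !indicE (_ : (b - t \in `[0, b]%classic) = (t \in `[0, b]%classic)) //.
by apply/idP/idP; rewrite !inE /= !in_itv /= => /andP[h1 h2]; apply/andP; split; lra.
Qed.

Lemma lcont_cmeas g : lcont g -> cmeas (g : measurableTypeR R -> R[i]).
Proof. by move=> [g1 g2]; split; exact: continuous_measurable_fun. Qed.

Lemma cintegral_closed g (b : R) : lcont g ->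
  cintegral leb `[0, b[ g = cintegral leb `[0, b] g.
Proof.
move=> gc; have [i1 i2] := lcont_cintegrable 0 b gc.
rewrite /cintegral; congr (_ +i* _); apply: Rintegral_itv_bndo_bndc.
- by apply: integrableS i1 => //; exact: subset_itv_co_cc.
- by apply: integrableS i2 => //; exact: subset_itv_co_cc.
Qed.

Lemma cexpX (z : R[i]) (m : nat) : cexp (m%:R * z) = cexp z ^+ m.
Proof.
elim: m => [|m IH]; first by rewrite mul0r cexp0.
by rewrite -natr1 mulrDl mul1r cexpD IH exprSr.
Qed.

Lemma cexp_2pi_nat (m : nat) : cexp ('i%C * (2 * pi * m%:R)%:C : R[i]) = 1.
Proof.
have -> : 'i%C * (2 * pi * m%:R)%:C = m%:R * ('i%C * (2 * pi)%:C) :> R[i].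
  by rewrite RCM rmorph_nat; ring.
by rewrite cexpX -[_ * _]add0r cexp_2pi cexp0 expr1n.
Qed.

End LineIntegrals.

Section Contour.
Context {R : realType}.
Notation leb := (@lebesgue_measure R).
Variables (lambda : R) (m : nat).
Hypotheses (l0 : 0 < lambda) (m0 : (0 < m)%N).
Variables (V : R[i] -> R[i]) (zeta : R[i]).
Hypothesis hV : holomorphic V.

Let h := m%:R * lambda ^+ 2.
Let h0 : 0 < h. Proof. by rewrite mulr_gt0 ?ltr0n // exprn_gt0. Qed.

(* The integrand of [J], multiplied by z, in the coordinate w = log z. *)
Definition contour_fun (w : R[i]) : R[i] :=
  cexp w ^+ m * cexp (- (m%:R * zeta * cexp (- w))) * V (zeta + cexp w).

Lemma contour_fun_cdiff w : cdiff contour_fun w.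
Proof.
have dV z : cdiff V z by move: z; apply/holomorphicP.
apply: cdiffM.
  apply: cdiffM.
    rewrite (_ : (fun x => _) = (fun x => cexp (m%:R * x))); last by apply/funext => x; rewrite cexpX.
    by apply: (cdiff_comp (F := cexp)) (cdiff_cexp _); apply: cdiffZ; exact: cdiff_id.
  apply: (cdiff_comp (F := cexp)) (cdiff_cexp _).
  rewrite (_ : (fun x => _) = (fun x => (- (m%:R * zeta)) * cexp (- x))); last first.
    by apply/funext => x; rewrite mulNr.
  apply: cdiffZ; apply: (cdiff_comp (F := cexp)) (cdiff_cexp _).
  have := cdiffZ (-1) (cdiff_id w).
  by rewrite (_ : (fun x => -1 * x) = (fun x => - x)) //; apply/funext => x; rewrite mulN1r.
apply: (cdiff_comp (F := V)) (dV _).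
by apply: cdiffD; [exact: cdiff_cst|exact: cdiff_cexp].
Qed.

Lemma contour_fun_periodic w : contour_fun (w + 'i%C * (2 * pi)%:C) = contour_fun w.
Proof.
rewrite /contour_fun cexp_2pi; congr (_ * cexp (- (_ * _)) * _).
by rewrite !cexpN cexp_2pi.
Qed.

Definition contour_cst : R := ((expR 1 * m%:R)^-1) `^ (m%:R / 2).

(** The constant of J as one exponential, e^(-m/2) s^(-m) with s = sqrt m, so that it can be merged
    with the other exponents. *)
Lemma contour_cstE : contour_cst = expR (- (m%:R / 2) * (1 + 2 * ln (Num.sqrt m%:R))).
Proof.
have mp : 0 < m%:R :> R by rewrite ltr0n.
rewrite /contour_cst /powR gt_eqF ?invr_gt0 ?mulr_gt0 ?expR_gt0 //.
rewrite lnV ?posrE ?mulr_gt0 ?expR_gt0 // lnM ?posrE ?expR_gt0 // expRK.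
have -> : ln (m%:R : R) = 2 * ln (Num.sqrt m%:R).
  rewrite -[in LHS](sqr_sqrtr (ltW mp)) lnXn ?sqrtr_gt0 //.
  by rewrite mulr2n; ring.
by congr expR; ring.
Qed.

(** Put z = sqrt m e^(i theta). The shift sqrt h / lambda equals sqrt m, so V is taken at zeta + z.
    The height theta / (2 lambda^2) gives the phase e^(i m theta) of z^m. The cross term is m zeta /
    z. The Gaussian factor e^(-m/2) is the constant of J times |z|^m. *)
Lemma beta_gamma (theta : R) : beta_pos h (gamma lambda (theta / lambda)) V zeta
  = contour_cst%:C * contour_fun (ln (Num.sqrt m%:R) +i* theta).
Proof.
have mp : 0 < m%:R :> R by rewrite ltr0n.
have ln0 : lambda != 0 by rewrite gt_eqF.
pose s : R := Num.sqrt m%:R.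
have s0 : 0 < s by rewrite sqrtr_gt0.
have sm : m%:R = s ^+ 2 by rewrite sqr_sqrtr // ltW.
have sh : Num.sqrt h = s * lambda.
  by rewrite /h sqrtrM ?(ltW mp) // sqrtr_sqr gtr0_norm.
have th : theta / lambda / lambda^-1 = theta by rewrite invrK divfK.
have eW : cexp (ln s +i* theta) = s%:C * (cos theta +i* sin theta).
  by rewrite cexp_polar lnK ?posrE // cexp_iE.
have eWN : cexp (- (ln s +i* theta)) = (s^-1)%:C * (cos theta +i* - sin theta).
  have -> : - (ln s +i* theta) = - ln s +i* - theta by apply: complex_ext.
  by rewrite cexp_polar expRN lnK ?posrE // cexp_iE cosN sinN.
pose W : R[i] := ln s +i* theta.
have -> : contour_cst%:C * contour_fun W = cexp ((- (m%:R / 2) * (1 + 2 * ln s))%:C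
    + m%:R * W + - (m%:R * zeta * cexp (- W))) * V (zeta + cexp W).
  rewrite /contour_fun -cexpX contour_cstE -cexp_real -/s.
  move: (V _) => v; rewrite (cexpD (_ + _)) (cexpD _ (_ * W)).
  by move: (cexp _) (cexp (m%:R * W)) (cexp (- (m%:R * zeta * _))) => x y z; ring.
have mC : (m%:R : R[i]) = (s ^+ 2)%:C by rewrite -sm rmorph_nat.
rewrite /W eW eWN mC /beta_pos cnorm_sqr /gamma /= th sh; congr (cexp _ * V _); last first.
  congr (_ + _); by apply: complex_ext; rewrite ?ReM ?ImM /=; field; exact: ln0.
have cs : cos theta ^+ 2 = 1 - sin theta ^+ 2 by rewrite -(cos2Dsin2 theta) addrK.
have sn0 : s != 0 by rewrite gt_eqF.
rewrite /h sm.
case: zeta => a b; apply: complex_ext; rewrite !(ReD, ImD, ReN, ImN, ReM, ImM) /=.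
  rewrite (_ : (lambda^-1 * cos theta) ^+ 2 + _ = lambda^-1 ^+ 2); last first.
    by rewrite !exprMn -mulrDr cos2Dsin2 mulr1.
  by field; rewrite sn0 ln0.
by field; rewrite sn0 ln0.
Qed.

Let L := 2 * pi / lambda.
Let L0 : 0 < L. Proof. by rewrite divr_gt0 // mulr_gt0 // pi_gt0. Qed.
Let B (s : R) := beta_pos h (gamma lambda s) V zeta.

Let BE s : B s = contour_cst%:C * contour_fun (ln (Num.sqrt m%:R) +i* (s * lambda)).
Proof. by rewrite -beta_gamma mulfK // gt_eqF. Qed.

Let B_lcont : lcont B.
Proof.
have := @lcont_line R (fun w => contour_cst%:C * contour_fun w) (ln (Num.sqrt m%:R)) lambda
  (fun w => cdiffZ _ (contour_fun_cdiff w)).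
by rewrite (_ : (fun s => _) = B) //; apply/funext => s; rewrite BE.
Qed.

Let B_periodic s : B (s + L) = B s.
Proof.
rewrite !BE -[in RHS]contour_fun_periodic; congr (_ * contour_fun _).
have -> : (s + L) * lambda = s * lambda + 2 * pi by rewrite mulrDl /L divfK // gt_eqF.
by apply: complex_ext; rewrite ?ReD ?ImD ?ReM ?ImM /=; ring.
Qed.

(** The factor i from dz = i z dtheta cancels the one in 1 / (2 pi i); then L / (2 pi) = 1 / lambda
    is the Jacobian of s = theta / lambda. *)
Lemma J_beta_gamma (r : R) (n : int) : 0 < r -> `|n|%N = m ->
  L%:C * J r n V zeta = cintegral leb `[0, L] B.
Proof.
move=> r0 nm; have pi2 : 0 < 2 * pi :> R by rewrite mulr_gt0 // pi_gt0.
pose I0 := cintegral leb `[0, 2 * pi] (fun t => contour_fun (ln (Num.sqrt m%:R) +i* t)).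
have lcf a : lcont (fun t => contour_fun (a +i* t)).
  have := @lcont_line R contour_fun a 1 contour_fun_cdiff.
  by under eq_fun do rewrite mulr1.
have -> : cintegral leb `[0, L] B = (lambda^-1)%:C * (contour_cst%:C * I0).
  rewrite /L cintegral_scale ?(ltW pi2) ?invr_gt0 //; congr (_ * _).
  rewrite -cintegralZ //; last exact: lcont_cintegrable.
  by apply: eq_cintegral => t _; rewrite /B beta_gamma.
(* The z in dz raises z^(m-1) to z^m, and vertical invariance moves the contour from radius r to
   radius sqrt m. *)
have circ : circle_integral r (fun z => z ^+ m.-1 * cexp (- (m%:R * zeta / z)) * V (zeta + z))
    = 'i%C * I0.
  rewrite /I0 -(vertical_invariance contour_fun_cdiff (ln r) _ pi2 contour_fun_periodic).
  rewrite -cintegralZ //; last exact: lcont_cintegrable.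
  apply: eq_cintegral => t _; rewrite /contour_fun cexpN.
  have -> : cexp (ln r +i* t) = r%:C * cexp ('i%C * t%:C) by rewrite cexp_polar lnK.
  move: (r%:C * cexp ('i%C * t%:C)) => z.
  have -> : z ^+ m = z ^+ m.-1 * z by rewrite -exprSr prednK.
  by move: (cexp _) (V _) => u v; ring.
rewrite /J nm circ -/contour_cst.
have p0 : pi != 0 :> R by rewrite gt_eqF // pi_gt0.
have i0 : 'i%C != 0 :> R[i] by apply/eqP => /(congr1 (@complex.Im R)) /= /eqP; rewrite oner_eq0.
have pC0 : pi%:C != 0 :> R[i] by apply/eqP => /(congr1 (@complex.Re R)) /= /eqP; rewrite (negbTE p0).
have -> : L%:C = 2 * pi%:C * (lambda^-1)%:C.
  by rewrite /L !RCM; congr (_ * _ * _); rewrite -[2]/(2%:R) rmorph_nat.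
move: pC0 => pC0; have t0 : (2 : R[i]) != 0 by rewrite pnatr_eq0.
rewrite !invfM; set x := pi%:C in pC0 *; set y := (lambda^-1)%:C.
rewrite (_ : 2 * x * y * (2^-1 / x / 'i%C * contour_cst%:C * ('i%C * I0)) =
  (2 / 2) * (x / x) * ('i%C / 'i%C) * (y * (contour_cst%:C * I0))); last by ring.
by rewrite !divff // !mul1r.
Qed.

Lemma integral_beta_gamma (n : int) : `|n|%N = m ->
  cintegral leb `[0, L[ (fun s => beta (n%:~R * lambda ^+ 2) (gamma lambda s) V zeta)
  = cintegral leb `[0, L] B.
Proof.
move=> nm; rewrite -(cintegral_closed L B_lcont).
have hn : `|n%:~R * lambda ^+ 2| = h :> R.
  rewrite normrM (ger0_norm (sqr_ge0 _)) /h; congr (_ * _).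
  by rewrite -intr_norm -abszE nm.
have [hp|hp] := boolP (0 < n%:~R * lambda ^+ 2).
  by apply: eq_cintegral => s _; rewrite betaE hn /hsig hp.
(* For negative n, beta sees (conj z, -t), and this turns gamma(s) into gamma(-s). Periodicity
   brings -s back to L - s, and a reflection of the interval finishes. *)
have E s : beta (n%:~R * lambda ^+ 2) (gamma lambda s) V zeta = B (L - s).
  have -> : B (L - s) = B (- s) by rewrite -(B_periodic (- s)) addrC.
  have G : gamma lambda (- s) = ((gamma lambda s).1.1, - (gamma lambda s).1.2, - (gamma lambda s).2).
    by rewrite /gamma /= mulNr cosN sinN; congr (_, _, _); ring.
  by rewrite /B G /beta (negbTE hp) hn.
transitivity (cintegral leb `[0, L[ (fun s => B (L - s))).
  by apply: eq_cintegral => s _.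
have lr : lcont (fun s => B (L - s)).
  have c : continuous (fun s : R => L - s) by move=> s; apply: cvgB; [exact: cvg_cst|exact: cvg_id].
  have [b1 b2] := B_lcont; split => s.
  - by apply: (@continuous_comp _ _ _ (fun s : R => L - s) (fun x => complex.Re (B x))); [exact: c|exact: b1].
  - by apply: (@continuous_comp _ _ _ (fun s : R => L - s) (fun x => complex.Im (B x))); [exact: c|exact: b2].
rewrite (cintegral_closed L lr) (cintegral_closed L B_lcont).
exact: (cintegral_reflect L (lcont_cmeas B_lcont)).
Qed.

End Contour.

(** * Comparison of the two Fourier transforms *)

Section Main.
Context {R : realType}.
Notation leb := (@lebesgue_measure R).
Notation HH := (measurableTypeR R * measurableTypeR R * measurableTypeR R)%type.
Notation hm := (sfprod (sfprod leb leb) leb).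

Lemma beta_pos_central (a t : R) F : cexp ('i%C * (2 * a * t)%:C) = 1 ->
  beta_pos a (0, 0, t) F = F.
Proof.
move=> e; apply: funC_ext => w; rewrite beta_posE.
have -> : bexp a (0, 0, t) w = 'i%C * (2 * a * t)%:C.
  by apply: complex_ext; rewrite ?ReM ?ImM /=; ring.
by rewrite e mul1r /bshift /= !mulr0 !addr0; case: w.
Qed.

Lemma beta_central (lambda : R) (n : int) F : lambda != 0 ->
  beta (n%:~R * lambda ^+ 2) (0, 0, - (pi * lambda^-1 ^+ 2)) F = F.
Proof.
move=> l0; set h := _ * _; pose P := pi * lambda^-1 ^+ 2.
(* The powers of lambda cancel, so the central phase is a multiple of 2 pi: the frequencies n
   lambda^2 are those for which beta is trivial on Gamma_lambda. *)
have hP : 2 * `|h| * P = 2 * pi * `|n|%N%:R.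
  rewrite /h normrM (ger0_norm (sqr_ge0 _)) -intr_norm -abszE /P.
  by rewrite pmulrn; field.
have e1 : cexp ('i%C * (2 * `|h| * P)%:C) = 1 :> R[i] by rewrite hP cexp_2pi_nat.
have e2 : cexp ('i%C * (2 * `|h| * - P)%:C) = 1 :> R[i].
  rewrite mulrN (_ : _ * _ = - ('i%C * (2 * `|h| * P)%:C)); last by rewrite RCN mulrN.
  by rewrite cexpN e1 invr1.
rewrite betaE /hsig; case: ifP => _; first exact: beta_pos_central.
by rewrite oppr0 opprK; exact: beta_pos_central.
Qed.

Variables (f : heis R -> R[i]) (n : int) (lambda : R) (F : R[i] -> R[i]).
Hypotheses (fi : cintegrable hm setT f) (l0 : 0 < lambda) (fF : fock F).

Let h := n%:~R * lambda ^+ 2.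
Let V := fourier_H f h F.

Let VE : V = (fun z => cintegral hm setT (fun q => f q * beta h (hinv q) F z)).
Proof. exact: (bochner_integralE h fF measurableT fi). Qed.

Lemma fock_fourier_H : fock V.
Proof. by rewrite VE; exact: (bochner_integral_fock h fF measurableT fi). Qed.

Let cF : ccont F. Proof. by apply: holomorphic_ccont; case/fockP: fF. Qed.

Let Psi z (q : HH) := beta h (hinv q) F z.

Let mPsi z : cmeas (Psi z).
Proof.
rewrite /Psi -(toC_ReIm z).
exact: (cmeas_beta_inv h cF (@measurable_id _ HH setT) (measurable_cst (complex.Re z, complex.Im z))).
Qed.

Let C z := Num.sqrt (pi^-1 * expR (cnorm z ^+ 2) * fine (N2 F)).

Let Psi_le z q : cnorm (Psi z q) <= C z.
Proof.
have := fock_eval_le z (fock_beta h (hinv q) fF); rewrite N2_beta // => le.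
by rewrite -[leLHS]ger0_norm ?cnorm_ge0 // -sqrtr_sqr ler_wsqrtr.
Qed.

Let Psi_invariant z (q : HH) : Psi z (q.1, q.2 + pi * lambda^-1 ^+ 2) = Psi z q.
Proof.
have -> : (q.1, q.2 + pi * lambda^-1 ^+ 2) = hmul q (0, 0, pi * lambda^-1 ^+ 2).
  by case: q => [[x y] t]; rewrite /hmul /=; congr (_, _, _); ring.
rewrite /Psi hinvM.
have -> : hmul (hinv (0, 0, pi * lambda^-1 ^+ 2)) (hinv q) = hmul (hinv q) (0, 0, - (pi * lambda^-1 ^+ 2)).
  by rewrite /hmul /hinv /=; congr (_, _, _); ring.
by rewrite -beta_mul beta_central // gt_eqF.
Qed.

Lemma fourier_quot_Xray z : fourier_quot lambda (Xray lambda f) n F z =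
  cintegral leb `[0, 2 * pi / lambda[ (fun s => beta h (gamma lambda s) V z).
Proof.
have [_ gi _] := Xray_spec l0 fi.
have mD := measurable_fund_domain lambda.
have -> : fourier_quot lambda (Xray lambda f) n F z =
    cintegral hm (fund_domain lambda) (fun q => Xray lambda f q * Psi z q).
  by rewrite /fourier_quot -/h (bochner_integralE h fF mD gi).
rewrite (Xray_pairing l0 fi (mPsi z) (Psi_le z)).
rewrite (helix_pairing l0 fi (mPsi z) (Psi_le z) (Psi_invariant z)).
(* At a fixed z, beta_h(gamma(s)) is a scalar times evaluation at another point, so it passes under
   the integral that defines V; then (p gamma(s)^-1)^-1 = gamma(s) p^-1. *)
apply: eq_cintegral => s _; rewrite betaE VE /beta_pos.
have [_ ii] := bochner_exists h fF measurableT fi.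
rewrite -cintegralZ //.
apply: eq_cintegral => p _; rewrite /Psi hinvM.
have -> : hinv (hinv (gamma lambda s)) = gamma lambda s.
  by case: (gamma _ _) => [[a b] c]; rewrite /hinv /= !opprK.
by rewrite -beta_mul betaE /beta_pos mulrCA.
Qed.

End Main.

Theorem theorem2 (R : realType) (f : heis R -> R[i])
    (hf : cintegrable (@heis_measure R) setT f)
    (n : int) (hn : n != 0) (lambda : R) (hlambda : 0 < lambda)
    (r : R) (hr : 0 < r) (F : R[i] -> R[i]) (hF : fock F) :
  fourier_quot lambda (Xray lambda f) n F
  = (fun zeta : R[i] =>
       (2 * pi / lambda)%:C *
       J r n (fourier_H f (n%:~R * lambda ^+ 2) F) zeta).
Proof.
apply/funext => z; rewrite (fourier_quot_Xray n hf hlambda hF).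
have m0 : (0 < `|n|)%N by rewrite absz_gt0.
have [hV _] := fock_fourier_H n lambda hf hF.
rewrite (integral_beta_gamma hlambda m0 z hV (erefl _)).
by rewrite (J_beta_gamma hlambda m0 z hV hr (erefl _)).
Qed.
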